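(* Let $\rho : G \to O(V)$ be an orthogonal representation of a finite group $G$ on a real finite-dimensional Euclidean vector space $V$, and assume that $\rho$ has property $(\mathcal{B}_k)$. Let $d=d(\rho)$ and let $c : \mathbb{R} \to V/G = \sigma(V) \subseteq \mathbb{R}^n$ be a curve of class $C^{k+2d}$. Then there exists a global twice differentiable lift $\bar{c} : \mathbb{R}\to V$ of $c$.
   Context: Let $\mathbb{R}[V]^G$ be the (finitely generated) algebra of $G$-invariant real polynomials on $V$, let $\sigma_1,\ldots,\sigma_n$ be homogeneous generators of positive degree, and $\sigma=(\sigma_1,\ldots,\sigma_n):V\to\mathbb{R}^n$ the orbit map; $V/G$ is identified with $\sigma(V)\subseteq\mathbb{R}^n$ via the homeomorphism induced by $\sigma$. A curve in $V/G$ is of class $C^k$ if it is $C^k$ as a curve in $\mathbb{R}^n$ (independent of the choice of generators). A lift of a curve $c$ in $\sigma(V)$ is a curve $\bar c$ in $V$ with $\sigma\circ\bar c=c$; a local lift near $t_0$ is a lift of the restriction of $c$ to an open neighborhood of $t_0$. A differentiable lift has locally bounded derivative if $\|\bar c'\|$ is bounded on compact subsets of its domain. $\rho$ has property $(\mathcal{B}_k)$ if there exists a neighborhood $U$ of $0$ in $V/G=\sigma(V)$ such that each $C^k$-curve in $U$ admits (near each parameter value) a local differentiable lift to $V$ with locally bounded derivative. Here $k\in\{0,1,2,\ldots,\infty,\omega\}$ ($C^\omega$ meaning real analytic), with $\infty+m=\infty$, $\omega+m=\omega$ for integers $m$. $d(\rho)$ is the maximum of the degrees of the elements of a minimal system of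 homogeneous generators of positive degree of $\mathbb{R}[V]^G$ (independent of the choice of minimal system). *)

(* Defs.v *)
From HB Require Import structures.
(* The notations of mpoly clash with those of all_analysis. *)
From mathcomp Require Import -(notations) mpoly.
From mathcomp Require Import all_boot all_order all_algebra.
From mathcomp Require Import all_fingroup all_character.
From mathcomp Require Import all_classical all_reals all_analysis.

Set Implicit Arguments.
Unset Strict Implicit.
Unset Printing Implicit Defensive.

Import Order.TTheory GRing.Theory Num.Theory numFieldNormedType.Exports.
Local Open Scope classical_set_scope.
Local Open Scope ring_scope.

(* Euclidean spaces are R^m with orthonormal coordinates, as column vectors, so
   that g acts by v |-> rG g *m v.  The library norm on 'cV[R]_m is the sup
   norm; it is used only for derivatives, topology and boundedness, which do
   not distinguish it from the Euclidean norm. *)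

Section Invariants.
Context (R : realType) (gT : finGroupType) (G : {group gT}) (m : nat).
Implicit Types (rG : mx_representation R G m) (p : mpoly m R) (v : 'cV[R]_m).

Definition orthogonal_repr rG : Prop :=
  forall g, g \in G -> (rG g)^T *m rG g = 1%:M.

Definition poly_fun p v : R := meval (fun i => v i 0) p.

Definition invariant_poly rG p : Prop :=
  forall g, g \in G -> forall v, poly_fun p (rG g *m v) = poly_fun p v.

(* As usual in a graded algebra, 0 counts as homogeneous of every degree. *)
Definition homogeneous_generators rG n (s : n.-tuple (mpoly m R)) : Prop :=
  [/\ forall i, invariant_poly rG (tnth s i),
      forall i, exists2 e, (0 < e)%N & tnth s i \is ishomog1 e mdeg
    & forall p, invariant_poly rG p ->
        exists q : mpoly n R, p = comp_mpoly s q].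

Definition minimal_generators rG (s : seq (mpoly m R)) : Prop :=
  homogeneous_generators rG (in_tuple s) /\
  forall s' : seq (mpoly m R), subseq s' s ->
    homogeneous_generators rG (in_tuple s') -> s' = s.

(* A minimal system does not contain 0, and the degree of p != 0 is
   (msize p).-1; the maximum of the empty system is 0. *)
Definition max_generator_degree rG (d : nat) : Prop :=
  exists2 s : seq (mpoly m R), minimal_generators rG s
    & d = \max_(p <- s) (msize p).-1.

Definition orbit_map n (s : n.-tuple (mpoly m R)) v : 'cV[R]_n :=
  \col_i poly_fun (tnth s i) v.

End Invariants.

Inductive smoothness := Cfin of nat | Cinfty | Comega.

Definition smooth_add (k : smoothness) (j : nat) : smoothness :=
  if k is Cfin i then Cfin (i + j) else k.

Section Curves.
Context (R : realType) (V : normedModType R).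
Implicit Types (I : set R) (f : R -> V).

(* The set I is meant to be open, so that the (total) derivatives of f at the
   points of I depend only on the restriction of f to I. *)
Definition Cn_on (n : nat) I f : Prop :=
  (forall j t, (j < n)%N -> I t -> derivable (derive1n j f) t 1) /\
  (forall j t, (j <= n)%N -> I t -> {for t, continuous (derive1n j f)}).

Definition analytic_on I f : Prop :=
  forall t0, I t0 -> exists a : nat -> V,
    \forall t \near t0, series (fun j => (t - t0) ^+ j *: a j) @ \oo --> f t.

Definition of_class (k : smoothness) I f : Prop :=
  match k with
  | Cfin n => Cn_on n I f
  | Cinfty => forall n, Cn_on n I f
  | Comega => analytic_on I f
  end.

Definition differentiable_on I f : Prop := forall t, I t -> derivable f t 1.

Definition locally_bounded_derivative I f : Prop :=
  forall K : set R, compact K -> K `<=` I -> [bounded derive1 f t | t in K].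

End Curves.

Section Lifts.
Context (R : realType) (m n : nat) (s : n.-tuple (mpoly m R)).

Definition lift_on (I : set R) (c : R -> 'cV[R]_n) (b : R -> 'cV[R]_m) : Prop :=
  forall t, I t -> orbit_map s (b t) = c t.

(* U is a neighborhood of 0 for the subspace topology of the image of the orbit
   map; curves are defined on arbitrary open intervals. *)
Definition property_B (k : smoothness) : Prop :=
  exists U : set 'cV[R]_n,
    [/\ U `<=` range (orbit_map s),
        within (range (orbit_map s)) (nbhs (0 : 'cV[R]_n)) U
      & forall (I : set R) (c : R -> 'cV[R]_n),
          open I -> is_interval I -> of_class k I c ->
          (forall t, I t -> U (c t)) ->
          forall t0, I t0 ->
          exists (J : set R) (b : R -> 'cV[R]_m),
            [/\ open J /\ J t0, J `<=` I, lift_on J c b,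
                differentiable_on J b & locally_bounded_derivative J b]].

End Lifts.

(* Main.v *)
Require Import Defs.
From HB Require Import structures.
From mathcomp Require Import -(notations) mpoly.
From mathcomp Require Import all_boot all_order all_algebra.
From mathcomp Require Import all_fingroup all_character.
From mathcomp Require Import all_classical all_reals all_analysis.
From mathcomp Require Import ring lra zify.

Set Implicit Arguments.
Unset Strict Implicit.
Unset Printing Implicit Defensive.

Import Order.TTheory GRing.Theory Num.Theory numFieldNormedType.Exports.
Local Open Scope classical_set_scope.
Local Open Scope ring_scope.

(** Near a parameter t a lift is sought in the form
      b x = v + (x - t) w + (x - t)^2 u x
    with v over c t and a differentiable u whose derivative is bounded.  Such a b is
    differentiable, and so is its derivative at t, because u' enters it with
    the factor (x - t)^2 (second_order_lift).

    The coefficients v and w, and the curve of orbits that u has to lift, are found by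
    a blow-up (blowup), which is applied twice.  Choose lifts of c, without any regularity,
    that tend to v at t.  The group is replaced by the stabilizer K of v, and its
    invariants by the Taylor components at v of the given generators.  These generate
    the K-invariants (slice_gen) and have degree at most d.  Although the chosen lift
    is irregular, K-invariants are as regular along it as c is (slice_regular): they
    are simple roots of polynomials whose coefficients are invariants of the larger
    group, provided that they separate v from the rest of its orbit, and this is true
    of the linear form <., v> and of p + la <., v> for each K-invariant p and large
    la.  The components of degree j of the lift minus v are
    O(|x - t|^j), since the squared length of this difference is a nonnegative
    regular function that vanishes at t.  Hence they can be divided by (x - t)^j.
    Each blow-up costs d orders of differentiability, and the property B_k passes
    from a group to the stabilizers of points (slice_lifting), because
    curves near 0 can be moved to curves near v.  After two blow-ups a curve of class
    C^k remains, and B_k provides u.  Simple roots and division by x - t have to be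
    treated for the three classes separately (gC_hensel, gC_quot, ganalytic_hensel,
    ganalytic_quot).

    What remains is to choose the local lifts coherently.  The 1-jets at t of the local
    lifts form one orbit of the finite group in the space of 1-jets, and the lift above
    shows that near each t these orbits have a selection that is differentiable at t.
    A family of orbits with this property has a global differentiable selection
    (differentiable_selection), and the base points of the selected jets are
    the required lift.  To find it, selections on adjacent intervals are glued after
    acting on one of them by a group element, which is possible because one-sided jets
    of selections are again jets of the local ones (one_sided_jet).  The
    parameters at which this procedure stops would form a closed set without isolated
    points; at a point of it with the smallest stabilizer, the local selection
    is fixed by this stabilizer on the whole set nearby, and it fits together
    with the selections on the complementary intervals (all_good). *)

(** * First order expansions at a point *)

Lemma fin_pos (R : realType) (I : finType) (P : I -> R -> Prop) :
  (forall i c c', P i c -> 0 < c' -> c' <= c -> P i c') ->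
  (forall i, exists2 c, 0 < c & P i c) ->
  exists2 c, 0 < c & forall i, P i c.
Proof.
move=> Pmono Pex.
have /choice [f fP] : forall i, exists c, 0 < c /\ P i c.
  by move=> i; have [c c0 Pc] := Pex i; exists c.
pose c := \big[Order.min/1]_i f i.
have c0 : 0 < c.
  rewrite /c; elim/big_ind: _ => //= [x y x0 y0|i _]; last by have [] := fP i.
  by rewrite lt_min x0.
exists c => // i; have [fi0 Pfi] := fP i; apply: Pmono Pfi c0 _.
by rewrite /c (bigD1 i) //= ge_min lexx.
Qed.

Section Dv.
Context (R : realType) (W : normedModType R).
Implicit Types (t : R) (f : R -> W) (l : W).

(** The epsilon-delta form of having derivative l at t.  It concerns one point
    only, so expansions obtained on the two sides of t can be put together. *)
Definition dv t f l := forall e, 0 < e -> exists2 d, 0 < d &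
  forall s, `|s - t| < d -> `|f s - f t - (s - t) *: l| <= e * `|s - t|.

Lemma dvP t f l : dv t f l <-> is_derive t 1 f l.
Proof.
have quot s : s != t -> `|f s - f t - (s - t) *: l| =
    `|s - t| * `|(s - t)^-1 *: (f s - f t) - l|.
  move=> st; rewrite -normrZ scalerBr scalerA mulfV ?subr_eq0 //.
  by rewrite scale1r.
split=> [H|H].
- have : (fun h => h^-1 *: (f (h + t) - f t)) @ 0^' --> l.
    apply/cvgrPdist_le => e e0; have [d d0 Hd] := H _ e0.
    rewrite near_withinE; apply/nbhs_ballP; exists d => // h.
    rewrite /ball /= sub0r normrN => hd h0.
    have /Hd : `|h + t - t| < d by rewrite addrK.
    have /quot -> : h + t != t by rewrite -subr_eq0 addrK.
    by rewrite addrK mulrC ler_pM2r ?normr_gt0 // distrC.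
  move=> Hl; have Hl' : (fun h => h^-1 *: ((f \o shift t) (h *: 1) - f t)) @ 0^' --> l.
    by under eq_fun do rewrite /= [_ *: 1]mulr1.
  by split; [apply/cvg_ex; exists l | apply: cvg_lim].
- case: H => /cvg_ex[l' Hl'] Dl.
  have ll' : l' = l by rewrite -Dl; apply/esym; apply: cvg_lim.
  rewrite {}ll' in Hl'.
  move=> e e0; move/cvgrPdist_le : Hl' => /(_ _ e0).
  rewrite near_withinE /= => /nbhs_ballP [d d0 Hd].
  exists d => // s sd.
  have [->|st] := eqVneq s t.
    by rewrite !subrr scale0r subr0 !normr0 mulr0.
  rewrite quot // mulrC ler_pM2r ?normr_gt0 ?subr_eq0 //.
  have := Hd (s - t); rewrite /ball /= sub0r normrN => /(_ sd).
  by rewrite subr_eq0 => /(_ st); rewrite /= [_ *: 1]mulr1 subrK distrC.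
Qed.

Lemma dv_cont t f l : dv t f l -> {for t, continuous f}.
Proof.
move=> /dvP [fd _]; apply: differentiable_continuous.
exact/derivable1_diffP.
Qed.

Lemma dv_ext t f g l d : 0 < d -> (forall s, `|s - t| < d -> f s = g s) ->
  dv t f l -> dv t g l.
Proof.
move=> d0 fg H e e0; have [d' d'0 Hd] := H e e0.
exists (Num.min d d'); first by rewrite lt_min d0.
move=> s; rewrite lt_min => /andP[sd sd'].
by rewrite -!fg ?subrr ?normr0 //; exact: Hd.
Qed.

Lemma dv_close t f l : dv t f l -> forall e, 0 < e -> exists2 d, 0 < d &
  forall s, `|s - t| < d -> `|f s - f t| < e.
Proof.
move=> /dv_cont /cvgrPdist_lt H e e0; have /nbhs_ballP [d d0 Hd] := H e e0.
by exists d => // s sd; rewrite distrC; apply: Hd; rewrite /ball /= distrC.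
Qed.
End Dv.

(** A continuous function that avoids the values between p and q stays on one
    side of this gap, by the intermediate value theorem. *)
Lemma no_cross (R : realType) (f : R -> R) (p q a b : R) :
  p < q ->
  (forall x, Num.min a b <= x <= Num.max a b ->
     {for x, continuous f} /\ (f x <= p \/ q <= f x)) ->
  f a <= p -> f b <= p.
Proof.
move=> pq H fa.
have bab : Num.min a b <= b <= Num.max a b by rewrite ge_min le_max lexx !orbT.
have [_ [//|qfb]] := H b bab.
pose v := (p + q) / 2.
have pv : p < v by rewrite /v; lra.
have vq : v < q by rewrite /v; lra.
suff [c cab fc] : exists2 c, Num.min a b <= c <= Num.max a b & f c = v.
  by have [_ ] := H c cab; rewrite fc => -[]; rewrite leNgt ?pv ?vq.
have fav : f a <= v by exact: le_trans fa (ltW pv).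
have vfb : v <= f b by exact: le_trans (ltW vq) qfb.
have [ab|ba] := leP a b.
  have [||c] := @IVT R f a b v ab.
  - apply: continuous_in_subspaceT => x; rewrite inE /= in_itv /= => xab.
    by have [] := H x; rewrite // (min_idPl ab) (max_idPr ab).
  - by rewrite ge_min fav le_max vfb orbT.
  by rewrite in_itv /= => cab fc; exists c.
have [||c] := @IVT R f b a v (ltW ba).
- apply: continuous_in_subspaceT => x; rewrite inE /= in_itv /= => xab.
  by have [] := H x; rewrite // (min_idPr (ltW ba)) (max_idPl (ltW ba)).
- by rewrite ge_min fav le_max vfb !orbT.
by rewrite in_itv /= => cab fc; exists c.
Qed.

Section Between.
Context (R : realType).
Implicit Types s r x y : R.

Lemma between_sub s r x y : Num.min s r <= x <= Num.max s r ->
  Num.min s x <= y <= Num.max s x -> Num.min s r <= y <= Num.max s r.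
Proof.
rewrite !ge_min !le_max => /andP[/orP[] h1 /orP[] h2] /andP[/orP[] h3 /orP[] h4];
  apply/andP; split; apply/orP; first [by left; lra|by right; lra].
Qed.

Lemma between_cover s r x y : Num.min r x <= y <= Num.max r x ->
  Num.min s r <= y <= Num.max s r \/ Num.min s x <= y <= Num.max s x.
Proof.
rewrite !ge_min !le_max; have [ys|/ltW ->] := leP y s; rewrite ?orbT /=.
  by move=> /andP[/orP[->|->] _]; rewrite ?orbT /=; [left|right].
by move=> /andP[_ /orP[->|->]]; rewrite ?orbT /=; [left|right].
Qed.

Lemma between_ball s r x e : `|r - s| < e ->
  Num.min s r <= x <= Num.max s r -> `|x - s| < e.
Proof.
rewrite ge_min le_max !ltr_norml => /andP[h1 h2] /andP[/orP[] h3 /orP[] h4];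
  apply/andP; split; lra.
Qed.
End Between.

(** * Differentiable selections from the orbits of a finite group *)

Section Selection.
Context (R : realType) (W : normedModType R) (gT : finGroupType).
Context (G : {group gT}) (act : gT -> W -> W) (C : R).
Hypothesis act1 : forall u, act 1%g u = u.
Hypothesis actM : forall g h, g \in G -> h \in G ->
  forall u, act (g * h)%g u = act g (act h u).
Hypothesis act_lin : forall g, g \in G -> forall a u v,
  act g (a *: u + v) = a *: act g u + act g v.
Hypothesis act_norm : forall g, g \in G -> forall u, `|act g u| <= C * `|u|.
Hypothesis C_ge1 : 1 <= C.

Let C_gt0 : 0 < C. Proof. exact: lt_le_trans C_ge1. Qed.

Lemma act0 g : g \in G -> act g 0 = 0.
Proof.
move=> gG; apply/eqP; rewrite -normr_le0.
by rewrite (le_trans (act_norm gG _)) // normr0 mulr0.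
Qed.

Lemma actZ g a u : g \in G -> act g (a *: u) = a *: act g u.
Proof. by move=> gG; rewrite -[in LHS](addr0 (a *: u)) act_lin // act0 // addr0. Qed.

Lemma actD g u v : g \in G -> act g (u + v) = act g u + act g v.
Proof. by move=> gG; rewrite -[in LHS](scale1r u) act_lin // scale1r. Qed.

Lemma actB g u v : g \in G -> act g (u - v) = act g u - act g v.
Proof. by move=> gG; rewrite actD // -scaleN1r actZ // scaleN1r. Qed.

Lemma actVK g u : g \in G -> act g^-1%g (act g u) = u.
Proof. by move=> gG; rewrite -actM ?groupV // mulVg act1. Qed.

Lemma dv_act g t f l : g \in G -> dv t f l -> dv t (fun s => act g (f s)) (act g l).
Proof.
move=> gG H e e0; have [d d0 Hd] := H (e / C) (divr_gt0 e0 C_gt0).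
exists d => // s /Hd {}Hd.
rewrite -actB // -actZ // -actB //; apply: le_trans (act_norm gG _) _.
apply: le_trans (ler_wpM2l (ltW C_gt0) Hd) _.
by rewrite mulrA mulrCA divff ?mulr1 // gt_eqF.
Qed.

Definition op (A : set R) := forall t, A t ->
  exists2 d, 0 < d & forall s, `|s - t| < d -> A s.

Definition convex_set (A : set R) := forall x y z, A x -> A z -> x <= y <= z -> A y.

Context (E : R -> W -> Prop).
Hypothesis E_orbit : forall t u v, E t u -> E t v -> exists2 g, g \in G & v = act g u.
Hypothesis E_act : forall t u g, g \in G -> E t u -> E t (act g u).

Definition local_at t b l := (exists2 d, 0 < d & forall s, `|s - t| < d -> E s (b s)) /\
  dv t b l.
Hypothesis E_local : forall t, exists b l, local_at t b l.

Definition selat t (f : R -> W) := E t (f t) /\ exists l, dv t f l.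

Lemma local_at_E t b l : local_at t b l -> E t (b t).
Proof. by case=> -[d d0 Hd] _; apply: Hd; rewrite subrr normr0. Qed.

Lemma local_at_act g t b l : g \in G -> local_at t b l ->
  local_at t (fun s => act g (b s)) (act g l).
Proof.
move=> gG [[d d0 Hd] H]; split; last exact: dv_act.
by exists d => // s sd; apply: E_act => //; exact: Hd.
Qed.

(** The group is transitive on E t, so that some group element moves a given
    local selection through u. *)
Lemma local_from t u : E t u -> exists b l, local_at t b l /\ b t = u.
Proof.
move=> Eu; have [b [l H]] := E_local t.
have [g gG ->] := E_orbit (local_at_E H) Eu.
by exists (fun s => act g (b s)), (act g l); split => //; exact: local_at_act.
Qed.

Lemma selat_ext t f g d : 0 < d -> (forall s, `|s - t| < d -> f s = g s) ->
  selat t f -> selat t g.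
Proof.
move=> d0 fg [Et [l H]]; split; last by exists l; apply: dv_ext H; eassumption.
by rewrite -fg // subrr normr0.
Qed.

Lemma selat_act t f g : g \in G -> selat t f -> selat t (fun s => act g (f s)).
Proof. by move=> gG [Et [l H]]; split; [exact: E_act|exists (act g l); exact: dv_act]. Qed.

(** The sign sg is 1 for the right and -1 for the left.  The limit u is kept
    apart from f t, because at t the curve f is yet to be defined. *)
Definition side_dv (sg t : R) f (u l : W) := forall e, 0 < e -> exists2 d, 0 < d &
  forall s, 0 < s -> s < d -> `|f (t + sg * s) - u - (sg * s) *: l| <= e * s.

(** Two affine curves that differ are at least at linear distance near the
    parameter 0: their values differ there, or else their slopes do. *)
Lemma affine_apart (sg : R) (u1 l1 u2 l2 : W) : `|sg| = 1 ->
  exists2 c, 0 < c & forall s, 0 < s -> s < c -> (u1 = u2 /\ l1 = l2) \/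
    c * s <= `|(u1 + (sg * s) *: l1) - (u2 + (sg * s) *: l2)|.
Proof.
move=> sg1.
have eqn s : (u1 + (sg * s) *: l1) - (u2 + (sg * s) *: l2) =
    (u1 - u2) + (sg * s) *: (l1 - l2).
  by rewrite scalerBr opprD addrACA.
have [uE|u12] := eqVneq u1 u2.
  have [lE|l12] := eqVneq l1 l2; first by exists 1 => // s s0 s1; left.
  exists `|l1 - l2|; first by rewrite normr_gt0 subr_eq0.
  move=> s s0 _; right; rewrite eqn uE subrr add0r normrZ normrM sg1 mul1r.
  by rewrite gtr0_norm // mulrC.
have D0 : 0 < `|u1 - u2| by rewrite normr_gt0 subr_eq0.
have L0 : 0 < 1 + `|l1 - l2| by rewrite ltr_pwDl.
exists (Num.min 1 (`|u1 - u2| / (2 * (1 + `|l1 - l2|)))).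
  by rewrite lt_min ltr01 divr_gt0 // mulr_gt0.
move=> s s0; rewrite lt_min => /andP[s1 sD]; right; rewrite eqn.
apply: le_trans (lerB_normD _ _).
rewrite normrZ normrM sg1 mul1r (gtr0_norm s0).
move: sD; rewrite ltr_pdivlMr ?mulr_gt0 // => sD.
set c := Num.min _ _; have c1 : c <= 1 by rewrite ge_min lexx.
have cs : c * s <= s by rewrite -[leRHS]mul1r ler_pM2r.
move: (c * s) cs sD D0 => cs; move: `|u1 - u2| => X; move: `|l1 - l2| => Y.
by rewrite mulrCA mulrDr mulr1; move: (s * Y) => sY; lra.
Qed.

(** At each t near t0 the value of f is o(t - t0)-close to one of the finitely many
    affine curves h (b t0) + (t - t0) h l.  Distinct ones are at distance c |t - t0| at least,
    and the continuous quotient of |f - A g| by |t - t0| cannot cross the gap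
    between c / 4 and 3 c / 4, so that f follows a single one of them. *)
Lemma one_sided_jet (sg t0 a : R) f b l : `|sg| = 1 -> 0 < a ->
  (forall s, 0 < s -> s < a -> selat (t0 + sg * s) f) ->
  local_at t0 b l ->
  exists2 g, g \in G & side_dv sg t0 f (act g (b t0)) (act g l).
Proof.
move=> sg1 a0 fsel [[d0 d0_gt0 Eb] Hb].
pose A g s := act g (b t0) + (sg * s) *: act g l.
have [c c0 Hc] : exists2 c, 0 < c & forall gh : gT * gT,
    forall s, 0 < s -> s < c -> (act gh.1 (b t0) = act gh.2 (b t0) /\ act gh.1 l = act gh.2 l) \/
    c * s <= `|A gh.1 s - A gh.2 s|.
  apply: fin_pos => [gh c c' H c'0 c'c s s0 sc'|gh]; last exact: affine_apart.
  have [|?] := H s s0 (lt_le_trans sc' c'c); first by left.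
  by right; apply: le_trans; [|eassumption]; rewrite ler_pM2r.
have near e : 0 < e -> exists2 d, 0 < d & forall s, 0 < s -> s < d ->
    exists2 h, h \in G & f (t0 + sg * s) = act h (b (t0 + sg * s)) /\
      `|f (t0 + sg * s) - A h s| <= e * s.
  move=> e0; have [d d_gt0 Hd] := Hb (e / C) (divr_gt0 e0 C_gt0).
  exists (Num.min d (Num.min d0 a)); first by rewrite !lt_min d_gt0 d0_gt0.
  move=> s s0; rewrite !lt_min => /and3P[sd sd0 sa].
  have ns : `|t0 + sg * s - t0| = s by rewrite addrAC subrr add0r normrM sg1 mul1r gtr0_norm.
  have /Eb Es : `|t0 + sg * s - t0| < d0 by rewrite ns.
  have [Ef _] := fsel s s0 sa.
  have [h hG fE] := E_orbit Es Ef; exists h => //; split=> //.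
  rewrite fE /A opprD addrA -actB // -actZ // -actB //.
  apply: le_trans (act_norm hG _) _.
  have := Hd (t0 + sg * s); rewrite ns => /(_ sd).
  rewrite (_ : t0 + sg * s - t0 = sg * s); last by rewrite addrAC subrr add0r.
  move=> {}Hd; apply: le_trans (ler_wpM2l (ltW C_gt0) Hd) _.
  by rewrite mulrA mulrCA divff ?mulr1 // gt_eqF.
have c4 : 0 < c / 4 by rewrite divr_gt0.
have [d1 d1_gt0 H1] := near _ c4.
pose d2 := Num.min d1 (Num.min a c).
have d2_gt0 : 0 < d2 by rewrite !lt_min d1_gt0 a0.
have d2P s : s < d2 -> [/\ s < d1, s < a & s < c].
  by rewrite !lt_min => /and3P.
pose s1 := d2 / 2.
have s1_gt0 : 0 < s1 by rewrite divr_gt0.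
have s1d2 : s1 < d2 by rewrite /s1; lra.
have [g gG [_ Hg]] := H1 s1 s1_gt0 (let: And3 x _ _ := d2P _ s1d2 in x).
exists g => //.
have gapg s : 0 < s -> s < d2 -> s^-1 * `|f (t0 + sg * s) - A g s| <= c / 4 \/
    3 * c / 4 <= s^-1 * `|f (t0 + sg * s) - A g s|.
  move=> s0 /d2P[sd1 sa sc].
  have [h hG [_ Hh]] := H1 s s0 sd1.
  have [[e1 e2]|sep] := Hc (h, g) s s0 sc.
    left; rewrite ler_pdivrMl // [s * _]mulrC.
    by move: e1 e2 Hh => /= e1 e2; rewrite /A e1 e2.
  right; rewrite ler_pdivlMl //=.
  have := ler_distD (f (t0 + sg * s)) (A h s) (A g s).
  rewrite (distrC (A h s) (f _)) => tri; move: (le_trans sep tri) Hh => /=.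
  by set X := `|_|; set Y := `|_|; lra.
have stay s : 0 < s -> s < d2 -> s^-1 * `|f (t0 + sg * s) - A g s| <= c / 4.
  move=> s0 sd2.
  apply: (@no_cross _ (fun s => s^-1 * `|f (t0 + sg * s) - A g s|) (c/4) (3 * c / 4) s1).
  - by lra.
  - move=> x xss.
    have [x0 xd2] : 0 < x /\ x < d2.
      case/andP: xss => h1 h2; split.
        by apply: lt_le_trans h1; rewrite lt_min s1_gt0 s0.
      by apply: le_lt_trans h2 _; rewrite gt_max s1d2 sd2.
    split; last exact: gapg.
    have [_ xa _] := d2P _ xd2.
    have [_ [l' /dv_cont fc]] := fsel x x0 xa.
    have affc : {for x, continuous (fun y => t0 + sg * y)}.
      by apply: cvgD; [exact: cvg_cst|apply: cvgM; [exact: cvg_cst|exact: cvg_id]].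
    apply: cvgM; first by apply: cvgV; [rewrite gt_eqF|exact: cvg_id].
    apply: cvg_norm; apply: cvgB; first exact: (@continuous_comp _ _ _ (fun y => t0 + sg * y) f).
    apply: cvgD; first exact: cvg_cst.
    apply: cvgZr_tmp; apply: cvgM; [exact: cvg_cst|exact: cvg_id].
  - by rewrite ler_pdivrMl // [s1 * _]mulrC.
move=> e e0; pose e' := Num.min e (c / 4).
have e'0 : 0 < e' by rewrite lt_min e0.
have [d3 d3_gt0 H3] := near _ e'0.
exists (Num.min d2 d3); first by rewrite lt_min d2_gt0.
move=> s s0; rewrite lt_min => /andP[sd2 sd3].
have [h hG [_ Hh]] := H3 s s0 sd3.
have [_ _ sc] := d2P _ sd2.
have e'e : e' <= e by rewrite ge_min lexx.
have e'c : e' <= c / 4 by rewrite ge_min lexx orbT.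
rewrite -addrA -opprD -/(A g s).
have [[e1 e2]|sep] := Hc (h, g) s s0 sc.
  rewrite (_ : A g s = A h s); last by move: e1 e2 => /= e1 e2; rewrite /A e1 e2.
  by apply: le_trans Hh _; rewrite ler_pM2r.
have := stay s s0 sd2; rewrite ler_pdivrMl // => stays.
exfalso; have := ler_distD (f (t0 + sg * s)) (A h s) (A g s).
rewrite (distrC (A h s) (f _)) => tri; move: (le_trans sep tri) Hh stays => /=.
have : e' * s <= c / 4 * s by rewrite ler_pM2r.
have := mulr_gt0 c0 s0.
by set X := `|_|; set Y := `|_|; lra.
Qed.

(** The jets of f1 and f2 at t0 lie in one orbit, that of the jet of b; one group
    element therefore matches values and derivatives at the same time. *)
Lemma glue_right t0 a f1 f2 : 0 < a ->
  (forall t, t0 - a < t -> t < t0 -> selat t f1) ->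
  (forall t, t0 < t -> t < t0 + a -> selat t f2) ->
  exists f g, [/\ g \in G, selat t0 f, forall t, t < t0 -> f t = f1 t
    & forall t, t0 < t -> f t = act g (f2 t)].
Proof.
move=> a0 H1 H2; have [b [l0 Hb]] := E_local t0.
have [g1 g1G J1] : exists2 g, g \in G & side_dv (-1) t0 f1 (act g (b t0)) (act g l0).
  apply: (@one_sided_jet (-1) t0 a) => //; first by rewrite normrN1.
  by move=> s s0 sa; apply: H1; lra.
have [g2 g2G J2] : exists2 g, g \in G & side_dv 1 t0 f2 (act g (b t0)) (act g l0).
  apply: (@one_sided_jet 1 t0 a) => //; first by rewrite normr1.
  by move=> s s0 sa; apply: H2; lra.
pose g := (g1 * g2^-1)%g; have gG : g \in G by rewrite groupM ?groupV.
have gg2 u : act g (act g2 u) = act g1 u by rewrite -actM // /g mulgKV.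
exists (fun t => if t < t0 then f1 t else if t == t0 then act g1 (b t0) else act g (f2 t)), g.
split=> //; last 2 first.
- by move=> t ->.
- by move=> t t0t; rewrite ltNge (ltW t0t) /= gt_eqF.
split; first by rewrite ltxx eqxx; apply: E_act => //; exact: local_at_E Hb.
exists (act g1 l0) => e e0.
have [d1 d1_gt0 K1] := J1 e e0.
have [d2 d2_gt0 K2] := J2 (e / C) (divr_gt0 e0 C_gt0).
exists (Num.min d1 d2); first by rewrite lt_min d1_gt0.
move=> s; rewrite lt_min ltxx eqxx => /andP[sd1 sd2].
have [st|t0s|->] := ltgtP s t0; last by rewrite !subrr scale0r subr0 !normr0 mulr0.
- have s0 : 0 < t0 - s by rewrite subr_gt0.
  move: sd1; rewrite distrC gtr0_norm // => /(K1 _ s0).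
  by rewrite !mulN1r !opprB subrKC.
- have s0 : 0 < s - t0 by rewrite subr_gt0.
  move: sd2; rewrite gtr0_norm // => /(K2 _ s0).
  rewrite !mul1r subrKC => K.
  rewrite -!gg2 -actZ // -!actB //; apply: le_trans (act_norm gG _) _.
  apply: le_trans (ler_wpM2l (ltW C_gt0) K) _.
  by rewrite mulrA mulrCA divff ?mulr1 // gt_eqF.
Qed.

Lemma glue_left t0 a f1 f2 : 0 < a ->
  (forall t, t0 - a < t -> t < t0 -> selat t f1) ->
  (forall t, t0 < t -> t < t0 + a -> selat t f2) ->
  exists f g, [/\ g \in G, selat t0 f, forall t, t < t0 -> f t = act g (f1 t)
    & forall t, t0 < t -> f t = f2 t].
Proof.
move=> a0 H1 H2; have [f [g [gG Sf F1 F2]]] := glue_right a0 H1 H2.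
exists (fun t => act g^-1%g (f t)), g^-1%g; rewrite groupV; split=> //.
- by apply: selat_act; rewrite ?groupV.
- by move=> t /F1 ->.
- by move=> t /F2 ->; rewrite actVK.
Qed.

Definition sel_on (A : set R) f := forall t, A t -> selat t f.

Definition good t := exists2 d, 0 < d & exists f, forall s, `|s - t| < d -> selat s f.

Lemma good_op : op good.
Proof.
move=> t [d d0 [f Hf]]; exists (d / 2); first by rewrite divr_gt0.
move=> s sd; exists (d / 2); first by rewrite divr_gt0.
exists f => r rd; apply: Hf; have := ler_distD s r t; lra.
Qed.

Section Interval.
Variable A : set R.
Hypotheses (A_op : op A) (A_convex : convex_set A) (A_good : A `<=` good).

(** The partial selections to which Zorn's lemma is applied.  Convex domains keep
    the number of ends to be extended down to two. *)
Record patch := Patch { dom : set R; fn : R -> W;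
  patchP : [/\ op dom, convex_set dom, dom `<=` A & sel_on dom fn] }.

Definition extends (p q : patch) : bool :=
  `[< dom p `<=` dom q /\ forall t, dom p t -> fn q t = fn p t >].

(** The supremum of the domain is a parameter in A, so that there is a selection
    around it, which can be glued to the end of the patch. *)
Lemma extend_up p t x : dom p t -> A x -> t <= x -> ~ dom p x ->
  exists q, extends p q /\ ~~ extends q p.
Proof.
case: p => D f [Dop Dcv DA Dsel] /= Dt Ax tx nDx.
have ubx : ubound D x.
  move=> y Dy; rewrite leNgt; apply/negP => xy; apply: nDx.
  by apply: (Dcv t x y) => //; rewrite tx ltW.
have hsD : has_sup D by split; [exists t|exists x].
pose be := sup D.
have tbe : t <= be by exact: sup_upper_bound.
have bex : be <= x by apply: ge_sup => //; exists t.
have Abe : A be by apply: (A_convex (DA _ Dt) Ax); rewrite tbe.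
have nDbe : ~ D be.
  move=> /Dop[d d0 Hd]; have /(sup_upper_bound hsD) : D (be + d / 2).
    by apply: Hd; rewrite addrAC subrr add0r gtr0_norm; lra.
  by rewrite -/be; lra.
have Dlt s : D s -> s < be.
  move=> Ds; rewrite lt_neqAle (sup_upper_bound hsD) // andbT.
  by apply/eqP => sbe; apply: nDbe; rewrite -sbe.
have tlt := Dlt t Dt.
have Dbetw s : t <= s -> s < be -> D s.
  move=> ts sbe; have [y Dy sy] := sup_gt (ex_intro _ t Dt) sbe.
  by apply: (Dcv t s y) => //; rewrite ts ltW.
have [dA dA0 HA] := A_op Abe.
have [d d0 [f2 Hf2]] := A_good Abe.
pose a := Num.min (be - t) (Num.min dA d).
have a0 : 0 < a by rewrite !lt_min subr_gt0 tlt dA0.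
have aP s : s < a -> [/\ s < be - t, s < dA & s < d] by rewrite !lt_min => /and3P.
have ltn s : be - a < s -> t < s.
  have : a <= be - t by rewrite ge_min lexx.
  by lra.
have [||g [h [hG Sg g1 g2]]] := @glue_right be a f f2 a0.
- by move=> s /ltn ts sbe; apply: Dsel; apply: Dbetw => //; exact: ltW.
- move=> s bes sa; apply: Hf2; have [] // := aP (s - be); first by lra.
  by rewrite gtr0_norm ?subr_gt0.
pose D' := [set s | D s \/ `|s - be| < a].
have D'P : [/\ op D', convex_set D', D' `<=` A & sel_on D' g].
  split.
  - move=> s [/Dop[e e0 He]|sa].
      by exists e => // r /He; left.
    exists (a - `|s - be|); first by rewrite subr_gt0.
    by move=> r ra; right; have := ler_distD s r be; lra.
  - move=> u v w Du Dw /andP[uv vw]; have [vbe|bev] := ltP v be.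
      case: Du => [Du|ua].
        left; have [tv|vt] := leP t v; first exact: Dbetw.
        by apply: (Dcv u v t) => //; rewrite uv ltW.
      by right; move: ua; rewrite !ltr_norml => /andP[]; lra.
    case: Dw => [/Dlt wbe|wa]; first by lra.
    by right; move: wa; rewrite !ltr_norml => /andP[]; lra.
  - by move=> s [/DA//|/aP[_ ? _]]; exact: HA.
  - move=> s D's; have [sbe|bes|->//] := ltgtP s be.
      have Ds : D s.
        by case: D's => //; rewrite ltr_norml => /andP[? _]; apply: Dbetw => //; apply/ltW/ltn; lra.
      apply: (@selat_ext s f g (be - s)); rewrite ?subr_gt0 //; last exact: Dsel.
      by move=> r; rewrite ltr_norml => /andP[_ ?]; rewrite g1 //; lra.
    apply: (@selat_ext s (fun r => act h (f2 r)) g (s - be)); rewrite ?subr_gt0 //.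
      by move=> r; rewrite ltr_norml => /andP[? _]; rewrite g2 //; lra.
    apply: selat_act => //; apply: Hf2; case: D's => [/Dlt|/aP[]//]; lra.
exists (Patch D'P); split.
  by apply/asboolP; split=> [s Ds|s Ds]; [left|rewrite /= g1 //; exact: Dlt].
apply/asboolP => -[/= sub _]; apply: nDbe; apply: sub; right.
by rewrite subrr normr0.
Qed.

Lemma extend_down p t x : dom p t -> A x -> x <= t -> ~ dom p x ->
  exists q, extends p q /\ ~~ extends q p.
Proof.
case: p => D f [Dop Dcv DA Dsel] /= Dt Ax tx nDx.
have ubx : lbound D x.
  move=> y Dy; rewrite leNgt; apply/negP => xy; apply: nDx.
  by apply: (Dcv y x t) => //; rewrite tx ltW.
have hsD : has_inf D by split; [exists t|exists x].
pose be := inf D.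
have tbe : be <= t by exact: (inf_lbound (proj2 hsD)) Dt.
have bex : x <= be by apply: lb_le_inf => //; exists t.
have Abe : A be by apply: (A_convex Ax (DA _ Dt)); rewrite tbe bex.
have nDbe : ~ D be.
  move=> /Dop[d d0 Hd]; have /(inf_lbound (proj2 hsD)) : D (be - d / 2).
    by apply: Hd; rewrite addrAC subrr add0r normrN gtr0_norm; lra.
  by rewrite -/be; lra.
have Dlt s : D s -> be < s.
  move=> Ds; rewrite lt_neqAle (inf_lbound (proj2 hsD)) // andbT.
  by apply/eqP => sbe; apply: nDbe; rewrite sbe.
have tlt := Dlt t Dt.
have Dbetw s : s <= t -> be < s -> D s.
  move=> ts sbe; have [y Dy sy] := inf_lt (ex_intro _ t Dt) sbe.
  by apply: (Dcv y s t) => //; rewrite ts ltW.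
have [dA dA0 HA] := A_op Abe.
have [d d0 [f2 Hf2]] := A_good Abe.
pose a := Num.min (t - be) (Num.min dA d).
have a0 : 0 < a by rewrite !lt_min subr_gt0 tlt dA0.
have aP s : s < a -> [/\ s < t - be, s < dA & s < d] by rewrite !lt_min => /and3P.
have ltn s : s < be + a -> s < t.
  have : a <= t - be by rewrite ge_min lexx.
  by lra.
have [||g [h [hG Sg g1 g2]]] := @glue_left be a f2 f a0.
- move=> s bes sa; apply: Hf2; have [] // := aP (be - s); first by lra.
  by rewrite distrC gtr0_norm ?subr_gt0.
- by move=> s sbe /ltn ts; apply: Dsel; apply: Dbetw => //; exact: ltW.
pose D' := [set s | D s \/ `|s - be| < a].
have D'P : [/\ op D', convex_set D', D' `<=` A & sel_on D' g].
  split.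
  - move=> s [/Dop[e e0 He]|sa].
      by exists e => // r /He; left.
    exists (a - `|s - be|); first by rewrite subr_gt0.
    by move=> r ra; right; have := ler_distD s r be; lra.
  - move=> u v w Du Dw /andP[uv vw]; have [bev|vbe] := ltP be v.
      case: Dw => [Dw|wa].
        left; have [vt|tv] := leP v t; first exact: Dbetw.
        by apply: (Dcv t v w) => //; rewrite vw ltW.
      by right; move: wa; rewrite !ltr_norml => /andP[]; lra.
    case: Du => [/Dlt wbe|ua]; first by lra.
    by right; move: ua; rewrite !ltr_norml => /andP[]; lra.
  - by move=> s [/DA//|/aP[_ ? _]]; exact: HA.
  - move=> s D's; have [sbe|bes|->//] := ltgtP s be.
      apply: (@selat_ext s (fun r => act h (f2 r)) g (be - s)); rewrite ?subr_gt0 //.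
        by move=> r; rewrite ltr_norml => /andP[_ ?]; rewrite g1 //; lra.
      apply: selat_act => //; apply: Hf2; case: D's => [/Dlt|/aP[]//]; lra.
    have Ds : D s.
      by case: D's => //; rewrite ltr_norml => /andP[_ ?]; apply: Dbetw => //; apply/ltW/ltn; lra.
    apply: (@selat_ext s f g (s - be)); rewrite ?subr_gt0 //; last exact: Dsel.
    by move=> r; rewrite ltr_norml => /andP[? _]; rewrite g2 //; lra.
exists (Patch D'P); split.
  by apply/asboolP; split=> [s Ds|s Ds]; [left|rewrite /= g2 //; exact: Dlt].
apply/asboolP => -[/= sub _]; apply: nDbe; apply: sub; right.
by rewrite subrr normr0.
Qed.

Lemma interval_selection : exists f, sel_on A f.
Proof.
have p0P : [/\ op set0, convex_set set0, set0 `<=` A & sel_on set0 (fun _ => 0)].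
  by split=> // [t [] | x y z []].
have [|||p pmax] := @ZL_preorder patch (Patch p0P) extends.
- by move=> p; apply/asboolP; split.
- move=> q p r /asboolP[pq1 pq2] /asboolP[qr1 qr2]; apply/asboolP; split.
    exact: subset_trans qr1.
  by move=> t Dt; rewrite qr2 ?pq2 //; exact: pq1.
- move=> S Stot.
  have /choice[ch chP] : forall t, exists p, (exists2 q, S q & dom q t) -> S p /\ dom p t.
    move=> t; have [[q Sq qt]|nq] := pselect (exists2 q, S q & dom q t).
      by exists q.
    by exists (Patch p0P).
  pose D := [set t | exists2 q, S q & dom q t].
  have agree q t : S q -> dom q t -> fn (ch t) t = fn q t.
    move=> Sq qt; have [Sc ct] : S (ch t) /\ dom (ch t) t by apply: chP; exists q.
    by have [/asboolP[_ ->]|/asboolP[_ ->]] := Stot _ _ Sc Sq.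
  have DP : [/\ op D, convex_set D, D `<=` A & sel_on D (fun t => fn (ch t) t)].
    split.
    - move=> t [q Sq qt]; have [qop _ _ _] := patchP q; have [d d0 Hd] := qop t qt.
      by exists d => // s /Hd; exists q.
    - move=> x y z [q Sq qx] [r Sr rz] xyz.
      have [qcv rcv] : convex_set (dom q) /\ convex_set (dom r).
        by split; [have [] := patchP q|have [] := patchP r].
      have [/asboolP[qr _]|/asboolP[rq _]] := Stot _ _ Sq Sr.
        by exists r => //; apply: (rcv x y z) => //; exact: qr.
      by exists q => //; apply: (qcv x y z) => //; exact: rq.
    - by move=> t [q _ qt]; have [_ _ qA _] := patchP q; exact: qA.
    - move=> t [q Sq qt]; have [qop _ _ qsel] := patchP q; have [d d0 Hd] := qop t qt.
      apply: (@selat_ext t (fn q) _ d) => //; last exact: qsel.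
      by move=> s /Hd qs; rewrite (agree q).
  exists (Patch DP) => q Sq; apply/asboolP; split; first by move=> t qt; exists q.
  by move=> t qt /=; rewrite (agree q).
have maxP q : ~ (extends p q /\ ~~ extends q p).
  by move=> [/pmax ->].
exists (fn p) => x Ax; have [_ _ _ psel] := patchP p; apply: psel; apply: contrapT => nx.
have [[t pt]|np] := pselect (exists t, dom p t).
  by have [tx|/ltW xt] := leP t x;
    [have [q /maxP] := extend_up pt Ax tx nx|have [q /maxP] := extend_down pt Ax xt nx].
have [dA dA0 HA] := A_op Ax; have [d d0 [f Hf]] := A_good Ax.
pose a := Num.min dA d.
have a0 : 0 < a by rewrite !lt_min dA0.
have aP s : s < a -> s < dA /\ s < d by rewrite !lt_min => /andP.
have qP : [/\ op [set s | `|s - x| < a], convex_set [set s | `|s - x| < a],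
    [set s | `|s - x| < a] `<=` A & sel_on [set s | `|s - x| < a] f].
  split.
  - move=> s /= sa; exists (a - `|s - x|); first by rewrite subr_gt0.
    by move=> r ra; have := ler_distD s r x; lra.
  - by move=> u v w /=; rewrite !ltr_norml => /andP[? ?] /andP[? ?] /andP[? ?]; lra.
  - by move=> s /aP[? _]; exact: HA.
  - by move=> s /aP[_ ?]; exact: Hf.
apply: (maxP (Patch qP)); split.
  by apply/asboolP; split=> [t pt|t pt]; case: np; exists t.
by apply/asboolP => -[/= sub _]; apply: nx; apply: sub; rewrite /= subrr normr0.
Qed.
End Interval.

(** On both sides of t there are selections by interval_selection; they are glued
    at t. *)
Lemma not_isolated t d : 0 < d ->
  (forall s, 0 < `|s - t| -> `|s - t| < d -> good s) -> good t.
Proof.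
move=> d0 H.
have opI x y : op [set s | x < s < y].
  move=> s /= /andP[xs sy]; exists (Num.min (s - x) (y - s)); first by rewrite lt_min !subr_gt0 xs.
  by move=> r; rewrite lt_min !ltr_norml => /andP[/andP[? ?] /andP[? ?]]; apply/andP; split; lra.
have cvI x y : convex_set [set s | x < s < y].
  by move=> u v w /= /andP[? ?] /andP[? ?] /andP[? ?]; apply/andP; split; lra.
have gl : [set s | t - d < s < t] `<=` good.
  move=> s /= /andP[? ?]; apply: H; rewrite distrC gtr0_norm ?subr_gt0 //; lra.
have gr : [set s | t < s < t + d] `<=` good.
  move=> s /= /andP[? ?]; apply: H; rewrite gtr0_norm ?subr_gt0 //; lra.
have [f1 H1] := interval_selection (@opI _ _) (@cvI _ _) gl.
have [f2 H2] := interval_selection (@opI _ _) (@cvI _ _) gr.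
have [||f [g [gG Sf F1 F2]]] := @glue_right t d f1 f2 d0.
- by move=> s ? ?; apply: H1; apply/andP.
- by move=> s ? ?; apply: H2; apply/andP.
exists d => //; exists f => s; rewrite ltr_norml => /andP[? ?].
have [st|ts|->//] := ltgtP s t.
  apply: (@selat_ext s f1 f (t - s)); rewrite ?subr_gt0 //.
    by move=> r; rewrite ltr_norml => /andP[? ?]; rewrite F1 //; lra.
  by apply: H1; apply/andP; split; lra.
apply: (@selat_ext s (fun r => act g (f2 r)) f (s - t)); rewrite ?subr_gt0 //.
  by move=> r; rewrite ltr_norml => /andP[? ?]; rewrite F2 //; lra.
by apply: selat_act => //; apply: H2; apply/andP; split; lra.
Qed.

Definition stab u : {set gT} := [set g in G | act g u == u]%SET.

(** The parameters without a local selection form a closed set.  Take t0 in it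
    such that w0 in E t0 has the smallest possible stabilizer H, and a local b with
    b t0 = w0.  At a nearby bad parameter s the stabilizer of b s is contained in H,
    hence equals H by minimality.  On each component of the good parameters there is
    a selection that stays close to w0, and hence in the H-orbit of b.  Together
    with b on the bad set this defines f, with values in the H-orbit of b.

    At a bad t1 the vector b t1 is fixed by H, and so is the derivative of b
    there: bad parameters accumulate at t1, and b is fixed by H at all of them.
    Hence the expansion of b at t1 is also one of all k (b s) with k in H, so
    that f is differentiable at t1 and t0 was not bad after all. *)
Lemma all_good t : good t.
Proof.
apply: contrapT => nt.
pose P n := `[< exists s u, [/\ ~ good s, E s u & #|stab u| = n] >].
have exP : exists n, P n.
  have [b [l /local_at_E Eb]] := E_local t.
  by exists #|stab (b t)|; apply/asboolP; exists t, (b t).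
have [n /asboolP[t0 [w0 [nt0 Ew0 n_def]]] nmin] := ex_minnP exP.
pose H := stab w0.
have HP g : g \in H -> g \in G /\ act g w0 = w0.
  by rewrite inE => /andP[gG /eqP].
have [b [l0 [[[d0 d0_gt0 Eb] Hb] bt0]]] := local_from Ew0.
have [eta eta0 Heta] : exists2 eta, 0 < eta & forall g, g \in G -> g \notin H ->
    eta <= `|act g w0 - w0|.
  have [c c0 Hc] : exists2 c, 0 < c & forall g, g \in G -> g \notin H -> c <= `|act g w0 - w0|.
    apply: (@fin_pos R gT (fun g c => g \in G -> g \notin H -> c <= `|act g w0 - w0|)).
      by move=> g c c' Hc _ c'c gG gH; apply: le_trans (Hc gG gH).
    move=> g; have [gw|gw] := eqVneq (act g w0) w0.
      by exists 1 => // gG; rewrite inE gG gw eqxx.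
    by exists `|act g w0 - w0|; rewrite // normr_gt0 subr_eq0.
  by exists c.
(* de is so small that H moves no point of the ball of radius de around w0 farther
   than eta / 4 from w0, while the other elements keep it beyond 3 eta / 4. *)
pose de := eta / (4 * C).
have de0 : 0 < de by rewrite divr_gt0 // mulr_gt0.
have Cde : C * de = eta / 4.
  by rewrite /de; field; rewrite gt_eqF.
have dele : de <= eta / 4 by rewrite -Cde ler_peMl // ltW.
have dele3 : de <= 3 * eta / 4 by lra.
have close k u : k \in H -> `|u - w0| < de -> `|act k u - w0| <= eta / 4.
  move=> /HP[kG kw] uw; rewrite -{1}kw -actB //; apply: le_trans (act_norm kG _) _.
  by rewrite -Cde ler_pM2l // ltW.
have far k u : k \in G -> k \notin H -> `|u - w0| < de -> 3 * eta / 4 <= `|act k u - w0|.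
  move=> kG kH uw; have := Heta k kG kH.
  have := ler_distD (act k u) (act k w0) w0.
  have : `|act k w0 - act k u| <= eta / 4.
    rewrite -actB //; apply: le_trans (act_norm kG _) _.
    by rewrite -Cde ler_pM2l // distrC ltW.
  lra.
have [d1 d1_gt0 Hd1] := dv_close Hb de0.
pose d := Num.min d0 d1.
have d_gt0 : 0 < d by rewrite lt_min d0_gt0.
pose J s := `|s - t0| < d.
have bE s : J s -> E s (b s).
  by rewrite /J lt_min => /andP[? _]; exact: Eb.
have bw s : J s -> `|b s - w0| < de.
  by rewrite /J lt_min => /andP[_ ?]; rewrite -bt0; exact: Hd1.
pose Q s u := exists2 k, k \in H & u = act k (b s).
have QP s u : J s -> E s u -> `|u - w0| <= eta / 4 \/ 3 * eta / 4 <= `|u - w0|.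
  move=> Js Eu; have [k kG ->] := E_orbit (bE s Js) Eu.
  have [kH|kH] := boolP (k \in H); first by left; apply: close => //; exact: bw.
  by right; apply: far => //; exact: bw.
have QQ s u : J s -> E s u -> `|u - w0| < 3 * eta / 4 -> Q s u.
  move=> Js Eu uw; have [k kG kE] := E_orbit (bE s Js) Eu.
  exists k => //; apply: contraT => kH.
  by move: uw; rewrite ltNge kE far //; exact: bw.
have stabP s : ~ good s -> J s -> forall k, k \in H -> act k (b s) = b s.
  move=> ns Js k kH.
  have sub : stab (b s) \subset H.
    apply/fintype.subsetP => g; rewrite inE => /andP[gG /eqP gb]; apply: contraT => gH.
    have := far g (b s) gG gH (bw s Js); rewrite gb; have := bw s Js; lra.
  have : stab (b s) == H.
    rewrite eqEcard sub /H n_def; apply: nmin; apply/asboolP.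
    by exists s, (b s); split=> //; exact: bE.
  by move=> /eqP E1; move: kH; rewrite -E1 inE => /andP[_ /eqP].
(* Cp s is the component of s in the set A of good parameters. *)
pose A := [set s | J s /\ good s].
have Aop : op A.
  move=> s [Js /good_op[e e0 He]]; exists (Num.min e (d - `|s - t0|)).
    by rewrite lt_min e0 subr_gt0.
  move=> r; rewrite lt_min => /andP[re rd]; split; last exact: He.
  by rewrite /J; have := ler_distD s r t0; lra.
pose Cp (s : R) := [set r : R | forall x : R, Num.min s r <= x <= Num.max s r -> A x].
have CpA (s r : R) : Cp s r -> A r by apply; rewrite ge_min le_max lexx !orbT.
have Cp_refl (s : R) : A s -> Cp s s.
  by move=> As x; rewrite minxx maxxx -eq_le => /eqP <-.
have Cp_trans (s r x : R) : Cp s r -> Cp s x -> Cp r x.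
  by move=> Csr Csx y /(between_cover s)[]; [exact: Csr|exact: Csx].
have Cp_eq (s r : R) : Cp s r -> Cp s = Cp r.
  move=> Csr; have Css : Cp s s by apply: Cp_refl; apply: Csr; rewrite ge_min le_max !lexx.
  apply/seteqP; split=> x; first exact: Cp_trans.
  exact: (Cp_trans r s x (Cp_trans s r s Csr Css)).
have Cp_op (s : R) : A s -> exists2 e, 0 < e & forall r, `|r - s| < e -> Cp s r.
  move=> /Aop[e e0 He]; exists e => // r rs x xsr.
  by apply: He; exact: between_ball xsr.
have Cp_convex (s : R) : convex_set (Cp s).
  move=> x y z Cx Cz /andP[xy yz]; have Cxz := Cp_trans _ _ _ Cx Cz.
  rewrite (Cp_eq _ _ Cx) => r xyr; apply: Cxz; apply: (@between_sub _ x z y r) => //.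
  by rewrite ge_min le_max xy yz orbT.
have Cp_open (s : R) : op (Cp s).
  move=> r Csr; have [e e0 He] := Cp_op r (CpA _ _ Csr); exists e => // x /He.
  by rewrite (Cp_eq _ _ Csr).
have Cp_sel (s : R) : A s -> exists f, forall r, Cp s r -> selat r f /\ Q r (f r).
  move=> As; have [f Hf] : exists f, sel_on (Cp s) f.
    apply: interval_selection; [exact: Cp_open|exact: Cp_convex|].
    by move=> r /CpA[].
  have Js : J s by case: As.
  have [Ef _] := Hf s (Cp_refl s As).
  have [h hG fs] := E_orbit Ef (bE s Js).
  have hsel r : Cp s r -> selat r (fun x => act h (f x)).
    by move=> /Hf; exact: selat_act.
  exists (fun x => act h (f x)) => r Csr; split; first exact: hsel.
  have [Jr _] := CpA _ _ Csr.
  have [Er _] := hsel r Csr.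
  apply: QQ => //; apply: (@le_lt_trans _ _ (eta / 4)); last by lra.
  apply: (@no_cross R (fun x => `|act h (f x) - w0|) (eta / 4) (3 * eta / 4) s).
  - by lra.
  - move=> x sxr; have Csx : Cp s x.
      by move=> y ysx; apply: Csr; exact: between_sub sxr ysx.
    have [Jx _] := CpA _ _ Csx; have [Ex [l' /dv_cont Hl']] := hsel x Csx.
    split; last exact: (QP x _ Jx Ex).
    by apply: cvg_norm; apply: cvgB; [exact: Hl'|exact: cvg_cst].
  - by rewrite -fs; have := bw s Js; lra.
have /choice[ch chP] : forall S : set R, exists f, (exists f', forall r, S r -> selat r f' /\ Q r (f' r)) ->
    forall r, S r -> selat r f /\ Q r (f r).
  move=> S; have [[f Hf]|nf] := pselect (exists f', forall r, S r -> selat r f' /\ Q r (f' r)).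
    by exists f.
  by exists b.
(* The selection is chosen for the component as a set, so that it is the same for
   all parameters in the component. *)
have {}chP (s r : R) : Cp s r -> selat r (ch (Cp s)) /\ Q r (ch (Cp s) r).
  by move=> Csr; apply: chP => //; apply: Cp_sel; apply: Csr; rewrite ge_min le_max !lexx.
pose f s := if `[< A s >] then ch (Cp s) s else b s.
have fA s : A s -> f s = ch (Cp s) s by move=> As; rewrite /f asboolT.
have fB s : ~ A s -> f s = b s by move=> As; rewrite /f asboolF.
have fQ s : J s -> Q s (f s).
  move=> Js; have [As|nAs] := pselect (A s).
    by rewrite fA //; have [] := chP _ _ (Cp_refl s As).
  rewrite fB //; exists 1%g; rewrite ?act1 // inE group1 /=; apply/eqP; exact: act1.
apply: nt0; exists d => //; exists f => t1 Jt1.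
have [At1|nAt1] := pselect (A t1).
  have [e e0 He] := Cp_op t1 At1.
  apply: (@selat_ext t1 (ch (Cp t1)) f e) => //; last by have [] := chP _ _ (Cp_refl _ At1).
  by move=> s /He Cs; rewrite (fA _ (CpA _ _ Cs)) (Cp_eq _ _ Cs).
have nt1 : ~ good t1 by move=> gt1; apply: nAt1.
have ft1 : f t1 = b t1 by exact: fB.
have Et1 : E t1 (b t1) by exact: bE.
split; first by rewrite ft1.
have [b1 [l1 [[[d2 d2_gt0 Eb1] Hb1] b1t1]]] := local_from Et1.
exists l1.
have e1_gt0 : 0 < de - `|b t1 - w0| by rewrite subr_gt0 bw.
have [d3 d3_gt0 Hd3] := dv_close Hb1 e1_gt0.
pose d4 := Num.min (Num.min d2 d3) (d - `|t1 - t0|).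
have d4_gt0 : 0 < d4 by rewrite !lt_min d2_gt0 d3_gt0 subr_gt0.
have d4P s : `|s - t1| < d4 -> J s /\ (exists2 k, k \in H & b1 s = act k (b s)).
  rewrite !lt_min -andbA => /and3P[s2 s3 sd].
  have Js : J s by rewrite /J; apply: le_lt_trans (ler_distD t1 _ _) _; rewrite -ltrBrDr.
  split=> //; apply: QQ => //; first exact: Eb1.
  apply: le_lt_trans (ler_distD (b t1) _ _) _; rewrite -ltrBrDr -b1t1.
  by apply: lt_le_trans (Hd3 s s3) _; rewrite b1t1 lerD2r.
have l1_fix k : k \in H -> act k l1 = l1.
  move=> kH; have [kG kw] := HP k kH.
  apply/eqP; rewrite -subr_eq0 -normr_le0; apply/ler_addgt0Pl => e e0; rewrite addr0.
  have C1 : 0 < C + 1 by rewrite addr_gt0.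
  have [d5 d5_gt0 Hd5] := Hb1 (e / (C + 1)) (divr_gt0 e0 C1).
  pose d6 := Num.min d4 d5.
  have d6_gt0 : 0 < d6 by rewrite lt_min d4_gt0.
  have [s [st s6 ns]] : exists s, [/\ 0 < `|s - t1|, `|s - t1| < d6 & ~ good s].
    apply: contrapT => nex; apply: nt1; apply: (not_isolated d6_gt0) => s st s6.
    by apply: contrapT => ns; apply: nex; exists s.
  move: s6; rewrite lt_min => /andP[/d4P[Js [h hH b1s]] /Hd5 {}Hd5].
  have kb1 : act k (b1 s) = b1 s by rewrite b1s !stabP.
  have kb : act k (b t1) = b t1 by apply: stabP.
  rewrite b1t1 in Hd5; set X := b1 s - b t1 - (s - t1) *: l1 in Hd5.
  have kX : act k X - X = (s - t1) *: (l1 - act k l1).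
    rewrite /X !actB // actZ // kb1 kb scalerBr opprB.
    by rewrite addrC addrA subrK.
  have : `|act k X - X| <= e * `|s - t1|.
    apply: le_trans (ler_normB _ _) _.
    have := act_norm kG X; move: `|act k X| => Y HY.
    have HX : C * `|X| + `|X| <= e * `|s - t1|.
      rewrite -{2}[`|X|]mul1r -mulrDl; apply: le_trans (ler_wpM2l (ltW C1) Hd5) _.
      by rewrite mulrA mulrCA divff ?mulr1 // gt_eqF.
    by apply: le_trans HX; rewrite lerD2r.
  by rewrite kX normrZ mulrC ler_pM2r // distrC.
move=> e e0; have [d5 d5_gt0 Hd5] := Hb1 (e / C) (divr_gt0 e0 C_gt0).
exists (Num.min d4 d5); first by rewrite lt_min d4_gt0.
move=> s; rewrite lt_min => /andP[/d4P[Js [h hH b1s]] /Hd5 {}Hd5].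
have [k kH fs] := fQ s Js.
have [kG _] := HP k kH; have [hG _] := HP h hH.
have fs' : f s = act (k * h^-1)%g (b1 s) by rewrite b1s -actM ?groupM ?groupV // mulgKV.
have HM x y : x \in H -> y \in H -> (x * y^-1)%g \in H.
  move=> /HP[xG xw] /HP[yG yw]; rewrite inE groupM ?groupV //=.
  by rewrite actM ?groupV // -{1}yw actVK // xw.
have khH := HM k h kH hH; have [khG _] := HP _ khH.
rewrite ft1 fs' -[in X in _ - X - _](stabP t1 nt1 Jt1 _ khH) -b1t1 -(l1_fix _ khH).
rewrite -actZ // -!actB //; apply: le_trans (act_norm khG _) _.
apply: le_trans (ler_wpM2l (ltW C_gt0) Hd5) _.
by rewrite mulrA mulrCA divff ?mulr1 // gt_eqF.
Qed.

Theorem differentiable_selection : exists f, forall t, selat t f.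
Proof.
have opT : op [set: R] by move=> t _; exists 1.
have cvT : convex_set [set: R] by [].
have [f Hf] := interval_selection opT cvT (fun t _ => all_good t).
by exists f => t; apply: Hf.
Qed.
End Selection.

(** * Germs of C^n functions and their simple roots *)

Section GermCn.
Context (R : realType).
Implicit Types (f g h z : R -> R) (t x : R) (n : nat).

Lemma cvg_pow (T : Type) (F : set_system T) (FF : Filter F) (f : T -> R) (a : R) (k : nat) :
  f @ F --> a -> (fun y => f y ^+ k) @ F --> a ^+ k.
Proof.
move=> fa; elim: k => [|k IH].
  by rewrite expr0; under eq_fun do rewrite expr0; exact: cvg_cst.
by rewrite exprS; under eq_fun do rewrite exprS; exact: cvgM.
Qed.

(** C^n functions near t.  The recursion exhibits the derivatives instead of
    iterating a derivation operator, so that closure properties follow by induction. *)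
Fixpoint gC n t f : Prop :=
  if n is n'.+1 then
    exists f', (\forall x \near t, is_derive (x : R) (1 : R) f (f' x)) /\ gC n' t f'
  else \forall x \near t, {for x, continuous f}.

Lemma near2 t (P : R -> Prop) : (\forall x \near t, P x) ->
  \forall x \near t, \forall y \near x, P y.
Proof. by move/near_join. Qed.

Lemma near_forall (I : finType) (P : I -> R -> Prop) t :
  (forall i, \forall x \near t, P i x) -> \forall x \near t, forall i, P i x.
Proof. by move=> H; exact: (@filter_forall R I P (nbhs t) (nbhs_filter t) H). Qed.

Lemma cont_ext t f g : (\forall x \near t, f x = g x) ->
  {for t, continuous f} -> {for t, continuous g}.
Proof.
move=> fg cf; rewrite /prop_for /continuous_at -(nbhs_singleton fg).
by apply: cvg_trans cf; apply: near_eq_cvg.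
Qed.

Lemma is_derive_cont t f l : is_derive t 1 f l -> {for t, continuous f}.
Proof. by move/dvP/dv_cont. Qed.

Lemma gC_ext n t f g : (\forall x \near t, f x = g x) -> gC n t f -> gC n t g.
Proof.
case: n => [|n] fg /=.
  by apply: filterS2 (near2 fg) => x; exact: cont_ext.
move=> [f' [Hf Cf]]; exists f'; split => //.
by apply: filterS2 (near2 fg) Hf => x; exact: near_eq_is_derive.
Qed.

Lemma gC_S n t f : gC n.+1 t f -> gC n t f.
Proof.
elim: n f => [|n IH] f [f' [Hf Cf]].
  by apply: filterS Hf => x; exact: is_derive_cont.
by exists f'; split=> //; exact: IH.
Qed.

Lemma gC_0 n t f : gC n t f -> gC 0 t f.
Proof. by elim: n => // n IH /gC_S. Qed.

Lemma gC_cont n t f : gC n t f -> {for t, continuous f}.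
Proof. by move/gC_0/nbhs_singleton. Qed.

Lemma gC_cst n t a : gC n t (fun _ => a).
Proof.
elim: n a => [|n IH] a /=; first by near=> x; exact: cvg_cst.
by exists (fun _ => 0); split=> //; near=> x; exact: is_derive_cst.
Unshelve. all: by end_near. Qed.

Lemma gC_id n t : gC n t id.
Proof.
case: n => [|n] /=; first by near=> x; exact: cvg_id.
exists (fun _ => 1); split; [by near=> x; exact: is_derive_id|exact: gC_cst].
Unshelve. all: by end_near. Qed.

Lemma gC_D n t f g : gC n t f -> gC n t g -> gC n t (fun x => f x + g x).
Proof.
elim: n f g => [|n IH] f g /=.
  by apply: filterS2 => x; exact: cvgD.
move=> [f' [Hf Cf]] [g' [Hg Cg]]; exists (fun x => f' x + g' x); split; last exact: IH.
by apply: filterS2 Hf Hg => x Hf Hg; exact: is_deriveD.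
Qed.

Lemma gC_M n t f g : gC n t f -> gC n t g -> gC n t (fun x => f x * g x).
Proof.
elim: n f g => [|n IH] f g.
  by apply: filterS2 => x; exact: cvgM.
move=> fC gC'; have [f' [Hf Cf]] := fC; have [g' [Hg Cg]] := gC'.
exists (fun x => f x * g' x + g x * f' x); split.
  by apply: filterS2 Hf Hg => x Hf Hg; exact: is_deriveM.
by apply: gC_D; apply: IH => //; exact: gC_S.
Qed.

Lemma gC_sum n t m (F : 'I_m -> R -> R) : (forall i, gC n t (F i)) ->
  gC n t (fun x => \sum_i F i x).
Proof.
elim: m F => [|m IH] F HF.
  by apply: gC_ext (gC_cst n t 0); near=> x; rewrite big_ord0.
apply: gC_ext (gC_D (IH (fun i => F (lift ord0 i)) _) (HF ord0)) => //.
by near=> x; rewrite big_ord_recl addrC.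
Unshelve. all: by end_near. Qed.

Lemma gC_X n t f k : gC n t f -> gC n t (fun x => f x ^+ k).
Proof.
move=> Hf; elim: k => [|k IH].
  by apply: gC_ext (gC_cst n t 1); near=> x; rewrite expr0.
by apply: gC_ext (gC_M Hf IH); near=> x; rewrite exprS.
Unshelve. all: by end_near. Qed.

Lemma gC_V n t f : f t != 0 -> gC n t f -> gC n t (fun x => (f x)^-1).
Proof.
move=> f0 Cf; have fn0 : \forall x \near t, f x != 0.
  have := gC_cont Cf; move/cvgrPdist_lt => /(_ `|f t|); rewrite normr_gt0 => /(_ f0).
  apply: filterS => x; apply: contraTneq => ->.
  by rewrite subr0 ltxx.
elim: n Cf => [|n IH] Cf.
  by apply: filterS2 fn0 Cf => x; exact: cvgV.
have [f' [Hf Cf']] := Cf.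
exists (fun x => - ((f x)^-1 * (f x)^-1) * f' x); split.
  apply: filterS2 fn0 Hf => x fx Hf; apply: is_derive_eq (is_deriveV fx Hf) _.
  by rewrite expr2 invfM.
have IHn := IH (gC_S Cf).
apply: gC_M => //; apply: gC_ext (gC_M (gC_cst n t (-1)) (gC_M IHn IHn)).
by near=> x; rewrite mulN1r.
Unshelve. all: by end_near. Qed.

(** The polynomial in u with coefficients a i t. *)
Definition horn N (a : 'I_N -> R -> R) t (u : R) := \sum_(i < N) a i t * u ^+ i.

(** The divided difference of this polynomial in u; on the diagonal it is the
    derivative, so that it is nonzero there exactly at simple roots. *)
Definition dhorn N (a : 'I_N -> R -> R) t (u v : R) :=
  \sum_(i < N) a i t * \sum_(j < i) u ^+ (i.-1 - j) * v ^+ j.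

Lemma hornB N (a : 'I_N -> R -> R) t u v : horn a t u - horn a t v = (u - v) * dhorn a t u v.
Proof.
rewrite /horn /dhorn -sumrB mulr_sumr; apply: eq_bigr => i _.
rewrite -mulrBr mulrCA; congr (_ * _).
case: i => -[|i] _ /=; first by rewrite !expr0 subrr big_ord0 mulr0.
by rewrite subrXX; congr (_ * _); apply: eq_bigr => j _; rewrite subSS.
Qed.

Section Root.
Variables (N : nat) (a : 'I_N -> R -> R) (z : R -> R).

Lemma dhorn_cvg x : (forall i, {for x, continuous (a i)}) -> {for x, continuous z} ->
  (fun p : R * R => dhorn a p.1 (z p.1) (z p.2)) @ (x, x) --> dhorn a x (z x) (z x).
Proof.
move=> ac zx.
have c1 (f : R -> R) : {for x, continuous f} -> (fun p : R * R => f p.1) @ (x, x) --> f x.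
  by move=> fx; apply: (@cvg_comp _ _ _ fst f _ (nbhs x)) => //; exact: cvg_fst.
have c2 (f : R -> R) : {for x, continuous f} -> (fun p : R * R => f p.2) @ (x, x) --> f x.
  by move=> fx; apply: (@cvg_comp _ _ _ snd f _ (nbhs x)) => //; exact: cvg_snd.
apply: cvg_big => [|i _]; first exact: add_continuous.
apply: cvgM; first exact: c1.
apply: cvg_big => [|j _]; first exact: add_continuous.
by apply: cvgM; apply: cvg_pow; [exact: c1|exact: c2].
Qed.

Lemma horn_cont x u : (forall i, {for x, continuous (a i)}) ->
  {for x, continuous (fun y => horn a y u)}.
Proof.
move=> ac; apply: cvg_big => [|i _]; first exact: add_continuous.
by apply: cvgM; [exact: ac|exact: cvg_cst].
Qed.

(** The divided difference is continuous in both variables and nonzero at (t, t). *)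
Lemma dhorn_away t : (forall i, {for t, continuous (a i)}) ->
  {for t, continuous z} -> dhorn a t (z t) (z t) != 0 ->
  exists2 c, 0 < c & \forall x \near t, \forall y \near x,
    c <= `|dhorn a y (z y) (z x)|.
Proof.
move=> ac zc simple; set D := dhorn a t (z t) (z t) in simple.
exists (`|D| / 2); first by rewrite divr_gt0 // normr_gt0.
have := dhorn_cvg ac zc.
move=> /cvgrPdist_lt /(_ (`|D| / 2)); rewrite divr_gt0 ?normr_gt0 // => /(_ isT).
move=> [[A B] /= [At Bt] AB].
have := near2 At; apply: filterS2 Bt => x Bx Ax.
apply: filterS Ax => y Ay.
have := AB (y, x) (conj Ay Bx); rewrite /= -/D => H.
have := ler_distD (dhorn a y (z y) (z x)) D 0; rewrite !subr0; lra.
Qed.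

(** The coefficients at y and the root at x give the value (z x - z y) times a
    divided difference which is bounded away from 0; this value tends to 0. *)
Lemma root_continuous t : (forall i, \forall x \near t, {for x, continuous (a i)}) ->
  (\forall x \near t, horn a x (z x) = 0) ->
  {for t, continuous z} -> dhorn a t (z t) (z t) != 0 ->
  \forall x \near t, {for x, continuous z}.
Proof.
move=> ac root_z zc simple.
have act i : {for t, continuous (a i)} by exact: nbhs_singleton (ac i).
have [c c0 Hc] := dhorn_away act zc simple.
have acN : \forall x \near t, forall i, {for x, continuous (a i)} by exact: (@near_forall _ (fun i x => {for x, continuous (a i)}) t).
have r2 := near2 root_z.
near=> x.
have rx : horn a x (z x) = 0 by near: x.
have acx : forall i, {for x, continuous (a i)} by near: x.
have rn : \forall y \near x, horn a y (z y) = 0 by near: x.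
have cn : \forall y \near x, c <= `|dhorn a y (z y) (z x)| by near: x.
apply/cvgrPdist_lt => e e0.
have := horn_cont (u := z x) acx; move=> /cvgrPdist_lt /(_ (c * e)).
rewrite mulr_gt0 // rx => /(_ isT) hn.
apply: filterS3 rn cn hn => y ry cy; rewrite sub0r normrN => hy.
have := hornB a y (z y) (z x); rewrite ry sub0r => /(congr1 Num.norm).
rewrite normrN normrM distrC => Hy.
rewrite -(ltr_pM2l c0); apply: le_lt_trans hy.
by rewrite Hy mulrC ler_wpM2l.
Unshelve. all: by end_near. Qed.

(** Subtracting the two equations for z y and z t expresses z y - z t as y - t times
    a quotient of functions that are continuous at t. *)
Lemma root_derive t (a' : 'I_N -> R) : (forall i, is_derive t 1 (a i) (a' i)) ->
  (\forall x \near t, horn a x (z x) = 0) ->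
  {for t, continuous z} -> dhorn a t (z t) (z t) != 0 ->
  is_derive t 1 z (- (\sum_(i < N) a' i * z t ^+ i) * (dhorn a t (z t) (z t))^-1).
Proof.
move=> ad root_z zc simple.
have ac i : {for t, continuous (a i)} by exact: is_derive_cont (ad i).
have /choice[q Hq] : forall i, exists q : R -> R,
    [/\ forall y : R, a i y - a i t = q y * (y - t), {for t, continuous q} & q t = a' i].
  by move=> i; have /is_derive1_caratheodory[q Hq] := ad i; exists q.
pose F y := - (\sum_(i < N) q i y * z t ^+ i) * (dhorn a y (z y) (z t))^-1.
have Dc : {for t, continuous (fun y => dhorn a y (z y) (z t))}.
  apply: (@cvg_comp _ _ _ (fun y => (y, t)) (fun p : R * R => dhorn a p.1 (z p.1) (z p.2)) _ (nbhs (t, t))); last exact: dhorn_cvg.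
  move=> A [[B1 B2] /= [B1t B2t] BA]; apply: filterS B1t => y B1y.
  by apply: BA; split => //=; exact: nbhs_singleton B2t.
have Fc : {for t, continuous F}.
  apply: cvgM; last by apply: cvgV.
  apply: cvgN; apply: cvg_big => [|i _]; first exact: add_continuous.
  by apply: cvgM; [have [] := Hq i|exact: cvg_cst].
have Ft : F t = - (\sum_(i < N) a' i * z t ^+ i) * (dhorn a t (z t) (z t))^-1.
  by congr (- _ * _); apply: eq_bigr => i _; have [_ _ ->] := Hq i.
have Dn : \forall y \near t, dhorn a y (z y) (z t) != 0.
  move: Dc; move/cvgrPdist_lt => /(_ `|dhorn a t (z t) (z t)|); rewrite normr_gt0 => /(_ simple).
  by apply: filterS => y; apply: contraTneq => ->; rewrite subr0 ltxx.
have Fz : \forall y \near t, z y - z t = F y * (y - t).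
  have rt := nbhs_singleton root_z.
  apply: filterS2 root_z Dn => y ry Dy.
  have Hy : - (\sum_(i < N) q i y * z t ^+ i) * (y - t) = (z y - z t) * dhorn a y (z y) (z t).
    rewrite -hornB ry sub0r mulNr; congr (- _).
    transitivity (horn a y (z t) - horn a t (z t)); last by rewrite rt subr0.
    rewrite /horn -sumrB mulr_suml; apply: eq_bigr => i _.
    by rewrite -mulrBl; have [-> _ _] := Hq i; rewrite mulrAC.
  by rewrite /F mulrAC Hy mulfK.
apply/is_derive1_caratheodory.
exists (fun y => if y == t then F t else (z y - z t) / (y - t)); split.
- move=> y; case: eqVneq => [->|yt]; first by rewrite !subrr mulr0.
  by rewrite divfK // subr_eq0.
- apply: cont_ext Fc; apply: filterS Fz => y ->.
  by case: eqVneq => [->//|yt]; rewrite mulfK // subr_eq0.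
- by rewrite eqxx Ft.
Qed.
End Root.

(** A continuous simple root is as smooth as the coefficients: its derivative is
    a rational expression in the root itself and the derivatives of the
    coefficients, which gains one order in each induction step. *)
Lemma gC_hensel n t N (a : 'I_N -> R -> R) z : (forall i, gC n t (a i)) ->
  (\forall x \near t, horn a x (z x) = 0) ->
  {for t, continuous z} -> dhorn a t (z t) (z t) != 0 -> gC n t z.
Proof.
elim: n a z => [|n IH] a z Ca root_z zc simple.
  exact: (root_continuous Ca root_z zc simple).
have Can i := gC_S (Ca i).
have Cz := IH a z Can root_z zc simple.
have /choice[a' Ha'] : forall i, exists f' : R -> R,
    (\forall x \near t, is_derive x (1 : R) (a i) (f' x)) /\ gC n t f'.
  by move=> i; have [f' Hf'] := Ca i; exists f'.
have CD : gC n t (fun x => dhorn a x (z x) (z x)).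
  apply: gC_sum => i; apply: gC_M => //; apply: gC_sum => j.
  by apply: gC_M; exact: gC_X.
exists (fun x => - (\sum_(i < N) a' i x * z x ^+ i) * (dhorn a x (z x) (z x))^-1); split.
  have zn : \forall x \near t, {for x, continuous z}.
    by apply: root_continuous (root_z) zc simple => i; exact: gC_0 (Can i).
  have an : \forall x \near t, forall i, is_derive (x : R) (1 : R) (a i) (a' i x).
    by apply: (@near_forall _ (fun i (x : R) => is_derive x (1 : R) (a i) (a' i x))) => i; have [] := Ha' i.
  have Dn : \forall x \near t, dhorn a x (z x) (z x) != 0.
    move: (gC_cont CD); move/cvgrPdist_lt => /(_ `|dhorn a t (z t) (z t)|).
    rewrite normr_gt0 => /(_ simple).
    by apply: filterS => y; apply: contraTneq => ->; rewrite subr0 ltxx.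
  near=> x; apply: root_derive.
  - by near: x.
  - by near: x; exact: near2.
  - by near: x.
  - by near: x.
apply: gC_M; last exact: gC_V.
have S : gC n t (fun x => \sum_(i < N) a' i x * z x ^+ i).
  by apply: gC_sum => i; apply: gC_M; [have [] := Ha' i|exact: gC_X].
by apply: gC_ext (gC_M (gC_cst n t (-1)) S); near=> x; rewrite mulN1r.
Unshelve. all: by end_near. Qed.
End GermCn.

(** * Division of C^n germs by the parameter *)

Section Division.
Context (R : realType).
Implicit Types (f g h : R -> R) (t x y : R) (n : nat).

Lemma scaleRE (a b : R) : a *: b = a * b.
Proof. by []. Qed.

(** The mean value theorem for both positions of x relative to t; the derivative
    need not exist at t. *)
Lemma mvt2 f df t x :
  (forall y, `|y - t| <= `|x - t| -> {for y, continuous f}) ->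
  (forall y, y != t -> `|y - t| <= `|x - t| -> is_derive y (1 : R) f (df y)) ->
  x != t ->
  exists y, [/\ y != t, `|y - t| <= `|x - t| & f x - f t = df y * (x - t)].
Proof.
move=> fc fd xt; have [tx|xt'] := ltP t x.
- have nx : `|x - t| = x - t by rewrite gtr0_norm ?subr_gt0.
  have [||y] := @MVT R f df t x tx.
  + move=> y; rewrite in_itv /= => /andP[ty yx]; apply: fd; first by rewrite gt_eqF.
    by rewrite nx gtr0_norm ?subr_gt0 // lerD2r ltW.
  + apply: continuous_in_subspaceT => y; rewrite inE /= in_itv /= => /andP[ty yx].
    by apply: fc; rewrite nx ger0_norm ?subr_ge0 // lerD2r.
  rewrite in_itv /= => /andP[ty yx] E; exists y; split=> //; first by rewrite gt_eqF.
  by rewrite nx gtr0_norm ?subr_gt0 // lerD2r ltW.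
- have {xt'}xt' : x < t by rewrite lt_neqAle xt.
  have nx : `|x - t| = t - x by rewrite distrC gtr0_norm ?subr_gt0.
  have [||y] := @MVT R f df x t xt'.
  + move=> y; rewrite in_itv /= => /andP[xy yt]; apply: fd; first by rewrite lt_eqF.
    by rewrite nx distrC gtr0_norm ?subr_gt0 // lerD2l lerN2 ltW.
  + apply: continuous_in_subspaceT => y; rewrite inE /= in_itv /= => /andP[xy yt].
    by apply: fc; rewrite nx distrC ger0_norm ?subr_ge0 // lerD2l lerN2.
  rewrite in_itv /= => /andP[xy yt] E; exists y; split=> //; first by rewrite lt_eqF.
    by rewrite nx distrC gtr0_norm ?subr_gt0 // lerD2l lerN2 ltW.
  by rewrite -opprB E -mulrN opprB.
Qed.

Lemma near_neq t : \forall x \near t, x != t -> \forall y \near x, y != t.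
Proof.
apply: filterE => x xt.
have xt0 : 0 < `|x - t| by rewrite normr_gt0 subr_eq0.
apply/nbhs_ballP; exists `|x - t| => //= y; rewrite /ball /= => xy.
by apply: contraTneq xy => ->; rewrite ltxx.
Qed.

Lemma is_derive_XB t j y : is_derive y (1 : R) (fun x => (x - t) ^+ j.+1) (j.+1%:R * (y - t) ^+ j).
Proof.
have D : is_derive y (1 : R) (fun x => x - t) 1.
  have D0 : is_derive y (1 : R) (fun x => x - t) (1 - 0).
    exact: (is_deriveB (is_derive_id y (1 : R)) (is_derive_cst t y (1 : R))).
  by rewrite subr0 in D0.
have E : (fun x => (x - t) ^+ j.+1) = (fun x : R => x - t) ^+ j.+1.
  apply/funext => x; elim: j.+1 => [|k IH]; first by rewrite !expr0.
  by rewrite !exprS IH.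
by rewrite E; apply: is_derive_eq (is_deriveX j.+1 D) _; rewrite scaleRE mulr1.
Qed.

(** The mean value theorem applied to F - h t (x - t)^(j+1) / (j+1), whose
    derivative is (x - t)^j (h x - h t). *)
Lemma primitive_quotient t j (F h : R -> R) : {for t, continuous h} ->
  F t = 0 -> (\forall x \near t, {for x, continuous F}) ->
  (\forall x \near t, x != t -> is_derive (x : R) (1 : R) F ((x - t) ^+ j * h x)) ->
  forall e, 0 < e -> \forall x \near t, x != t ->
    `|F x / (x - t) ^+ j.+1 - h t / j.+1%:R| <= e.
Proof.
move=> hc F0 Fc Fd e e0.
pose c := h t / j.+1%:R; pose P x := F x - c * (x - t) ^+ j.+1.
have hn : \forall x \near t, `|h x - h t| <= e.
  by move/cvgrPdist_le : hc => /(_ e e0); apply: filterS => x; rewrite distrC.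
have /nbhs_ballP[d d0 Hd] : \forall x \near t, [/\ {for x, continuous F},
    x != t -> is_derive (x : R) (1 : R) F ((x - t) ^+ j * h x) & `|h x - h t| <= e].
  by apply: filterS3 Fc Fd hn.
apply/nbhs_ballP; exists d => //= x; rewrite /ball /= distrC => xd xt.
have in_d y : `|y - t| <= `|x - t| -> ball t d y.
  by move=> yx; rewrite /ball /= distrC; exact: le_lt_trans xd.
have [y [yt yx E]] : exists y, [/\ y != t, `|y - t| <= `|x - t| &
    P x - P t = ((y - t) ^+ j * (h y - h t)) * (x - t)].
  apply: mvt2 => // y.
    move=> /in_d/Hd[Fy _ _]; apply: cvgB => //; apply: cvgM; first exact: cvg_cst.
    exact: (is_derive_cont (is_derive_XB t j _)).
  move=> yt /in_d/Hd[_ /(_ yt) Fy _].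
  have Z := is_deriveZ c (is_derive_XB t j y).
  apply: is_derive_eq (is_deriveB Fy Z) _; rewrite scaleRE /c mulrA divfK ?pnatr_eq0 //.
  by rewrite [h t * _]mulrC -mulrBr.
have [_ _ hy] := Hd _ (in_d _ yx).
have Pt : P t = 0 by rewrite /P F0 subrr expr0n mulr0 subrr.
have u0 : 0 < `|x - t| by rewrite normr_gt0 subr_eq0.
have -> : F x / (x - t) ^+ j.+1 - h t / j.+1%:R = P x / (x - t) ^+ j.+1.
  by rewrite /P mulrBl mulfK // expf_neq0 // subr_eq0.
rewrite normrM normfV normrX ler_pdivrMr ?exprn_gt0 //.
rewrite -[P x]subr0 -Pt E !normrM normrX exprSr mulrA ler_pM2r // mulrC.
by apply: ler_pM => //; apply: lerXn2r.
Qed.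

(** With u = x - t, the relation (u^(j+1) g)' = u^j f gives g' = (f - (j+1) g) / u,
    and p = g' satisfies a relation of the same kind with j+1 and f' for j and f:
    (u^(j+2) p)' = u^(j+1) f'.  So each derivative of f yields one of g, and
    primitive_quotient provides the continuity of p at t. *)
Lemma gC_primitive_quotient n t j f g : gC n t f ->
  (\forall x \near t, {for x, continuous g}) ->
  (\forall x \near t, x != t ->
     is_derive (x : R) (1 : R) (fun y => (y - t) ^+ j.+1 * g y) ((x - t) ^+ j * f x)) ->
  gC n t g.
Proof.
elim: n j f g => [//|n IH] j f g Cf gc gd.
have [h [fd Ch]] := Cf.
pose p x := if x == t then h t / j.+2%:R else (f x - j.+1%:R * g x) / (x - t).
have pE x : x != t -> p x = (f x - j.+1%:R * g x) / (x - t) by move=> /negbTE xt; rewrite /p xt.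
pose F x := (x - t) ^+ j.+1 * (f x - j.+1%:R * g x).
have fc := gC_0 Cf.
have hc := gC_cont Ch.
have Fc : \forall x \near t, {for x, continuous F}.
  apply: filterS2 fc gc => x fx gx; apply: cvgM.
    exact: (is_derive_cont (is_derive_XB t j _)).
  by apply: cvgB => //; apply: cvgM; [exact: cvg_cst|].
have Fd : \forall x \near t, x != t -> is_derive (x : R) (1 : R) F ((x - t) ^+ j.+1 * h x).
  apply: filterS2 fd gd => x fx gx xt.
  have D := is_deriveB (is_deriveM (is_derive_XB t j x) fx) (is_deriveZ j.+1%:R (gx xt)).
  have FE : (fun y => (y - t) ^+ j.+1) * f - j.+1%:R \*: (fun y => (y - t) ^+ j.+1 * g y) = F.
    by apply/funext => y; rewrite /F !fctE /= scaleRE mulrBr [X in _ - X]mulrCA.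
  rewrite FE in D; apply: is_derive_eq D _.
  by rewrite !scaleRE; ring.
have Fp x : x != t -> F x / (x - t) ^+ j.+2 = p x.
  move=> xt; have u0 : x - t != 0 by rewrite subr_eq0.
  have : (x - t) ^+ j.+1 != 0 by rewrite expf_neq0.
  rewrite pE // /F [X in _ / X]exprS; move: ((x - t) ^+ j.+1) => U U0.
  by field; rewrite u0 U0.
have pc : \forall x \near t, {for x, continuous p}.
  have pcn : \forall x \near t, x != t -> {for x, continuous p}.
    have away := near_neq t.
    apply: filterS3 fc gc away => x fx gx ax xt.
    apply: (@cont_ext _ x (fun x => (f x - j.+1%:R * g x) / (x - t))).
      by apply: filterS (ax xt) => y yt; rewrite pE.
    apply: cvgM; first by apply: cvgB => //; apply: cvgM; [exact: cvg_cst|].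
    apply: cvgV; first by rewrite subr_eq0.
    by apply: cvgB; [exact: cvg_id|exact: cvg_cst].
  apply: filterS pcn => x px; have [->|] := eqVneq x t; last exact: px.
  apply/cvgrPdist_le => e e0.
  have F0 : F t = 0 by rewrite /F subrr expr0n mul0r.
  have := primitive_quotient hc F0 Fc Fd e0; apply: filterS => y Hy.
  have [->|yt] := eqVneq y t; first by rewrite subrr normr0 ltW.
  by rewrite -(Fp y yt) distrC /p eqxx; exact: Hy.
exists p; split.
  have gdn : \forall x \near t, x != t -> is_derive (x : R) (1 : R) g (p x).
    have away := near_neq t.
    apply: filterS2 away gd => x ax gx xt.
    have u0 : x - t != 0 by rewrite subr_eq0.
    have uj : (x - t) ^+ j.+1 != 0 by rewrite expf_neq0.
    have D := is_deriveM (gx xt) (@is_deriveV R (fun y => (y - t) ^+ j.+1) x _ 1 uj (is_derive_XB t j x)).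
    apply: (@near_eq_is_derive _ _ _ ((fun y => (y - t) ^+ j.+1 * g y) * (fun y => ((y - t) ^+ j.+1)^-1))).
      apply: filterS (ax xt) => y yt; rewrite !fctE mulrC mulKf //.
      by rewrite expf_neq0 // subr_eq0.
    apply: is_derive_eq D _; rewrite pE // !scaleRE exprS.
    by move: uj; rewrite exprS mulf_eq0 negb_or => /andP[_ uj]; field; rewrite uj u0.
  apply: filterS2 (near2 gdn) (near2 gc) => x gdx gcx.
  have [xt|] := eqVneq x t; last exact: (nbhs_singleton gdx).
  rewrite {x}xt in gdx gcx *; apply/dvP => e e0.
  move: (nbhs_singleton pc) => /cvgrPdist_le /(_ e e0) pe.
  have /nbhs_ballP[d d0 Hd] : \forall x \near t, [/\ `|p t - p x| <= e,
      x != t -> is_derive (x : R) (1 : R) g (p x) & {for x, continuous g}].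
    by apply: filterS3 pe gdx gcx.
  exists d => // x xd.
  have in_d y : `|y - t| <= `|x - t| -> ball t d y.
    by move=> yx; rewrite /ball /= distrC; exact: le_lt_trans xd.
  have [->|xt] := eqVneq x t; first by rewrite !subrr scale0r subr0 !normr0 mulr0.
  have [y [yt yx ->]] : exists y, [/\ y != t, `|y - t| <= `|x - t| & g x - g t = p y * (x - t)].
    apply: mvt2 => // y; first by move=> /in_d/Hd[].
    by move=> yt /in_d/Hd[_ /(_ yt)].
  rewrite scaleRE [(x - t) * p t]mulrC -mulrBl normrM ler_pM2r ?normr_gt0 ?subr_eq0 //.
  by rewrite distrC; have [] := Hd _ (in_d _ yx).
apply: (IH j.+1 h p Ch pc); have away := near_neq t.
apply: filterS2 away Fd => x ax Fx xt.
apply: near_eq_is_derive (Fx xt); apply: filterS (ax xt) => y yt.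
by rewrite -Fp // mulrC divfK // expf_neq0 // subr_eq0.
Qed.

(** At t the quotient takes the value forced by continuity. *)
Definition quot t f x := if x == t then 'D_1 f t else f x / (x - t).

(** Division by x - t costs one derivative: the previous lemma with j = 0, as
    (x - t) quot t f x is f, with derivative h. *)
Lemma gC_quot n t f : gC n.+1 t f -> f t = 0 -> gC n t (quot t f).
Proof.
move=> Cf f0; have [h [fd Ch]] := Cf.
have fdt := nbhs_singleton fd.
have qE x : quot t f x * (x - t) = f x.
  rewrite /quot; case: eqVneq => [->|xt]; first by rewrite subrr mulr0.
  by rewrite divfK // subr_eq0.
have uq : (fun y => (y - t) ^+ 1 * quot t f y) = f by apply/funext => y; rewrite expr1 mulrC.
apply: (@gC_primitive_quotient n t 0 h) => //; last first.
  by rewrite uq; apply: filterS fd => x fx _; rewrite expr0 mul1r.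
have qcn : \forall x \near t, x != t -> {for x, continuous (quot t f)}.
  have away := near_neq t.
  apply: filterS2 away fd => x ax fx xt.
  apply: (@cont_ext _ x (fun x => f x / (x - t))).
    by apply: filterS (ax xt) => y /negbTE yt; rewrite /quot yt.
  apply: cvgM; first exact: is_derive_cont fx.
  apply: cvgV; first by rewrite subr_eq0.
  by apply: cvgB; [exact: cvg_id|exact: cvg_cst].
apply: filterS qcn => x qx; have [->|//] := eqVneq x t.
apply/cvgrPdist_le => e e0; have [d d0 Hd] := (dvP t f (h t)).2 fdt e e0.
apply/nbhs_ballP; exists d => //= y; rewrite /ball /= distrC => /Hd.
rewrite /quot eqxx f0 subr0; case: eqVneq => [-> _|yt].
  by rewrite subrr normr0 ltW.
have -> : 'D_1 f t = h t by exact: derive_val.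
have u0 : y - t != 0 by rewrite subr_eq0.
rewrite (_ : f y - _ = - ((h t - f y / (y - t)) * (y - t))); last by rewrite scaleRE; field.
by rewrite normrN normrM ler_pM2r ?normr_gt0.
Qed.
End Division.

(** * Germs of real analytic functions *)

Section PolyNorm.
Context (R : realType).
Implicit Types (p q : {poly R}) (r x : R).

(** The norm on the l^1 space of power series with radius r; it is
    submultiplicative. *)
Definition pnorm r p := \sum_(j < size p) `|p`_j| * r ^+ j.

Lemma pnormE n r p : (size p <= n)%N -> pnorm r p = \sum_(j < n) `|p`_j| * r ^+ j.
Proof.
move=> pn; rewrite /pnorm (big_ord_widen n (fun j => `|p`_j| * r ^+ j)) // big_mkcond /=.
apply: eq_bigr => i _; case: ltnP => // ip.
by rewrite nth_default // normr0 mul0r.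
Qed.

Lemma pnorm_ge0 r p : 0 <= r -> 0 <= pnorm r p.
Proof. by move=> r0; apply: sumr_ge0 => j _; rewrite mulr_ge0 // exprn_ge0. Qed.

Lemma pnorm_mono r r' p : 0 <= r -> r <= r' -> pnorm r p <= pnorm r' p.
Proof.
move=> r0 rr'; apply: ler_sum => j _; apply: ler_wpM2l => //.
by apply: lerXn2r => //; rewrite nnegrE // (le_trans r0).
Qed.

Lemma pnormD r p q : 0 <= r -> pnorm r (p + q) <= pnorm r p + pnorm r q.
Proof.
move=> r0; pose n := maxn (size p) (size q).
rewrite !(@pnormE n) ?leq_maxl ?leq_maxr ?size_polyD // -big_split /=.
apply: ler_sum => j _; rewrite -mulrDl coefD; apply: ler_wpM2r; rewrite ?exprn_ge0 //.
exact: ler_normD.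
Qed.

Lemma pnorm_sum r n (F : 'I_n -> {poly R}) : 0 <= r ->
  pnorm r (\sum_i F i) <= \sum_i pnorm r (F i).
Proof.
move=> r0; elim: n F => [|n IH] F.
  by rewrite !big_ord0 /pnorm size_poly0 big_ord0.
rewrite !big_ord_recl; apply: le_trans (pnormD _ _ r0) _.
by rewrite lerD2l.
Qed.

Lemma pnormN r p : pnorm r (- p) = pnorm r p.
Proof. by rewrite /pnorm size_polyN; apply: eq_bigr => j _; rewrite coefN normrN. Qed.

Lemma pnormB r p q : 0 <= r -> pnorm r (p - q) <= pnorm r p + pnorm r q.
Proof. by move=> r0; rewrite -(pnormN r q); exact: pnormD. Qed.

Lemma pnormM r p q : 0 <= r -> pnorm r (p * q) <= pnorm r p * pnorm r q.
Proof.
move=> r0; pose a (s : {poly R}) := \poly_(i < size s) `|s`_i|.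
have aE s : pnorm r s = (a s).[r].
  by rewrite horner_poly.
have ac s i : (a s)`_i = `|s`_i|.
  by rewrite coef_poly; case: ltnP => // si; rewrite nth_default // normr0.
rewrite !aE -hornerM.
pose n := (size (a p * a q)%R + size (a (p * q)%R))%N.
rewrite (@horner_coef_wide _ n (a (p * q))) ?leq_addl //.
rewrite (@horner_coef_wide _ n (a p * a q)) ?leq_addr //.
apply: ler_sum => i _; apply: ler_wpM2r; rewrite ?exprn_ge0 //.
rewrite ac !coefM; apply: le_trans (ler_norm_sum _ _ _) _.
by apply: ler_sum => j _; rewrite normrM !ac.
Qed.

Lemma pnorm_exp r p k : 0 <= r -> pnorm r (p ^+ k) <= pnorm r p ^+ k.
Proof.
move=> r0; elim: k => [|k IH].
  by rewrite !expr0 /pnorm size_poly1 big_ord1 coef1 normr1 mul1r.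
rewrite !exprS; apply: le_trans (pnormM _ _ r0) _.
by apply: ler_wpM2l => //; exact: pnorm_ge0.
Qed.

Lemma pnormC r c : pnorm r c%:P = `|c|.
Proof. by rewrite (@pnormE 1) ?size_polyC_leq1 // big_ord1 coefC mulr1. Qed.

Lemma pnormX r : pnorm r 'X = r.
Proof.
rewrite /pnorm size_polyX !big_ord_recl big_ord0 !coefX /=.
by rewrite normr0 normr1 mul0r add0r addr0 mul1r.
Qed.

Lemma pnormXnM r p n : pnorm r ('X^n * p) = r ^+ n * pnorm r p.
Proof.
have sz : (size ('X^n * p)%R <= n + size p)%N.
  by apply: leq_trans (size_polyMleq _ _) _; rewrite size_polyXn.
rewrite (pnormE _ sz) big_split_ord /= big1 ?add0r; last first.
  by move=> i _; rewrite coefXnM ltn_ord normr0 mul0r.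
rewrite /pnorm mulr_sumr; apply: eq_bigr => i _.
by rewrite coefXnM ltnNge leq_addr addKn exprD mulrCA.
Qed.

Lemma horner_pnorm r p x : `|x| <= r -> `|p.[x]| <= pnorm r p.
Proof.
move=> xr; rewrite horner_coef; apply: le_trans (ler_norm_sum _ _ _) _.
apply: ler_sum => i _; rewrite normrM normrX; apply: ler_wpM2l => //.
by apply: lerXn2r => //; rewrite nnegrE (le_trans _ xr).
Qed.

Lemma horner_tail r p x n : 0 < r -> `|x| <= r -> 'X^n %| p ->
  `|p.[x]| <= (`|x| / r) ^+ n * pnorm r p.
Proof.
move=> r0 xr /dvdpP[q ->]; rewrite mulrC pnormXnM hornerM hornerXn normrM normrX.
rewrite expr_div_n mulrA divfK ?expf_neq0 ?gt_eqF //.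
by apply: ler_wpM2l; rewrite ?exprn_ge0 //; exact: horner_pnorm.
Qed.
End PolyNorm.

Section Analytic.
Context (R : realType).
Implicit Types (f g h : R -> R) (t x r C : R) (u v : nat -> {poly R}).

(** A power series at t, presented by polynomials u M that are bounded in norm and
    whose coefficients below M no longer change after M.  The u M need not be its
    partial sums; for sums, products and solutions of fixed point equations it is
    enough to compute with the u M. *)
Definition papprox u r C t f :=
  [/\ 0 < r, forall M, pnorm r (u M) <= C, forall M, 'X^M %| u M.+1 - u M
    & forall x, `|x| < r -> (u M).[x] @[M --> \oo] --> f (t + x)].

Definition ganalytic t f := exists u r C, papprox u r C t f.

Lemma papprox_shrink u r r' C t f : 0 < r' -> r' <= r ->
  papprox u r C t f -> papprox u r' C t f.
Proof.
move=> r'0 r'r [r0 Hn Hs Hc]; split => // [M|x xr'].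
  by apply: le_trans (Hn M); apply: pnorm_mono => //; exact: ltW.
by apply: Hc; exact: lt_le_trans r'r.
Qed.

Lemma papprox_near u r C t f g : papprox u r C t f -> (\forall x \near t, f x = g x) ->
  exists2 r', 0 < r' & forall r'', 0 < r'' -> r'' <= r' -> papprox u r'' C t g.
Proof.
move=> A /nbhs_ballP[d /= d0 Hd]; have [r0 _ _ _] := A.
exists (Num.min r d); first by rewrite lt_min r0.
move=> r'' r''0; rewrite le_min => /andP[rr rd].
have [_ Hn Hs Hc] := papprox_shrink r''0 rr A; split => // x xr.
have <- : f (t + x) = g (t + x); last exact: Hc.
apply: Hd; rewrite /ball /= opprD addrA subrr add0r normrN.
exact: lt_le_trans rd.
Qed.

Lemma ganalytic_ext t f g : (\forall x \near t, f x = g x) ->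
  ganalytic t f -> ganalytic t g.
Proof.
move=> fg [u [r [C A]]]; have [r' r'0 H] := papprox_near A fg.
by exists u, r', C; exact: H.
Qed.

Lemma ganalytic_cst t a : ganalytic t (fun _ => a).
Proof.
exists (fun _ => a%:P), 1, `|a|; split=> //.
- by move=> M; rewrite pnormC.
- by move=> M; rewrite subrr dvdp0.
- by move=> x _; under eq_fun do rewrite hornerC; exact: cvg_cst.
Qed.

Lemma ganalytic_id t : ganalytic t id.
Proof.
exists (fun M => t%:P + 'X), 1, (`|t| + 1); split=> //.
- move=> M; apply: le_trans (pnormD _ _ ler01) _.
  by rewrite pnormC pnormX.
- by move=> M; rewrite subrr dvdp0.
- by move=> x _; under eq_fun do rewrite hornerD hornerC hornerX; exact: cvg_cst.
Qed.

Lemma papprox_common u r C t f v r' C' g : papprox u r C t f -> papprox v r' C' t g ->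
  exists r'', papprox u r'' C t f /\ papprox v r'' C' t g.
Proof.
move=> A B; have [r0 _ _ _] := A; have [r'0 _ _ _] := B.
have m0 : 0 < Num.min r r' by rewrite lt_min r0.
by exists (Num.min r r'); split;
  [apply: papprox_shrink A|apply: papprox_shrink B]; rewrite ?ge_min ?lexx ?orbT.
Qed.

Lemma ganalytic_D t f g : ganalytic t f -> ganalytic t g ->
  ganalytic t (fun x => f x + g x).
Proof.
move=> [u [r1 [C A]]] [v [r2 [C' B]]]; have [r [{}A {}B]] := papprox_common A B.
have [r0 An As Ac] := A; have [_ Bn Bs Bc] := B.
exists (fun M => u M + v M), r, (C + C'); split=> // [M|M|x xr].
- by apply: le_trans (pnormD _ _ (ltW r0)) _; exact: lerD.
- by rewrite opprD addrACA; apply: dvdp_add.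
- by under eq_fun do rewrite hornerD; apply: cvgD; [exact: Ac|exact: Bc].
Qed.

Lemma papprox_C_ge0 u r C t f : papprox u r C t f -> 0 <= C.
Proof. by move=> [r0 H _ _]; apply: le_trans (H 0%N); apply: pnorm_ge0; exact: ltW. Qed.

Lemma ganalytic_M t f g : ganalytic t f -> ganalytic t g ->
  ganalytic t (fun x => f x * g x).
Proof.
move=> [u [r1 [C A]]] [v [r2 [C' B]]]; have [r [{}A {}B]] := papprox_common A B.
have [r0 An As Ac] := A; have [_ Bn Bs Bc] := B.
exists (fun M => u M * v M), r, (C * C'); split=> // [M|M|x xr].
- apply: le_trans (pnormM _ _ (ltW r0)) _.
  by apply: ler_pM => //; apply: pnorm_ge0; exact: ltW.
- rewrite (_ : _ - _ = (u M.+1 - u M) * v M.+1 + u M * (v M.+1 - v M)); last by ring.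
  by apply: dvdp_add; [exact: dvdp_mulr|exact: dvdp_mull].
- by under eq_fun do rewrite hornerM; apply: cvgM; [exact: Ac|exact: Bc].
Qed.

Lemma ganalytic_sum t m (F : 'I_m -> R -> R) : (forall i, ganalytic t (F i)) ->
  ganalytic t (fun x => \sum_i F i x).
Proof.
elim: m F => [|m IH] F HF.
  by apply: ganalytic_ext (ganalytic_cst t 0); apply: filterE => x; rewrite big_ord0.
apply: ganalytic_ext (ganalytic_D (IH (fun i => F (lift ord0 i)) _) (HF ord0)) => //.
by apply: filterE => x; rewrite big_ord_recl addrC.
Qed.

Lemma papprox_at u r C t f : papprox u r C t f -> (u M).[0] @[M --> \oo] --> f t.
Proof. by move=> [r0 _ _]; move=> /(_ 0); rewrite normr0 addr0; apply. Qed.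

Lemma papprox_le u r C t f x B : papprox u r C t f -> `|x| < r ->
  (forall M, `|(u M).[x] - (u M).[0]| <= B) -> `|f (t + x) - f t| <= B.
Proof.
move=> A xr HB; have [_ _ _ /(_ x xr) Hc] := A.
have H : (fun M => `|(u M).[x] - (u M).[0]|) @ \oo --> `|f (t + x) - f t|.
  exact: cvg_norm (cvgB Hc (papprox_at A)).
by apply: (cvgr_to_le H); apply: nearW.
Qed.

Lemma dvdpX1 (p : {poly R}) : ('X^1 %| p) = (p.[0] == 0).
Proof. by rewrite expr1 -['X]subr0 -polyC0 dvdp_XsubCl. Qed.

Lemma ganalytic_cont t f : ganalytic t f -> {for t, continuous f}.
Proof.
move=> [u [r [C A]]]; have C0 := papprox_C_ge0 A; have [r0 An As Ac] := A.
apply/cvgrPdist_le => e e0.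
pose d := Num.min r (e * r / (2 * C + 1)).
have K0 : 0 < 2 * C + 1 by lra.
have d0 : 0 < d by rewrite lt_min r0 divr_gt0 // mulr_gt0.
apply/nbhs_ballP; exists d => //= y; rewrite /ball /= distrC lt_min => /andP[yr yd].
rewrite distrC -[y](subrKC t); apply: (papprox_le A) => // M.
set x := y - t; have D : 'X^1 %| u M - (u M).[0]%:P.
  by rewrite dvdpX1 hornerD hornerN hornerC subrr.
rewrite -[(u M).[0]](hornerC _ x) -hornerN -hornerD.
apply: le_trans (horner_tail r0 (ltW yr) D) _; rewrite expr1.
have HC : pnorm r (u M - (u M).[0]%:P) <= 2 * C.
  apply: le_trans (pnormB _ _ (ltW r0)) _; rewrite pnormC.
  have : `|(u M).[0]| <= pnorm r (u M) by apply: horner_pnorm; rewrite normr0 ltW.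
  by have := An M; lra.
apply: le_trans (ler_wpM2l _ HC) _; first by rewrite divr_ge0 // ltW.
rewrite mulrAC ler_pdivrMr //; move: (ltW yd); rewrite ler_pdivlMr //.
by apply: le_trans; rewrite ler_wpM2l //; lra.
Qed.
End Analytic.

Section AnalyticRoots.
Context (R : realType).
Implicit Types (f g h : R -> R) (t x r C : R) (u v : nat -> {poly R}).

Lemma stable_at0 u : (forall M, 'X^M %| u M.+1 - u M) -> forall M, (u M.+1).[0] = (u 1%N).[0].
Proof.
move=> Hu; elim=> // M <-; apply/eqP; rewrite -subr_eq0 -hornerN -hornerD -dvdpX1.
by apply: dvdp_trans (Hu M.+1); apply: dvdp_exp2l.
Qed.

Lemma ganalytic_quot t f : ganalytic t f -> f t = 0 ->
  exists2 g, ganalytic t g & forall x, f x = (x - t) * g x.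
Proof.
move=> [u [r [C A]]] f0; have [r0 An As Ac] := A.
have u0 M : (u M.+1).[0] = 0.
  have st := stable_at0 As; rewrite st.
  have H : (u M.+1).[0] @[M --> \oo] --> 0.
    by have := papprox_at A; rewrite f0 -(cvg_shiftS (fun M => (u M).[0])).
  have H' : (u M.+1).[0] @[M --> \oo] --> (u 1%N).[0].
    by under eq_fun do rewrite st; exact: cvg_cst.
  exact: cvg_unique H' H.
pose v M := u M.+1 %/ 'X.
have uv M : u M.+1 = 'X * v M.
  by rewrite /v mulrC divpK // -(expr1 'X) dvdpX1 u0.
pose g x := if x == t then (v 1%N).[0] else f x / (x - t).
have vs M : 'X^M %| v M.+1 - v M.
  have := As M.+1; rewrite !uv -mulrBr exprS dvdp_mul2l // polyX_eq0 //.
exists g; last first.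
  move=> x; rewrite /g; case: eqVneq => [->|xt]; first by rewrite f0 subrr mul0r.
  by rewrite mulrC divfK // subr_eq0.
exists v, r, (C / r); split => // [M|x xr].
  by rewrite ler_pdivlMr // mulrC; have := An M.+1; rewrite uv -(expr1 'X) pnormXnM expr1.
rewrite /g; case: eqVneq => [xt|xt].
  have -> : x = 0 by rewrite -(addKr t x) xt addNr.
  rewrite -(cvg_shiftS (fun M => (v M).[0])).
  by under eq_fun do rewrite (stable_at0 vs); exact: cvg_cst.
have x0 : x != 0 by apply: contraNneq xt => ->; rewrite addr0.
rewrite addrAC subrr add0r.
have vE M : (v M).[x] = (u M.+1).[x] / x by rewrite uv hornerM hornerX mulrAC divff ?mul1r.
under eq_fun do rewrite vE.
by apply: cvgMl; rewrite (cvg_shiftS (fun M => (u M).[x])); exact: Ac.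
Qed.

(** A series that vanishes at t is 'X times a series, so that its norm shrinks
    proportionally to the radius. *)
Lemma ganalytic_normal t f : ganalytic t f -> f t = 0 ->
  exists u r C, [/\ papprox u r C t f, forall M, 'X %| u M
    & forall M r', 0 < r' -> r' <= r -> pnorm r' (u M) <= r' * C].
Proof.
move=> fa f0; have [g [v [r [C A]]] fg] := ganalytic_quot fa f0.
have [r0 An As Ac] := A; have C0 := papprox_C_ge0 A.
have HX M r' : 0 < r' -> r' <= r -> pnorm r' ('X * v M) <= r' * C.
  move=> r'0 r'r; rewrite -(expr1 'X) pnormXnM expr1; apply: ler_wpM2l; first exact: ltW.
  by apply: le_trans (An M); apply: pnorm_mono => //; exact: ltW.
exists (fun M => 'X * v M), r, (C + r * C); split=> [|M|M r' r'0 r'r].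
- split=> // [M|M|x xr].
  + by apply: le_trans (HX M r r0 _) _ => //; rewrite lerDr.
  + by rewrite -mulrBr; apply: dvdp_mull.
  + rewrite fg addrAC subrr add0r; under eq_fun do rewrite hornerM hornerX.
    by apply: cvgMr; exact: Ac.
- exact: dvdp_mulr.
- by apply: le_trans (HX M r' r'0 r'r) _; rewrite ler_pM2l // lerDl mulr_ge0 // ltW.
Qed.

Lemma contraction_cvg0 (e d : nat -> R) : (forall M, 0 <= e M) ->
  (forall M, e M.+1 <= e M / 2 + d M) -> d @ \oo --> 0 -> e @ \oo --> 0.
Proof.
move=> e0 ed d0; apply/cvgrPdist_le => eps eps0.
have eps4 : 0 < eps / 4 by rewrite divr_gt0.
have [N0 _ HN0] : \forall M \near \oo, `|0 - d M| <= eps / 4 by move/cvgrPdist_le : d0 => /(_ _ eps4).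
have HN k : e (N0 + k)%N <= e N0 * 2^-1 ^+ k + eps / 2.
  elim: k => [|k IH]; first by rewrite addn0 expr0 mulr1 lerDl; lra.
  rewrite addnS; apply: le_trans (ed _) _.
  have := HN0 (N0 + k)%N (leq_addr _ _); rewrite sub0r normrN => Hd.
  have := le_trans (ler_norm _) Hd; rewrite exprS; lra.
have H2 : (fun k => e N0 * (2^-1 : R) ^+ k) @ \oo --> 0.
  rewrite -(mulr0 (e N0)); apply: cvgMr; apply: cvg_expr.
  by rewrite ger0_norm //; lra.
have eps2 : 0 < eps / 2 by rewrite divr_gt0.
have [N1 _ HN1] : \forall M \near \oo, `|0 - e N0 * 2^-1 ^+ M| <= eps / 2 by move/cvgrPdist_le : H2 => /(_ _ eps2).
exists (N0 + N1)%N => // M /= HM; rewrite sub0r normrN ger0_norm //.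
rewrite -(subnKC (leq_trans (leq_addr _ _) HM)).
have := HN1 (M - N0)%N; rewrite /= leq_subRL ?(leq_trans (leq_addr N1 N0)) // => /(_ HM).
rewrite sub0r normrN => H; have := le_trans (ler_norm _) H.
have := HN (M - N0)%N; lra.
Qed.

Lemma power_lipschitz (d a b : R) k : `|a| <= d -> `|b| <= d ->
  `|a ^+ k - b ^+ k| <= k%:R * d ^+ k.-1 * `|a - b|.
Proof.
move=> ad bd; have d0 : 0 <= d by exact: le_trans ad.
case: k => [|k]; first by rewrite !expr0 subrr normr0 mul0r mul0r.
rewrite subrXX normrM mulrC; apply: ler_wpM2r => //.
apply: le_trans (ler_norm_sum _ _ _) _.
rewrite mulr_natl -[X in _ *+ X]card_ord -sumr_const; apply: ler_sum => i _ /=.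
rewrite normrM !normrX -[in leRHS](@subnK i k) ?exprD; last by rewrite -ltnS.
by apply: ler_pM; rewrite ?exprn_ge0 //; apply: lerXn2r; rewrite ?nnegrE.
Qed.

(** The approximations U of z are the iterates of the fixed point equation, each with
    the next approximations of the coefficients.  As c 0 and c 1 vanish at t,
    their norms are small for a small radius r, and the equation maps the ball
    of radius d of the normed polynomials to itself and contracts it by 1 / 2.  It
    also improves divisibility: if 'X^M divides U M.+1 - U M, then 'X^M.+1 divides the
    next difference, since 'X divides c 0, c 1 and all U M. *)
Lemma ganalytic_fix t N (c : nat -> R -> R) (z : R -> R) :
  (forall k, ganalytic t (c k)) -> c 0%N t = 0 -> c 1%N t = 0 ->
  z t = 0 -> {for t, continuous z} ->
  (\forall x \near t, z x = \sum_(k < N.+2) c k x * z x ^+ k) ->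
  ganalytic t z.
Proof.
move=> ca c0 c1 z0 zc zE.
have /choice[uC HuC] : forall k, exists p : (nat -> {poly R}) * R, exists2 r, 0 < r &
    papprox p.1 r p.2 t (c k) /\ ((k < 2)%N -> (forall M, 'X %| p.1 M) /\
      forall M r', 0 < r' -> r' <= r -> pnorm r' (p.1 M) <= r' * p.2).
  move=> k; have [k2|k2] := ltnP k 2.
    have ck : c k t = 0 by case: k k2 => [|[|]].
    have [u [r [C [A H1 H2]]]] := ganalytic_normal (ca k) ck.
    by exists (u, C), r => //; have [] := A.
  by have [u [r [C A]]] := ca k; exists (u, C), r => //; have [] := A.
pose u k := (uC k).1; pose C k := (uC k).2.
pose n := N.+2; pose nR : R := n%:R.
have nR0 : 1 <= nR by rewrite ler1n.
have [r0 r0_gt0 Hr0] : exists2 r0, 0 < r0 & forall k : 'I_n,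
    papprox (u k) r0 (C k) t (c k) /\ ((k < 2)%N -> (forall M, 'X %| u k M) /\
      forall M r', 0 < r' -> r' <= r0 -> pnorm r' (u k M) <= r' * C k).
  apply: (@fin_pos R _ (fun (k : 'I_n) r0 => papprox (u k) r0 (C k) t (c k) /\
      ((k < 2)%N -> (forall M, 'X %| u k M) /\
      forall M r', 0 < r' -> r' <= r0 -> pnorm r' (u k M) <= r' * C k))).
    move=> k r r' [A H] r'0 r'r; split; first exact: papprox_shrink A.
    move=> /H[H1 H2]; split=> // M r'' r''0 r''r'.
    by apply: H2 => //; exact: le_trans r'r.
  by move=> k; have [r r_gt0 H] := HuC k; exists r.
(* K bounds the norms of all coefficients, and d is so small that the terms of
   order at least 2 contract by 1 / 4 on the ball of radius d. *)
pose K := 1 + \sum_(k < n) `|C k|.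
have K1 : 1 <= K by rewrite lerDl sumr_ge0.
have CK (k : 'I_n) : C k <= K.
  rewrite /K (bigD1 k) //=; have := ler_norm (C k).
  have : 0 <= \sum_(i < n | i != k) `|C i| by exact: sumr_ge0.
  lra.
pose B := 4 * K * nR ^+ 2.
have B4 : 4 <= B.
  rewrite /B -[leLHS]mulr1; apply: ler_pM => //; last by rewrite exprn_ege1.
  lra.
pose d := B^-1.
have d0 : 0 < d by rewrite invr_gt0; lra.
have dB : d * B = 1 by rewrite mulVf //; apply/eqP => B0; lra.
have d1 : d <= 1 / 4 by rewrite /d div1r lef_pV2 ?posrE //; lra.
have near_z : \forall x \near t, `|z x| <= d /\ z x = \sum_(k < n) c k x * z x ^+ k.
  have zd : \forall x \near t, `|z x| <= d.
    move/cvgrPdist_le : zc => /(_ d d0); apply: filterS => x.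
    by rewrite z0 sub0r normrN.
  by apply: filterS2 zd zE.
have /nbhs_ballP[r1 /= r1_gt0 Hr1] := near_z.
pose r := Num.min (Num.min r0 r1) (d / (2 * K)).
have r_gt0 : 0 < r by rewrite !lt_min r0_gt0 r1_gt0 divr_gt0 //; lra.
have rr0 : r <= r0 by rewrite !ge_min lexx.
have rr1 : r <= r1 by rewrite !ge_min lexx orbT.
have rK : r * K <= d / 2.
  have : r <= d / (2 * K) by rewrite ge_min lexx orbT.
  rewrite ler_pdivlMr; last by lra.
  lra.
have A (k : 'I_n) : papprox (u k) r (C k) t (c k) by have [A _] := Hr0 k; exact: papprox_shrink A.
have Xu (k : 'I_n) M : (k < 2)%N -> 'X %| u k M by have [_ H] := Hr0 k => /H[].
have nu_lt (k : 'I_n) M : (k < 2)%N -> pnorm r (u k M) <= d / 2.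
  have [_ H] := Hr0 k => /H[_ /(_ M r r_gt0 rr0) H2]; apply: le_trans H2 _.
  by apply: le_trans rK; rewrite ler_pM2l.
have nu (k : 'I_n) M : pnorm r (u k M) <= K by have [_ H _ _] := A k; apply: le_trans (CK k).
pose w (k : 'I_n) := if (k < 2)%N then d / 2 else K.
have nuw (k : 'I_n) M : pnorm r (u k M) <= w k.
  by rewrite /w; case: ltnP => k2; [exact: nu_lt|exact: nu].
have w0 (k : 'I_n) : 0 <= w k by apply: le_trans (nuw k 0%N); apply: pnorm_ge0; exact: ltW.
have KnR : K * nR * nR * d = 1 / 4.
  move: dB; rewrite /B expr2; lra.
have K0 : 0 < K by lra.
have nR_gt0 : 0 < nR by lra.
have NnR : (N%:R : R) <= nR by rewrite ler_nat /n -addn2 leq_addr.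
have dle1 i : d ^+ i <= 1 by apply: exprn_ile1; lra.
have d0' := ltW d0.
have sum_w : \sum_(k < n) w k * d ^+ k <= d.
  rewrite /n !big_ord_recl /w /= expr0 expr1 mulr1.
  have : \sum_(i < N) K * d ^+ (bump 0 (bump 0 i)) <= \sum_(i < N) K * (d * d).
    apply: ler_sum => i _; rewrite ler_pM2l // /bump /= !add1n !exprS mulrA.
    by rewrite ler_piMr // mulr_ge0.
  rewrite sumr_const card_ord -mulr_natl => H.
  have : N%:R * (K * (d * d)) <= d / 4.
    have KNd : K * N%:R * d <= 1 / 4.
      rewrite -KnR; apply: ler_wpM2r => //.
      have : K * N%:R <= K * nR by rewrite ler_pM2l.
      have : K * nR <= K * nR * nR by rewrite ler_peMr // mulr_ge0 // ltW.
      lra.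
    by have := ler_wpM2l d0' KNd; lra.
  have : d / 2 * d <= d / 8 by nra.
  by under eq_bigr do rewrite /=; lra.
have sum_lip : \sum_(k < n) w k * (k%:R * d ^+ k.-1) <= 1 / 2.
  rewrite /n !big_ord_recl /w /= mul0r mulr0 add0r expr0 mulr1.
  set S := \sum_(i < N) _.
  have : S <= \sum_(i < N) K * (nR * d).
    apply: ler_sum => i _; rewrite ler_pM2l // /bump /= !add1n !add0n.
    apply: ler_pM => //; first by rewrite exprn_ge0.
      by rewrite ler_nat /n !ltnS ltnW.
    by rewrite exprS ler_piMr.
  rewrite sumr_const card_ord -mulr_natl => H.
  have : N%:R * (K * (nR * d)) <= 1 / 4.
    rewrite -KnR.
    have := ler_wpM2r (mulr_ge0 (ltW K0) (mulr_ge0 (ltW nR_gt0) d0')) NnR; lra.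
  rewrite /bump /= addn0 mulr1; lra.
pose U := fix U M := if M is M'.+1 then \sum_(k < n) u k M'.+1 * U M' ^+ k else 0.
have US M : U M.+1 = \sum_(k < n) u k M.+1 * U M ^+ k by [].
have Un M : pnorm r (U M) <= d.
  elim: M => [|M IH]; first by rewrite /pnorm size_poly0 big_ord0 ltW.
  rewrite US; apply: le_trans (pnorm_sum _ (ltW r_gt0)) _.
  apply: le_trans sum_w; apply: ler_sum => k _.
  apply: le_trans (pnormM _ _ (ltW r_gt0)) _.
  have r_ge0 := ltW r_gt0.
  apply: ler_pM; [exact: pnorm_ge0|exact: pnorm_ge0|exact: nuw|].
  apply: le_trans (pnorm_exp _ _ r_ge0) _.
  by apply: lerXn2r; rewrite ?nnegrE ?pnorm_ge0.
have XU M : 'X %| U M.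
  elim: M => [|M IH]; first exact: dvdp0.
  rewrite US; elim/big_ind: _ => [|p q|k _]; [exact: dvdp0|exact: dvdp_add|].
  have [k2|k2] := ltnP k 2; first by apply: dvdp_mulr; exact: Xu.
  by apply: dvdp_mull; case: (nat_of_ord k) k2 => // k' _; rewrite exprS; exact: dvdp_mulr.
have SU M : 'X^M %| U M.+1 - U M.
  elim: M => [|M IH]; first by rewrite expr0 dvd1p.
  rewrite (US M.+1) {2}US -sumrB; elim/big_ind: _ => [|p q|k _]; [exact: dvdp0|exact: dvdp_add|].
  rewrite (_ : _ - _ = (u k M.+2 - u k M.+1) * U M.+1 ^+ k +
     u k M.+1 * (U M.+1 ^+ k - U M ^+ k)); last by ring.
  apply: dvdp_add; first by apply: dvdp_mulr; have [_ _ As _] := A k; exact: As.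
  rewrite exprS; have [k2|k2] := ltnP k 2.
    apply: dvdp_mul; first exact: Xu.
    by case: (nat_of_ord k) k2 => [|[|]] // _; rewrite ?expr0 ?subrr ?dvdp0 ?expr1.
  apply: dvdp_mull; rewrite subrXX mulrC; apply: dvdp_mul => //.
  elim/big_ind: _ => [|p q|j _]; [exact: dvdp0|exact: dvdp_add|].
  have [j0|j0] := eqVneq (nat_of_ord j) 0%N.
    apply: dvdp_mulr; rewrite j0 subn0; case: (nat_of_ord k) k2 => [|[|k']] // _.
    by rewrite exprS; exact: dvdp_mulr.
  by apply: dvdp_mull; case: (nat_of_ord j) j0 => // j' _; rewrite exprS; exact: dvdp_mulr.
exists U, r, d; split=> // x xr.
have [zd zx] : `|z (t + x)| <= d /\ z (t + x) = \sum_(k < n) c k (t + x) * z (t + x) ^+ k.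
  apply: Hr1; rewrite /ball /= opprD addrA subrr add0r normrN.
  exact: lt_le_trans rr1.
set y := z (t + x) in zd zx *.
pose e M := `|(U M).[x] - y|.
pose dl M := \sum_(k < n) `|(u k M.+1).[x] - c k (t + x)|.
have Ud M : `|(U M).[x]| <= d by apply: le_trans (Un M); apply: horner_pnorm; exact: ltW.
have eS M : e M.+1 <= e M / 2 + dl M.
  rewrite {1}/e US horner_sum [in X in _ - X]zx -sumrB; apply: le_trans (ler_norm_sum _ _ _) _.
  have -> : e M / 2 = 1 / 2 * `|(U M).[x] - y| by rewrite /e; lra.
  apply: le_trans (lerD (ler_wpM2r (normr_ge0 _) sum_lip) (lexx _)).
  rewrite mulr_suml -big_split /=; apply: ler_sum => k _.
  rewrite hornerM horner_exp.
  rewrite (_ : _ - _ = (u k M.+1).[x] * ((U M).[x] ^+ k - y ^+ k) +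
     ((u k M.+1).[x] - c k (t + x)) * y ^+ k); last by ring.
  apply: le_trans (ler_normD _ _) _; apply: lerD; last first.
    rewrite normrM ler_piMr // normrX; apply: exprn_ile1 => //.
    by apply: le_trans zd _; lra.
  rewrite normrM -mulrA; apply: ler_pM => //.
    by apply: le_trans (nuw k M.+1); apply: horner_pnorm; exact: ltW.
  exact: power_lipschitz.
have dl0 : dl @ \oo --> 0.
  have -> : (0 : R) = \sum_(k < n) 0 by rewrite big1.
  apply: cvg_big => [|k _]; first exact: add_continuous.
  rewrite -[X in _ --> X](normr0 R); apply: cvg_norm.
  rewrite -[X in _ --> X](subrr (c k (t + x))); apply: cvgB; last exact: cvg_cst.
  by rewrite (cvg_shiftS (fun M => (u k M).[x])); have [_ _ _] := A k; apply.
have e0 : e @ \oo --> 0 by apply: contraction_cvg0 eS dl0 => M; exact: normr_ge0.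
apply/cvgrPdist_le => eps eps0; move/cvgrPdist_le : e0 => /(_ eps eps0).
by apply: filterS => M; rewrite sub0r normrN normr_id distrC.
Qed.

(** Newton's form of the equation: expand the polynomial around z t, divide by minus
    the derivative D at this simple root and add the unknown w = z - z t on both
    sides.  This is a fixed point equation for w, whose constant and linear
    coefficients vanish at t. *)
Lemma ganalytic_hensel t N (a : 'I_N -> R -> R) z : (forall i, ganalytic t (a i)) ->
  (\forall x \near t, horn a x (z x) = 0) ->
  {for t, continuous z} -> dhorn a t (z t) (z t) != 0 -> ganalytic t z.
Proof.
move=> aa root_z zc simple; set D := dhorn a t (z t) (z t) in simple.
set z0 := z t in D simple.
pose b k x := \sum_(i < N) a i x * ('C(i, k)%:R * z0 ^+ (i - k)).
have bE x w : horn a x (z0 + w) = \sum_(k < N.+2) b k x * w ^+ k.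
  rewrite /horn /b; under [RHS]eq_bigr do rewrite mulr_suml.
  rewrite exchange_big /=; apply: eq_bigr => i _.
  under [RHS]eq_bigr do rewrite -mulrA; rewrite -mulr_sumr; congr (_ * _).
  rewrite exprDn (big_ord_widen N.+2 (fun k => z0 ^+ (i - k) * w ^+ k *+ 'C(i, k))); last first.
    by apply: leq_trans (ltn_ord i) _; rewrite -addn2 leq_addr.
  rewrite big_mkcond /=; apply: eq_bigr => k _.
  rewrite -mulr_natl mulrA; case: ltnP => // ik.
  by rewrite bin_small // !mul0r.
have ba k : ganalytic t (b k).
  by apply: ganalytic_sum => i; apply: ganalytic_M => //; exact: ganalytic_cst.
have b0 : b 0%N t = 0.
  have := nbhs_singleton root_z; rewrite -/z0 -[z0]addr0 bE big_ord_recl expr0 mulr1 big1 ?addr0 //.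
  by move=> i _; rewrite expr0n mulr0.
have b1 : b 1%N t = D.
  rewrite /b /D /dhorn; apply: eq_bigr => i _; congr (_ * _).
  rewrite bin1; transitivity (\sum_(j < i) z0 ^+ (i - 1)).
    by rewrite sumr_const card_ord mulr_natl.
  apply: eq_bigr => j _; rewrite -exprD subnK ?subn1 //.
  by rewrite -ltnS (leq_trans (ltn_ord j)) // leqSpred.
pose c k x := (- D^-1) * b k x + (k == 1%N)%:R.
have ca k : ganalytic t (c k).
  by apply: ganalytic_D; [apply: ganalytic_M => //; exact: ganalytic_cst|exact: ganalytic_cst].
have wa : ganalytic t (fun x => z x - z0).
  apply: (@ganalytic_fix t N c) => //.
  - by rewrite /c b0 mulr0 addr0.
  - by rewrite /c b1 mulNr mulVf // addNr.
  - by rewrite subrr.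
  - by apply: cvgB => //; exact: cvg_cst.
  apply: filterS root_z => x rx; have := bE x (z x - z0); rewrite subrKC rx => /esym bx.
  rewrite /c; under eq_bigr do rewrite mulrDl -mulrA; rewrite big_split /= -mulr_sumr bx mulr0 add0r.
  by rewrite !big_ord_recl /= mul0r add0r mul1r expr1 big1 ?addr0 // => i _; rewrite mul0r.
apply: ganalytic_ext (ganalytic_D wa (ganalytic_cst t z0)).
by apply: filterE => x; rewrite subrK.
Qed.
End AnalyticRoots.

(** * The three classes of germs *)

Section GermClasses.
Context (R : realType).
Implicit Types (f g z : R -> R) (t x : R) (k : smoothness).

Definition gcl k t f : Prop :=
  match k with
  | Cfin n => gC n t f
  | Cinfty => forall n, gC n t f
  | Comega => ganalytic t f
  end.

(** Class k at all parameters near t; unlike a germ property at t alone, this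
    is what a curve on an interval around t provides. *)
Definition ncl k t f := \forall x \near t, gcl k x f.

Lemma gcl_ext k t f g : (\forall x \near t, f x = g x) -> gcl k t f -> gcl k t g.
Proof.
move=> fg; case: k => [n||] /=; [exact: gC_ext|by move=> H n; exact: gC_ext (H n)|].
exact: ganalytic_ext.
Qed.

Lemma gcl_cst k t a : gcl k t (fun _ => a).
Proof. by case: k => [n||] /=; [exact: gC_cst|move=> n; exact: gC_cst|exact: ganalytic_cst]. Qed.

Lemma gcl_id k t : gcl k t id.
Proof. by case: k => [n||] /=; [exact: gC_id|move=> n; exact: gC_id|exact: ganalytic_id]. Qed.

Lemma gcl_D k t f g : gcl k t f -> gcl k t g -> gcl k t (fun x => f x + g x).
Proof.
case: k => [n||] /=; [exact: gC_D|by move=> H1 H2 n; apply: gC_D|exact: ganalytic_D].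
Qed.

Lemma gcl_M k t f g : gcl k t f -> gcl k t g -> gcl k t (fun x => f x * g x).
Proof.
case: k => [n||] /=; [exact: gC_M|by move=> H1 H2 n; apply: gC_M|exact: ganalytic_M].
Qed.

Lemma gcl_cont k t f : gcl k t f -> {for t, continuous f}.
Proof.
by case: k => [n||] /=; [exact: gC_cont|move=> /(_ 0%N); exact: gC_cont|exact: ganalytic_cont].
Qed.

Lemma gcl_hensel k t N (a : 'I_N -> R -> R) z : (forall i, gcl k t (a i)) ->
  (\forall x \near t, horn a x (z x) = 0) ->
  {for t, continuous z} -> dhorn a t (z t) (z t) != 0 -> gcl k t z.
Proof.
case: k => [n||] /=; [exact: gC_hensel|move=> H ? ? ? n|exact: ganalytic_hensel].
by apply: (@gC_hensel _ n t N a) => // i; exact: H.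
Qed.

(** The inverse of f is the root of the linear polynomial f X - 1. *)
Lemma gcl_V k t f : f t != 0 -> gcl k t f -> gcl k t (fun x => (f x)^-1).
Proof.
move=> f0 fk; have fc := gcl_cont fk.
have fn0 : \forall x \near t, f x != 0.
  move/cvgrPdist_lt : fc => /(_ `|f t|); rewrite normr_gt0 => /(_ f0).
  by apply: filterS => x; apply: contraTneq => ->; rewrite subr0 ltxx.
pose a (i : 'I_2) x := if i == ord0 then -1 else f x.
apply: (@gcl_hensel k t 2 a) => //.
- by move=> i; rewrite /a; case: eqP => _; [exact: gcl_cst|].
- apply: filterS fn0 => x fx; rewrite /horn !big_ord_recl big_ord0 /a /=.
  by rewrite expr0 expr1 mulr1 mulfV // addr0 addNr.
- exact: cvgV.
- by rewrite /dhorn big_ord_recr big_ord1 /= big_ord0 big_ord1 /a /= mulr0 add0r expr0 !mulr1.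
Qed.

Lemma gcl_weak k j t f : gcl (smooth_add k j) t f -> gcl k t f.
Proof.
case: k => [n||] //=; rewrite addnC.
by elim: j => // j IH /gC_S/IH.
Qed.

Lemma gcl_quot k t f : gcl (smooth_add k 1) t f -> f t = 0 ->
  exists2 g, gcl k t g & forall x, f x = (x - t) * g x.
Proof.
have qE x : f t = 0 -> f x = (x - t) * quot t f x.
  move=> f0; rewrite /quot; case: eqVneq => [->|xt]; first by rewrite subrr mul0r.
  by rewrite mulrC divfK // subr_eq0.
case: k => [n||] /= fk f0.
- by exists (quot t f) => [|x]; [apply: gC_quot; rewrite // -addn1|exact: qE].
- by exists (quot t f) => [n|x]; [apply: gC_quot; rewrite // -addn1|exact: qE].
- exact: ganalytic_quot.
Qed.

Lemma ncl_gcl k t f : ncl k t f -> gcl k t f.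
Proof. exact: nbhs_singleton. Qed.

Lemma ncl_ext k t f g : (\forall x \near t, f x = g x) -> ncl k t f -> ncl k t g.
Proof. by move=> /near2; apply: filterS2 => x; exact: gcl_ext. Qed.

Lemma ncl_cst k t a : ncl k t (fun _ => a).
Proof. by apply: filterE => x; exact: gcl_cst. Qed.

Lemma ncl_D k t f g : ncl k t f -> ncl k t g -> ncl k t (fun x => f x + g x).
Proof. by apply: filterS2 => x; exact: gcl_D. Qed.

Lemma ncl_M k t f g : ncl k t f -> ncl k t g -> ncl k t (fun x => f x * g x).
Proof. by apply: filterS2 => x; exact: gcl_M. Qed.

Lemma ncl_sum k t (I : Type) (s : seq I) (F : I -> R -> R) : (forall i, ncl k t (F i)) ->
  ncl k t (fun x => \sum_(i <- s) F i x).
Proof.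
move=> HF; elim: s => [|i s IH].
  by apply: ncl_ext (ncl_cst k t 0); apply: filterE => x; rewrite big_nil.
by apply: ncl_ext (ncl_D (HF i) IH); apply: filterE => x; rewrite big_cons.
Qed.

Lemma ncl_cont k t f : ncl k t f -> {for t, continuous f}.
Proof. by move/ncl_gcl/gcl_cont. Qed.

Lemma ncl_weak k j t f : ncl (smooth_add k j) t f -> ncl k t f.
Proof. by apply: filterS => x; exact: gcl_weak. Qed.

Lemma ncl_hensel k t N (a : 'I_N -> R -> R) z : (forall i, ncl k t (a i)) ->
  (\forall x \near t, horn a x (z x) = 0) ->
  {for t, continuous z} -> dhorn a t (z t) (z t) != 0 -> ncl k t z.
Proof.
move=> ak root_z zc simple.
have acn i : \forall x \near t, {for x, continuous (a i)}.
  by apply: filterS (ak i) => x; exact: gcl_cont.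
have act i : {for t, continuous (a i)} := nbhs_singleton (acn i).
have zcn := root_continuous acn root_z zc simple.
have [c c0 Hc] := dhorn_away act zc simple.
have an := near_forall ak.
near=> x.
have Hx : \forall y \near x, c <= `|dhorn a y (z y) (z x)| by near: x.
apply: gcl_hensel.
- by near: x; exact: an.
- by near: x; exact: near2.
- by near: x.
- by rewrite -normr_gt0; apply: lt_le_trans (nbhs_singleton Hx).
Unshelve. all: by end_near. Qed.

Lemma ncl_quot k t f : ncl (smooth_add k 1) t f -> f t = 0 ->
  exists2 g, ncl k t g & forall x, f x = (x - t) * g x.
Proof.
move=> fk f0; have [g gk fg] := gcl_quot (ncl_gcl fk) f0; exists g => //.
have away := near_neq t.
apply: filterS2 away fk => x ax fx; have [->//|xt] := eqVneq x t.
have u0 : x - t != 0 by rewrite subr_eq0.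
have uk : gcl k x (fun y => y - t) by apply: gcl_D; [exact: gcl_id|exact: gcl_cst].
apply: gcl_ext (gcl_M (gcl_weak fx) (@gcl_V k x (fun y => y - t) u0 uk)).
by apply: filterS (ax xt) => y yt; rewrite fg mulrAC mulfV ?mul1r // subr_eq0.
Qed.

Lemma vanish_of_bound t f (C : R) j : {for t, continuous f} ->
  (\forall x \near t, x != t -> `|f x| <= C * `|x - t| ^+ j.+1) -> f t = 0.
Proof.
move=> fc Hb; apply/eqP; rewrite -normr_le0; apply/ler_addgt0Pl => e e0; rewrite addr0.
have bc : {for t, continuous (fun x => C * `|x - t| ^+ j.+1)}.
  apply: cvgM; first exact: cvg_cst.
  by apply: cvg_pow; apply: cvg_norm; apply: cvgB; [exact: cvg_id|exact: cvg_cst].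
have e2 : 0 < e / 2 by rewrite divr_gt0.
move/cvgrPdist_le : fc => /(_ _ e2) H1; move/cvgrPdist_le : bc => /(_ _ e2) H2.
have : \forall x \near t, x != t -> `|f t| <= e.
  apply: filterS3 H1 H2 Hb => x h1 h2 h3 /h3 {}h3.
  rewrite subrr normr0 expr0n mulr0 sub0r normrN in h2.
  have := ler_distD (f x) (f t) 0; rewrite !subr0.
  have := ler_norm (C * `|x - t| ^+ j.+1); lra.
move=> /nbhs_ballP[d /= d0 Hd]; apply: (Hd (t + d / 2)).
  by rewrite /ball /= opprD addrA subrr add0r normrN gtr0_norm; lra.
by rewrite -subr_eq0 addrAC subrr add0r gt_eqF // divr_gt0.
Qed.

Lemma smooth_addA k i j : smooth_add k (i + j) = smooth_add (smooth_add k i) j.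
Proof. by case: k => [n||] //=; rewrite addnA. Qed.

Lemma ncl_quotn k t f (C : R) j : ncl (smooth_add k j) t f ->
  (\forall x \near t, x != t -> `|f x| <= C * `|x - t| ^+ j) ->
  exists2 g, ncl k t g & forall x, f x = (x - t) ^+ j * g x.
Proof.
elim: j f => [|j IH] f fk Hb.
  by exists f => [|x]; [exact: ncl_weak fk|rewrite expr0 mul1r].
have f0 : f t = 0 by apply: vanish_of_bound Hb; exact: ncl_cont fk.
rewrite -addn1 smooth_addA in fk.
have [g1 g1k fg1] := ncl_quot fk f0.
have [|g gk g1g] := IH g1 g1k.
  apply: filterS Hb => x Hx xt; have := Hx xt.
  rewrite fg1 normrM exprS mulrCA ler_pM2l // normr_gt0 subr_eq0 //.
by exists g => // x; rewrite fg1 g1g exprS mulrA.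
Qed.

(** A nonnegative germ that vanishes at t has its minimum there, so that its
    derivative vanishes as well and it can be divided by (x - t)^2. *)
Lemma ncl_nonneg_bound k t f : ncl (smooth_add k 2) t f -> f t = 0 ->
  (\forall x \near t, 0 <= f x) ->
  exists C, \forall x \near t, f x <= C * `|x - t| ^+ 2.
Proof.
move=> fk f0 fpos; rewrite (smooth_addA k 1 1) in fk.
have [g1 g1k fg1] := ncl_quot fk f0.
have g10 : g1 t = 0.
  apply/eqP/negP => /negP g1t.
  have g1c := ncl_cont (ncl_weak g1k).
  have n0 : 0 < `|g1 t| by rewrite normr_gt0.
  move/cvgrPdist_lt : g1c => /(_ _ n0) H.
  have /nbhs_ballP[d /= d0 Hd] : \forall x \near t, 0 <= f x /\ `|g1 t - g1 x| < `|g1 t|.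
    by apply: filterS2 fpos H.
  pose s := if 0 < g1 t then t - d / 2 else t + d / 2.
  have sb : ball t d s.
    rewrite /s /ball /=; case: ifP => _; rewrite opprD ?opprK addrA subrr add0r ?normrN gtr0_norm; lra.
  have [] := Hd s sb; rewrite fg1 /s.
  case: ltP => [gp|gn]; rewrite addrAC subrr add0r.
    rewrite (gtr0_norm gp) ltr_norml => h1 /andP[h2 h3].
    by have := pmulr_rge0 (g1 (t - d/2)) (divr_gt0 d0 (ltr0n R 2)); nra.
  have {}gn : g1 t < 0 by rewrite lt_neqAle g1t.
  rewrite (ltr0_norm gn) ltr_norml => h1 /andP[h2 h3]; nra.
have [g2 g2k g1g2] := ncl_quot g1k g10.
have g2c := ncl_cont g2k.
exists (`|g2 t| + 1); move/cvgrPdist_le : g2c => /(_ 1 ltr01); apply: filterS => x Hx.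
rewrite fg1 g1g2 mulrA -expr2 mulrC real_normK ?num_real //.
apply: ler_wpM2r; first exact: sqr_ge0.
have := ler_norm (g2 x); have := ler_distD (g2 t) (g2 x) 0; rewrite !subr0 distrC; lra.
Qed.
End GermClasses.

(** * Classes of curves and of their coordinates *)

Section Coordinates.
Context (R : realType).

Lemma mx_cvgP (T : Type) (F : set_system T) {FF : Filter F} m n (f : T -> 'M[R]_(m, n)) (M : 'M[R]_(m, n)) :
  (forall i j, (fun x => f x i j) @ F --> M i j) -> f @ F --> M.
Proof.
move=> H A [P PM PA].
have : F (fun x => forall ij : 'I_m * 'I_n, P ij.1 ij.2 (f x ij.1 ij.2)).
  have K (ij : 'I_m * 'I_n) : F (fun x => P ij.1 ij.2 (f x ij.1 ij.2)).
    by apply: H; exact: PM.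
  exact: (@filter_forall T _ (fun (ij : 'I_m * 'I_n) x => P ij.1 ij.2 (f x ij.1 ij.2)) F FF K).
by apply: (@filterS T F FF) => x Hx; apply: PA => i j; exact: (Hx (i, j)).
Qed.

Lemma coord_le_norm m n (M : 'M[R]_(m, n)) i j : `|M i j| <= `|M|.
Proof.
rewrite [leRHS]/Num.norm /= mx_normrE; apply/bigmax_geP; right => /=.
by exists (i, j).
Qed.

Lemma mx_norm_le m n (M : 'M[R]_(m, n)) B : 0 <= B -> (forall i j, `|M i j| <= B) -> `|M| <= B.
Proof.
move=> B0 H; rewrite [leLHS]/Num.norm /= mx_normrE; apply/bigmax_leP; split=> //= ij _; exact: H.
Qed.

Lemma coord_cvg (T : Type) (F : set_system T) {FF : Filter F} m n (f : T -> 'M[R]_(m, n)) (M : 'M[R]_(m, n)) i j :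
  f @ F --> M -> (fun x => f x i j) @ F --> M i j.
Proof.
move=> fM; apply: (@cvg_comp _ _ _ f (fun M : 'M[R]_(m, n) => M i j) _ (nbhs M)) => //.
exact: coord_continuous.
Qed.

Lemma coord_derive n (f : R -> 'cV[R]_n) (t : R) i : derivable f t 1 ->
  is_derive t (1 : R) (fun x => f x i 0) (derive1 f t i 0).
Proof.
move=> fd; have := (derivable_mxP f t 1).1 fd i 0 => fid.
by split => //; rewrite derive1E derive_mx // mxE.
Qed.

Lemma Cn_on_coord N n (f : R -> 'cV[R]_n) i t : Cn_on N setT f -> gC N t (fun x => f x i 0).
Proof.
elim: N f t => [|N IH] f t [fd fc].
  apply: filterE => x; apply: coord_cvg; exact: (fc 0%N x).
exists (fun x => derive1 f x i 0); split.
  by apply: filterE => x; apply: coord_derive; exact: (fd 0%N x).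
apply: IH; split=> j x jN _; rewrite -derive1Sn; [exact: fd|exact: fc].
Qed.

Lemma coord_Cn_on N n (f : R -> 'cV[R]_n) (I : set R) :
  (forall t, I t -> forall i, gC N t (fun x => f x i 0)) -> Cn_on N I f.
Proof.
elim: N f => [|N IH] f Cf.
  split=> j t; first by rewrite ltn0.
  rewrite leqn0 => /eqP -> It.
  by apply: mx_cvgP => i j'; rewrite (ord1 j'); exact: gC_cont (Cf t It i).
have dn t : I t -> \forall x \near t, derivable f x 1.
  move=> It; have : \forall x \near t, forall i, derivable (fun x => f x i 0) (x : R) 1.
    apply: near_forall => i; have [f' [Hf _]] := Cf t It i.
    by apply: filterS Hf => x [].
  by apply: filterS => x Hx; apply/derivable_mxP => i j; rewrite (ord1 j).
have Cf' t : I t -> forall i, gC N t (fun x => derive1 f x i 0).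
  move=> It i; have [f' [Hf Cf']] := Cf t It i; apply: gC_ext Cf'.
  apply: filterS2 (dn t It) Hf => x fx fix'.
  by have [_ <-] := coord_derive i fx; apply/esym; apply: derive_val.
have [D C] := IH _ Cf'.
split=> -[|j] t jN It.
- exact: nbhs_singleton (dn t It).
- by rewrite derive1Sn; exact: D.
- apply: mx_cvgP => i j'; rewrite (ord1 j').
  exact: gC_cont (Cf t It i).
- by rewrite derive1Sn; exact: C.
Qed.

(** The partial sums approximate f: the terms of a series that converges at s0 are
    bounded, so that the series converges in norm for half that radius. *)
Lemma analytic_on_coord n (f : R -> 'cV[R]_n) i t : analytic_on setT f ->
  ganalytic t (fun x => f x i 0).
Proof.
move=> /(_ t Logic.I) [a /nbhs_ballP[e /= e0 He]].
pose s0 := e / 2.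
have s00 : 0 < s0 by rewrite divr_gt0.
have partial x M : series (fun j => (x - t) ^+ j *: a j) M i 0 =
    (\poly_(j < M) a j i 0).[x - t].
  rewrite /series /= horner_poly summxE big_mkord; apply: eq_bigr => j _.
  by rewrite mxE mulrC.
have conv x : `|x| < e -> (\poly_(j < M) a j i 0).[x] @[M --> \oo] --> f (t + x) i 0.
  move=> xe; have /He H : ball t e (t + x).
    by rewrite /ball /= opprD addrA subrr add0r normrN.
  have E M : series (fun j => (t + x - t) ^+ j *: a j) M i 0 = (\poly_(j < M) a j i 0).[x].
    by rewrite partial addrAC subrr add0r.
  under eq_fun do rewrite -E; exact: coord_cvg H.
have [B B0 HB] : exists2 B, 0 <= B & forall j, `|a j i 0| * s0 ^+ j <= B.
  have s0e : `|s0| < e by rewrite gtr0_norm // /s0; lra.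
  have c0 := conv _ s0e.
  have /cvg_seq_bounded : cvgn (fun M => (\poly_(j < M) a j i 0).[s0]) by apply/cvg_ex; exists (f (t + s0) i 0).
  move=> [B1 [_ /(_ (`|B1| + 1))]].
  have -> : B1 < `|B1| + 1 by have := ler_norm B1; lra.
  move=> /(_ isT) HB1; exists (2 * (`|B1| + 1)); first by have := normr_ge0 B1; lra.
  move=> j; have := HB1 j Logic.I; have := HB1 j.+1 Logic.I => /=.
  rewrite !horner_poly big_ord_recr /= => h1 h2.
  have -> : `|a j i 0| * s0 ^+ j = `|a j i 0 * s0 ^+ j|.
    by rewrite normrM normrX (gtr0_norm s00).
  move: h1 h2; set X := \sum_(_ < _) _; set Y := _ * _ => h1 h2.
  have := ler_normB (X + Y) X; rewrite addrAC subrr add0r; lra.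
pose r := s0 / 2.
have r0 : 0 < r by rewrite divr_gt0.
exists (fun M => \poly_(j < M) a j i 0), r, (B * 2); split=> //.
- move=> M; rewrite (@pnormE _ M) ?size_poly //.
  apply: (@le_trans _ _ (\sum_(j < M) B * 2^-1 ^+ j)).
    apply: ler_sum => j _; rewrite coef_poly ltn_ord /r expr_div_n mulrA.
    by rewrite -exprVn; apply: ler_wpM2r => //; rewrite exprn_ge0.
  rewrite -mulr_sumr; apply: ler_wpM2l => //.
  have h2 : (2^-1 : R) != 1 by apply/eqP; lra.
  have := subrX1 (2^-1 : R) M => E.
  have p0 : 0 <= (2^-1 : R) ^+ M by rewrite exprn_ge0.
  lra.
- move=> M; have -> : \poly_(j < M.+1) a j i 0 - \poly_(j < M) a j i 0 = 'X^M * (a M i 0)%:P.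
    apply/polyP => j; rewrite coefB !coef_poly coefXnM coefC ltnS.
    have [jM|Mj|->] := ltngtP j M.
    + by rewrite subrr.
    + by rewrite subr0 subn_eq0 leqNgt Mj.
    + by rewrite subnn subr0.
  exact: dvdp_mulr.
- move=> x xr; apply: conv; apply: lt_trans xr _; rewrite /r /s0; lra.
Qed.

(** The coefficient of degree j is read off from u j.+1, where it is final.  The
    partial sum of order M is u M without its part of degree M and more, and
    this part tends to 0, being O((|x - t| / r)^M). *)
Lemma coord_analytic_on n (f : R -> 'cV[R]_n) (I : set R) :
  (forall t, I t -> forall i, ganalytic t (fun x => f x i 0)) -> analytic_on I f.
Proof.
move=> Hf t It.
have /choice[uC HuC] : forall i, exists p : (nat -> {poly R}) * R, exists2 r, 0 < r &
    papprox p.1 r p.2 t (fun x => f x i 0).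
  by move=> i; have [u [r [C A]]] := Hf t It i; exists (u, C), r => //; have [] := A.
have [r r0 Hr] : exists2 r, 0 < r & forall i : 'I_n,
    papprox (uC i).1 r (uC i).2 t (fun x => f x i 0).
  apply: (@fin_pos R _ (fun i r => papprox (uC i).1 r (uC i).2 t (fun x => f x i 0))) => [i c c' A c0 c'c|//].
  exact: papprox_shrink A.
pose a j : 'cV[R]_n := \col_i ((uC i).1 j.+1)`_j.
exists a; apply/nbhs_ballP; exists r => //= x; rewrite /ball /= distrC => xr.
apply: mx_cvgP => i j; rewrite (ord1 j) {j}.
have [_ An As Ac] := Hr i.
set u := (uC i).1 in An As Ac *; set C := (uC i).2 in An.
have co M j : (j < M)%N -> (u M)`_j = (u j.+1)`_j.
  elim: M => // M IH; rewrite ltnS leq_eqVlt => /orP[/eqP -> //|jM].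
  rewrite -IH //; apply/eqP; rewrite -subr_eq0 -coefB.
  by have /dvdpP[q ->] := As M; rewrite mulrC coefXnM jM.
have partial M : series (fun j => (x - t) ^+ j *: a j) M i 0 = (take_poly M (u M)).[x - t].
  rewrite /series /= horner_poly summxE big_mkord; apply: eq_bigr => j _.
  by rewrite !mxE mulrC co.
under eq_fun do rewrite partial.
have Hc := Ac (x - t) xr; rewrite subrKC in Hc.
have tail M : `|(u M).[x - t] - (take_poly M (u M)).[x - t]| <= (`|x - t| / r) ^+ M * C.
  rewrite -hornerN -hornerD.
  have -> : u M - take_poly M (u M) = drop_poly M (u M) * 'X^M.
    by rewrite -{1}(poly_take_drop M (u M)) addrAC subrr add0r.
  apply: le_trans (horner_tail r0 (ltW xr) (dvdp_mull _ (dvdpp _))) _.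
  apply: ler_wpM2l; first by rewrite exprn_ge0 // divr_ge0 // ltW.
  apply: le_trans (An M).
  have sz : (size (drop_poly M (u M) * 'X^M)%R <= M + size (u M))%N.
    apply: leq_trans (size_polyMleq _ _) _; rewrite size_polyXn addnS /= addnC leq_add2l.
    by rewrite size_drop_poly leq_subr.
  rewrite (pnormE _ sz) (@pnormE _ (M + size (u M)) r (u M)) ?leq_addl //.
  apply: ler_sum => j _; apply: ler_wpM2r; first by rewrite exprn_ge0 // ltW.
  rewrite coefMXn; case: ltnP => jM; first by rewrite normr0.
  by rewrite coef_drop_poly subnK.
have T0 : (fun M => (u M).[x - t] - (take_poly M (u M)).[x - t]) @ \oo --> 0.
  have G : (fun M => (`|x - t| / r) ^+ M * C) @ \oo --> 0.
    rewrite -(mul0r C); apply: cvgMl; apply: cvg_expr.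
    by rewrite normrM normr_id normfV (gtr0_norm r0) ltr_pdivrMr // mul1r.
  apply/cvgrPdist_le => e e0; move/cvgrPdist_le : G => /(_ e e0); apply: filterS => M.
  rewrite !sub0r !normrN => H; apply: le_trans (tail M) _.
  by apply: le_trans (ler_norm _) H.
have E M : (take_poly M (u M)).[x - t] =
    (u M).[x - t] - ((u M).[x - t] - (take_poly M (u M)).[x - t]) by rewrite opprB subrKC.
have := cvgB Hc T0; rewrite subr0 => L.
by under eq_fun do rewrite E; exact: L.
Qed.

Lemma of_class_coord k n (f : R -> 'cV[R]_n) i t : of_class k setT f ->
  ncl k t (fun x => f x i 0).
Proof.
move=> H; apply: filterE => x; case: k H => [N||] /=.
- exact: Cn_on_coord.
- by move=> H N; exact: Cn_on_coord.
- exact: analytic_on_coord.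
Qed.

Lemma coord_of_class k n (f : R -> 'cV[R]_n) (I : set R) :
  (forall t, I t -> forall i, gcl k t (fun x => f x i 0)) -> of_class k I f.
Proof.
case: k => [N||] /= H.
- exact: coord_Cn_on.
- by move=> N; apply: coord_Cn_on => t It i; exact: H.
- exact: coord_analytic_on.
Qed.
End Coordinates.

(** * Polynomial functions *)

Section PolyFun.
Context (R : realType) (m : nat).
Notation V := 'cV[R]_m.
Implicit Types (f g p : V -> R) (v x y : V) (s : R).

(** Polynomial functions of degree at most e; induction on this predicate replaces
    computations with coefficients. *)
Inductive pdeg : nat -> (V -> R) -> Prop :=
| pdeg_cst a : pdeg 0 (fun _ => a)
| pdeg_X i : pdeg 1 (fun v => v i 0)
| pdeg_D e f g : pdeg e f -> pdeg e g -> pdeg e (fun v => f v + g v)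
| pdeg_M e e' f g : pdeg e f -> pdeg e' g -> pdeg (e + e') (fun v => f v * g v)
| pdeg_le e e' f : (e <= e')%N -> pdeg e f -> pdeg e' f.

Definition pfun f := exists e, pdeg e f.

(** The subalgebra of functions on T that is generated by the family tau. *)
Inductive polygen (T I : Type) (tau : I -> T -> R) : (T -> R) -> Prop :=
| pg_cst a : polygen tau (fun _ => a)
| pg_gen i : polygen tau (tau i)
| pg_D (f g : T -> R) : polygen tau f -> polygen tau g -> polygen tau (fun u => f u + g u)
| pg_M (f g : T -> R) : polygen tau f -> polygen tau g -> polygen tau (fun u => f u * g u).

Lemma pfun_cst a : pfun (fun _ => a).
Proof. by exists 0%N; exact: pdeg_cst. Qed.

Lemma pfun_X i : pfun (fun v => v i 0).
Proof. by exists 1%N; exact: pdeg_X. Qed.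

Lemma pfun_D f g : pfun f -> pfun g -> pfun (fun v => f v + g v).
Proof.
move=> [e fe] [e' ge]; exists (maxn e e').
by apply: pdeg_D; [apply: pdeg_le fe|apply: pdeg_le ge]; rewrite ?leq_maxl ?leq_maxr.
Qed.

Lemma pfun_M f g : pfun f -> pfun g -> pfun (fun v => f v * g v).
Proof. by move=> [e fe] [e' ge]; exists (e + e')%N; exact: pdeg_M. Qed.

Lemma pfun_ext f g : f =1 g -> pfun f -> pfun g.
Proof. by move=> /funext ->. Qed.

Lemma polygen_ext (T I : Type) (tau : I -> T -> R) (f g : T -> R) :
  f =1 g -> polygen tau f -> polygen tau g.
Proof. by move=> /funext ->. Qed.

Lemma pfun_sum (I : Type) (r : seq I) (P : pred I) (F : I -> V -> R) :
  (forall i, pfun (F i)) -> pfun (fun v => \sum_(i <- r | P i) F i v).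
Proof.
move=> HF; elim: r => [|i r IH].
  by apply: pfun_ext (pfun_cst 0) => v; rewrite big_nil.
apply: (@pfun_ext (fun v => (if P i then F i v else 0) + \sum_(j <- r | P j) F j v)).
  by move=> v; rewrite big_cons; case: ifP => // _; rewrite add0r.
by apply: pfun_D => //; case: (P i) => //; exact: pfun_cst.
Qed.

Lemma pfun_prod (I : Type) (r : seq I) (P : pred I) (F : I -> V -> R) :
  (forall i, pfun (F i)) -> pfun (fun v => \prod_(i <- r | P i) F i v).
Proof.
move=> HF; elim: r => [|i r IH].
  by apply: pfun_ext (pfun_cst 1) => v; rewrite big_nil.
apply: (@pfun_ext (fun v => (if P i then F i v else 1) * \prod_(j <- r | P j) F j v)).
  by move=> v; rewrite big_cons; case: ifP => // _; rewrite mul1r.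
by apply: pfun_M => //; case: (P i) => //; exact: pfun_cst.
Qed.

Lemma pfun_exp f n : pfun f -> pfun (fun v => f v ^+ n).
Proof.
move=> Hf; elim: n => [|n IH]; first by apply: pfun_ext (pfun_cst 1) => v; rewrite expr0.
by apply: pfun_ext (pfun_M Hf IH) => v; rewrite exprS.
Qed.

Lemma polygen_sum (T I J : Type) (tau : I -> T -> R) (r : seq J) (F : J -> T -> R) :
  (forall i, polygen tau (F i)) -> polygen tau (fun u => \sum_(i <- r) F i u).
Proof.
move=> HF; elim: r => [|i r IH].
  by apply: polygen_ext (pg_cst tau 0) => u; rewrite big_nil.
by apply: polygen_ext (pg_D (HF i) IH) => u; rewrite big_cons.
Qed.

Lemma pfun_affine f (A : 'M[R]_m) (b : V) : pfun f -> pfun (fun v => f (A *m v + b)).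
Proof.
case=> e; elim=> {e f} [a|i|e f g _ Hf _ Hg|e e' f g _ Hf _ Hg|e e' f _ _ //].
- exact: pfun_cst.
- apply: (@pfun_ext (fun v => (\sum_j A i j * v j 0) + b i 0)).
    by move=> v; rewrite !mxE.
  apply: pfun_D; last exact: pfun_cst.
  by apply: pfun_sum => j; apply: pfun_M; [exact: pfun_cst|exact: pfun_X].
- exact: pfun_D.
- exact: pfun_M.
Qed.

Lemma pfun_shift f b : pfun f -> pfun (fun v => f (v + b)).
Proof. by move=> /(@pfun_affine _ 1%:M b); apply: pfun_ext => v; rewrite mul1mx. Qed.

Lemma pfun_mul f (A : 'M[R]_m) : pfun f -> pfun (fun v => f (A *m v)).
Proof. by move=> /(@pfun_affine _ A 0); apply: pfun_ext => v; rewrite addr0. Qed.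

Lemma horner_inj (p q : {poly R}) : (forall s, p.[s] = q.[s]) -> p = q.
Proof.
move=> pq; apply/eqP; rewrite -subr_eq0; apply/eqP.
pose rs : seq R := [seq i%:R | i <- iota 0 (size (p - q))].
apply: (@roots_geq_poly_eq0 R (p - q) rs).
- by apply/allP => s _; rewrite rootE hornerD hornerN pq subrr.
- by rewrite map_inj_uniq ?iota_uniq // => i j /eqP; rewrite eqr_nat => /eqP.
- by rewrite size_map size_iota.
Qed.

(** The expansion of f at v along lines, whose coefficient of degree j is a function
    of the direction that satisfies S j.  It is used with polynomials of degree j
    (Taylor's formula) and with polynomials in the Taylor components of given
    generators. *)
Definition expands (S : nat -> (V -> R) -> Prop) n v f (a : nat -> V -> R) :=
  (forall j, S j (a j)) /\ forall s x, f (v + s *: x) = \sum_(j < n) a j x * s ^+ j.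

Lemma expandsE (S : nat -> (V -> R) -> Prop) n v f a : expands S n v f a ->
  forall s x, f (v + s *: x) = (\poly_(j < n) a j x).[s].
Proof. by move=> [_ H] s x; rewrite H horner_poly. Qed.

Lemma expands_poly (S : nat -> (V -> R) -> Prop) n v f a x (b : {poly R}) : expands S n v f a ->
  (forall s, f (v + s *: x) = b.[s]) -> forall j, (j < n)%N -> a j x = b`_j.
Proof.
move=> E fb j jn; have -> : b = \poly_(j < n) a j x.
  by apply: horner_inj => s; rewrite -fb (expandsE E).
by rewrite coef_poly jn.
Qed.

Lemma expands_cst (S : nat -> (V -> R) -> Prop) v c : S 0%N (fun _ => c) -> (forall j, S j (fun _ => 0)) ->
  expands S 1 v (fun _ => c) (fun j _ => if j is 0%N then c else 0).
Proof. by move=> Sc S0; split=> [[|j]//|s x]; rewrite big_ord1 expr0 mulr1. Qed.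

Lemma expands_wide (S : nat -> (V -> R) -> Prop) n n' v f a : (forall j, S j (fun _ => 0)) -> (n <= n')%N -> expands S n v f a ->
  expands S n' v f (fun j x => if (j < n)%N then a j x else 0).
Proof.
move=> S0 nn' [Sa E]; split=> [j|s x]; first by case: (j < n)%N.
rewrite E (big_ord_widen n' (fun j => a j x * s ^+ j)) // big_mkcond /=.
by apply: eq_bigr => j _; case: ifP => // _; rewrite mul0r.
Qed.

Lemma expands_D (S : nat -> (V -> R) -> Prop) n v f g a b :
  (forall j f g, S j f -> S j g -> S j (fun x => f x + g x)) ->
  expands S n v f a -> expands S n v g b ->
  expands S n v (fun x => f x + g x) (fun j x => a j x + b j x).
Proof.
move=> SD [Sa Ea] [Sb Eb]; split=> [j|s x]; first exact: SD.
by rewrite Ea Eb -big_split /=; apply: eq_bigr => j _; rewrite mulrDl.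
Qed.

Lemma expands_M (S : nat -> (V -> R) -> Prop) n n' v f g a b :
  (forall j, S j (fun _ => 0)) ->
  (forall j f g, S j f -> S j g -> S j (fun x => f x + g x)) ->
  (forall i j f g, S i f -> S j g -> S (i + j)%N (fun x => f x * g x)) ->
  expands S n.+1 v f a -> expands S n'.+1 v g b ->
  exists c, expands S (n + n').+1 v (fun x => f x * g x) c.
Proof.
move=> S0 SD SM Ea Eb.
exists (fun k x => (\poly_(j < n.+1) a j x * \poly_(j < n'.+1) b j x)`_k); split.
  move=> k; rewrite (_ : (fun x => _) = fun x => \sum_(i < k.+1)
     (if (i < n.+1)%N then a i x else 0) * (if (k - i < n'.+1)%N then b (k - i)%N x else 0)); last first.
    by apply/funext => x; rewrite coefM; apply: eq_bigr => i _; rewrite !coef_poly.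
  elim: (index_enum _) => [|i r IH].
    by rewrite (_ : (fun x => _) = fun=> 0) //; apply/funext => x; rewrite big_nil.
  rewrite (_ : (fun x => _) = fun x => (if (i < n.+1)%N then a i x else 0) *
      (if (k - i < n'.+1)%N then b (k - i)%N x else 0) + \sum_(j <- r)
     (if (j < n.+1)%N then a j x else 0) * (if (k - j < n'.+1)%N then b (k - j)%N x else 0)); last first.
    by apply/funext => x; rewrite big_cons.
  have ik : (i <= k)%N by rewrite -ltnS.
  apply: SD => //; rewrite -{1}(subnKC ik).
  apply: SM; [case: (i < n.+1)%N => //; exact: Ea.1|].
  by case: (k - i < n'.+1)%N => //; exact: Eb.1.
move=> s x; rewrite (expandsE Ea) (expandsE Eb) -hornerM.
apply: horner_coef_wide; apply: leq_trans (size_polyMleq _ _) _.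
have sa := size_poly n.+1 (fun j => a j x); have sb := size_poly n'.+1 (fun j => b j x).
by move: sa sb; set A := size _; set B := size _ => sa sb; lia.
Qed.

Lemma pdeg0 e : pdeg e (fun _ => 0).
Proof. by apply: pdeg_le (pdeg_cst 0). Qed.

Lemma taylor e f v : pdeg e f -> exists a, expands pdeg e.+1 v f a.
Proof.
elim=> {e f} [c|i|e f g _ [a Ha] _ [b Hb]|e e' f g _ [a Ha] _ [b Hb]|e e' f ee' _ [a Ha]].
- by eexists; apply: expands_cst; [exact: pdeg_cst|exact: pdeg0].
- exists (fun j x => if j is j'.+1 then (if j' is 0%N then x i 0 else 0) else v i 0); split.
    by move=> [|[|j]]; [exact: pdeg_cst|exact: pdeg_X|exact: pdeg0].
  move=> s x; rewrite !mxE !big_ord_recl big_ord0 /= expr0 expr1 mulr1 addr0.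
  by rewrite [x i 0 * s]mulrC.
- by eexists; apply: expands_D Ha Hb; exact: pdeg_D.
- by apply: expands_M Ha Hb; [exact: pdeg0|exact: pdeg_D|exact: pdeg_M].
- by eexists; apply: expands_wide Ha; [exact: pdeg0|rewrite ltnS].
Qed.

Lemma pfun_line f v x : pfun f -> exists b : {poly R}, forall s, f (v + s *: x) = b.[s].
Proof.
move=> [e /(taylor v)[a Ha]]; exists (\poly_(j < e.+1) a j x) => s; exact: expandsE Ha s x.
Qed.

Lemma pfun_bounded f : pfun f -> exists C, forall x, (forall i, `|x i 0| <= 1) -> `|f x| <= C.
Proof.
case=> e; elim=> {e f} [a|i|e f g _ [C HC] _ [D HD]|e e' f g _ [C HC] _ [D HD]|e e' f _ _ //].
- by exists `|a|.
- by exists 1.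
- exists (C + D) => x Hx; apply: le_trans (ler_normD _ _) _.
  by apply: lerD; [exact: HC|exact: HD].
- by exists (C * D) => x Hx; rewrite normrM; apply: ler_pM => //; [exact: HC|exact: HD].
Qed.

Lemma pfun_continuous f : pfun f -> forall x, {for x, continuous f}.
Proof.
case=> e; elim=> {e f} [a|i|e f g _ Hf _ Hg|e e' f g _ Hf _ Hg|e e' f _ _ //] x.
- exact: cst_continuous.
- exact: coord_continuous.
- by apply: (@cvgD R R^o _ (nbhs x)); [exact: Hf|exact: Hg].
- by apply: (@cvgM R _ (nbhs x)); [exact: Hf|exact: Hg].
Qed.

Lemma polygen_ncl (T I : Type) (tau : I -> T -> R) (f : T -> R) k (t : R) (y : R -> T) :
  polygen tau f -> (forall i, ncl k t (fun u => tau i (y u))) -> ncl k t (fun u => f (y u)).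
Proof.
move=> pf H; elim: pf => {f} [a|i//|f g _ Hf _ Hg|f g _ Hf _ Hg].
- exact: ncl_cst.
- exact: ncl_D.
- exact: ncl_M.
Qed.

Definition dot v x : R := \sum_i v i 0 * x i 0.
Definition normsq v := dot v v.

Lemma dotE v x : dot v x = (v^T *m x) 0 0.
Proof. by rewrite mxE; apply: eq_bigr => i _; rewrite mxE. Qed.

Lemma dotC v x : dot v x = dot x v.
Proof. by apply: eq_bigr => i _; rewrite mulrC. Qed.

Lemma dotDl v x y : dot (v + x) y = dot v y + dot x y.
Proof. by rewrite /dot -big_split; apply: eq_bigr => i _; rewrite mxE mulrDl. Qed.

Lemma dotZl s x y : dot (s *: x) y = s * dot x y.
Proof. by rewrite /dot mulr_sumr; apply: eq_bigr => i _; rewrite mxE mulrA. Qed.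

Lemma dotBl v x y : dot (v - x) y = dot v y - dot x y.
Proof. by rewrite dotDl -scaleN1r dotZl mulN1r. Qed.

Lemma dotBr v x y : dot y (v - x) = dot y v - dot y x.
Proof. by rewrite dotC dotBl !(dotC y). Qed.

Lemma normsq_ge0 v : 0 <= normsq v.
Proof. by apply: sumr_ge0 => i _; rewrite -expr2 sqr_ge0. Qed.

Lemma coord_normsq v i : v i 0 ^+ 2 <= normsq v.
Proof.
rewrite /normsq /dot (bigD1 i) //= -expr2 lerDl; apply: sumr_ge0 => j _.
by rewrite -expr2 sqr_ge0.
Qed.

Lemma normsq_eq0 v : normsq v = 0 -> v = 0.
Proof.
move=> v0; apply/matrixP => i j; rewrite (ord1 j) mxE; apply/eqP.
by rewrite -sqrf_eq0 eq_le sqr_ge0 -v0 coord_normsq.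
Qed.

Lemma normsq0 : normsq 0 = 0.
Proof. by rewrite /normsq /dot big1 // => i _; rewrite mxE mul0r. Qed.

Lemma normsq_gt0 v : v != 0 -> 0 < normsq v.
Proof.
move=> v0; rewrite lt_neqAle normsq_ge0 andbT eq_sym.
by apply: contra_neq v0; exact: normsq_eq0.
Qed.

Lemma normsqZ s v : normsq (s *: v) = s ^+ 2 * normsq v.
Proof. by rewrite /normsq dotZl dotC dotZl mulrA expr2. Qed.

Lemma normsqN v : normsq (- v) = normsq v.
Proof. by rewrite -scaleN1r normsqZ sqrrN expr1n mul1r. Qed.

Lemma normsqD_le v x : normsq (v + x) <= 2 * (normsq v + normsq x).
Proof.
rewrite /normsq /dot -big_split mulr_sumr; apply: ler_sum => i _ /=.
rewrite !mxE; have := sqr_ge0 (v i 0 - x i 0); nra.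
Qed.

Lemma pfun_dot v : pfun (dot^~ v).
Proof. by apply: pfun_sum => i; apply: pfun_M; [exact: pfun_X|exact: pfun_cst]. Qed.

Lemma pfun_normsq : pfun normsq.
Proof. by apply: pfun_sum => i; apply: pfun_M; exact: pfun_X. Qed.

Lemma norm_le_normsq v (B : R) : 0 <= B -> normsq v <= B ^+ 2 -> `|v| <= B.
Proof.
move=> B0 H; apply: mx_norm_le => // i j; rewrite (ord1 j).
rewrite -(@ler_pXn2r _ 2) ?nnegrE // real_normK ?num_real //.
exact: le_trans (coord_normsq v i) H.
Qed.

(** By homogeneity it is enough to bound p on the unit cube. *)
Lemma hom_bound p j : pfun p -> (forall s x, p (s *: x) = s ^+ j * p x) ->
  exists C, forall x (B : R), 0 < B -> normsq x <= B ^+ 2 -> `|p x| <= C * B ^+ j.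
Proof.
move=> pp hom; have [C HC] := pfun_bounded pp; exists C => x B B0 xB.
rewrite -[x](scalerKV (lt0r_neq0 B0)) hom normrM normrX (gtr0_norm B0) mulrC.
apply: ler_wpM2r; first by rewrite exprn_ge0 // ltW.
apply: HC => i; apply: le_trans (coord_le_norm _ i 0) _.
apply: norm_le_normsq => //; rewrite normsqZ expr1n exprVn.
by rewrite mulrC ler_pdivrMr ?exprn_gt0 // mul1r.
Qed.
End PolyFun.

(** * Invariants of a finite group along a curve of orbits *)

Section LocalModel.
Context (R : realType) (gT : finGroupType) (G : {group gT}) (m : nat).
Context (rG : mx_representation R G m).
Hypothesis orth : orthogonal_repr rG.
Notation V := 'cV[R]_m.
Implicit Types (v w : V) (H K : {group gT}).

Definition rho g v : V := rG g *m v.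

Lemma rho1 v : rho 1%g v = v.
Proof. by rewrite /rho repr_mx1 mul1mx. Qed.

Lemma rhoM g h v : g \in G -> h \in G -> rho (g * h)%g v = rho g (rho h v).
Proof. by move=> gG hG; rewrite /rho repr_mxM // mulmxA. Qed.

Lemma rhoVK g v : g \in G -> rho g^-1%g (rho g v) = v.
Proof. by move=> gG; rewrite -rhoM ?groupV // mulVg rho1. Qed.

Lemma rhoD g v w : rho g (v + w) = rho g v + rho g w.
Proof. exact: mulmxDr. Qed.

Lemma rhoB g v w : rho g (v - w) = rho g v - rho g w.
Proof. exact: mulmxBr. Qed.

Lemma rhoZ g s v : rho g (s *: v) = s *: rho g v.
Proof. by rewrite /rho scalemxAr. Qed.

Lemma dot_rho g v w : g \in G -> dot (rho g v) (rho g w) = dot v w.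
Proof.
move=> gG; rewrite !dotE /rho trmx_mul mulmxA -[(_ *m _) *m rG g]mulmxA.
by rewrite orth // mulmx1.
Qed.

Lemma normsq_rho g v : g \in G -> normsq (rho g v) = normsq v.
Proof. exact: dot_rho. Qed.

Lemma pfun_rho g (f : V -> R) : pfun f -> pfun (fun v => f (rho g v)).
Proof. exact: pfun_mul. Qed.

Lemma stab_group H v : H \subset G ->
  exists K : {group gT}, forall h, (h \in K) = (h \in H) && (rho h v == v).
Proof.
move=> HG; have sub h : h \in H -> h \in G by apply/fintype.subsetP.
pose S : {set gT} := [set h in H | rho h v == v]%SET.
have gS : group_set S.
  apply/group_setP; split=> [|g h]; first by rewrite inE group1 rho1 eqxx.
  rewrite !inE => /andP[gH /eqP gv] /andP[hH /eqP hv].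
  by rewrite groupM //= rhoM ?sub // hv gv.
by exists (group gS) => h; rewrite inE.
Qed.

(** The germ version of property B_k for the invariants tau: curve germs of class k in
    the image of tau lift to differentiable germs with bounded derivative. *)
Definition lifting (k : smoothness) (I : finType) (tau : I -> V -> R) : Prop :=
  forall (t : R) (e : I -> R -> R), (forall i, ncl k t (e i)) ->
  (\forall x \near t, exists y, forall i, tau i y = e i x) ->
  exists b : R -> V, [/\ \forall x \near t, forall i, tau i (b x) = e i x,
    \forall x \near t, derivable b x 1
    & exists M, \forall x \near t, `|derive1 b x| <= M].

(** The data that pass from a group to the stabilizers of points: homogeneous
    generators tau i of positive degree dg i, at most d, of the H-invariant
    polynomial functions, for which germs of class k lift. *)
Record model H (I : finType) (tau : I -> V -> R) (dg : I -> nat) (d : nat)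
    (k : smoothness) : Prop := Model {
  m_sub : H \subset G;
  m_inv : forall i h x, h \in H -> tau i (rho h x) = tau i x;
  m_hom : forall i s x, tau i (s *: x) = s ^+ dg i * tau i x;
  m_pos : forall i, (0 < dg i)%N;
  m_deg : forall i, (dg i <= d)%N;
  m_pdeg : forall i, pdeg (dg i) (tau i);
  m_gen : forall f, pfun f -> (forall h x, h \in H -> f (rho h x) = f x) -> polygen tau f;
  m_lift : lifting k tau }.

Lemma polygen_eq (I : Type) (tau : I -> V -> R) f y y' : polygen tau f ->
  (forall i, tau i y = tau i y') -> f y = f y'.
Proof. by move=> pf E; elim: pf => [||f1 f2 _ -> _ ->|f1 f2 _ -> _ ->]. Qed.

(** An invariant polynomial in y that is small exactly if the orbit of y comes close
    to v. *)
Definition orbdist H v y := \prod_(h in H) normsq (rho h y - v).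

Lemma orbdist_pfun H v : pfun (orbdist H v).
Proof.
apply: pfun_prod => h; apply: (@pfun_ext _ _ (fun y => normsq (rG h *m y + - v))) => //.
by apply: pfun_affine; exact: pfun_normsq.
Qed.

Lemma orbdist_inv H v g y : H \subset G -> g \in H -> orbdist H v (rho g y) = orbdist H v y.
Proof.
move=> /fintype.subsetP HG gH; rewrite /orbdist [RHS](reindex_inj (mulIg g)) /=.
apply: eq_big => [h|h hH]; first by rewrite groupMr.
by rewrite rhoM // HG.
Qed.

Lemma orbdist_close H v y (e : R) : 0 <= e -> orbdist H v y < e ^+ #|H| ->
  exists2 h, h \in H & normsq (rho h y - v) < e.
Proof.
move=> e0 yH; apply: contrapT => nh; move: yH; rewrite ltNge => /negP; apply.
rewrite -prodr_const; apply: ler_prod => h hH; rewrite e0 /= leNgt; apply/negP => hy.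
by apply: nh; exists h.
Qed.

Section Fixed.
Variables (H : {group gT}) (I : finType) (tau : I -> V -> R) (dg : I -> nat) (d : nat).
Variable k : smoothness.
Hypothesis M : model H tau dg d k.

Let HG h : h \in H -> h \in G. Proof. exact: fintype.subsetP (m_sub M) h. Qed.

Lemma orbdist_gen v : polygen tau (orbdist H v).
Proof.
apply: (m_gen M) => [|h x hH]; first exact: orbdist_pfun.
exact: orbdist_inv (m_sub M) hH.
Qed.

Lemma orbdist_self v : orbdist H v v = 0.
Proof. by rewrite /orbdist (bigD1 1%g) //= rho1 subrr normsq0 mul0r. Qed.

(** The invariant orbdist H y' vanishes at y', hence at y. *)
Lemma separates y y' : (forall i, tau i y = tau i y') -> exists2 h, h \in H & y' = rho h y.
Proof.
move=> E; have := polygen_eq (orbdist_gen y') E; rewrite orbdist_self => /eqP.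
rewrite prodf_seq_eq0 => /hasP[h _ /andP[hH /eqP/normsq_eq0/eqP]].
by rewrite subr_eq0 => /eqP <-; exists h.
Qed.

(** At each parameter choose the lift that is closest to v.  The invariant orbdist H v
    is continuous along the curve and vanishes at t, so that these lifts tend to v. *)
Lemma lift_near (k' : smoothness) (t : R) (e : I -> R -> R) v :
  (forall i, ncl k' t (e i)) ->
  (\forall x \near t, exists y, forall i, tau i y = e i x) ->
  (forall i, tau i v = e i t) ->
  exists y : R -> V, [/\ \forall x \near t, forall i, tau i (y x) = e i x,
    y t = v & forall eps, 0 < eps -> \forall x \near t, normsq (y x - v) < eps].
Proof.
move=> ek ex ev.
have /choice[y0 Hy0] : forall x : R, exists y : V, (exists y', forall i, tau i y' = e i x) ->
    forall i, tau i y = e i x.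
  move=> x; have [[y Hy]|ny] := pselect (exists y', forall i, tau i y' = e i x).
    by exists y.
  by exists 0.
have y0E : \forall x \near t, forall i, tau i (y0 x) = e i x.
  by apply: filterS ex => x; exact: Hy0.
have /choice[h Hh] : forall x : R, exists h, h \in H /\
    forall g, g \in H -> normsq (rho h (y0 x) - v) <= normsq (rho g (y0 x) - v).
  move=> x; case: (@Order.TotalTheory.arg_minP _ R _ 1%g (mem H) (fun h => normsq (rho h (y0 x) - v)) (group1 H)) => h hH Hh.
  by exists h.
pose y x := rho (h x) (y0 x).
have yE : \forall x \near t, forall i, tau i (y x) = e i x.
  by apply: filterS y0E => x Hx i; rewrite (m_inv M) ?Hx //; have [] := Hh x.
have close eps : 0 < eps -> \forall x \near t, normsq (y x - v) < eps.
  move=> eps0.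
  have Dk : ncl k' t (fun x => orbdist H v (y0 x)).
    apply: polygen_ncl (orbdist_gen v) _ => i.
    by apply: ncl_ext (ek i); apply: filterS y0E => x ->.
  have D0 : orbdist H v (y0 t) = 0.
    rewrite -(orbdist_self v); apply: polygen_eq (orbdist_gen v) _ => i.
    by rewrite ev; exact: (nbhs_singleton y0E).
  have E0 : 0 < eps ^+ #|H| by rewrite exprn_gt0.
  move/cvgrPdist_lt : (ncl_cont Dk) => /(_ _ E0); apply: filterS => x.
  rewrite D0 sub0r normrN => /(le_lt_trans (ler_norm _)) /(orbdist_close (ltW eps0))[g gH].
  by apply: le_lt_trans; have [_] := Hh x; apply.
exists y; split=> //; apply/eqP; rewrite -subr_eq0; apply/eqP/normsq_eq0/eqP.
rewrite eq_le normsq_ge0 andbT; apply/ler_addgt0Pl => eps eps0; rewrite addr0 ltW //.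
exact: nbhs_singleton (close eps eps0).
Qed.

Section Slice.
Variables (v : V) (K : {group gT}).
Hypothesis KE : forall h, (h \in K) = (h \in H) && (rho h v == v).

Let KH h : h \in K -> h \in H. Proof. by rewrite KE => /andP[]. Qed.
Let Kv h : h \in K -> rho h v = v. Proof. by rewrite KE => /andP[_ /eqP]. Qed.

(** All points of the orbit of v have the same length as v, so that the linear form
    <., v> is largest on it at v only. *)
Lemma dot_gap h : h \in H -> h \notin K -> 0 < dot v v - dot (rho h v) v.
Proof.
move=> hH hK; have hv : rho h v - v != 0 by rewrite subr_eq0; move: hK; rewrite KE hH.
have := normsq_gt0 hv; rewrite /normsq dotBl !dotBr dot_rho ?HG // (dotC v (rho h v)).
lra.
Qed.

(** In a small ball around v the H-orbits are K-orbits: an element outside K moves v,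
    and hence also the ball, away from itself. *)
Lemma slice_radius : exists2 de, 0 < de & forall y h, h \in H ->
  normsq (y - v) < de -> normsq (rho h y - v) < de -> h \in K.
Proof.
have [c c0 Hc] : exists2 c, 0 < c & forall h, h \in H -> h \notin K -> 4 * c <= normsq (rho h v - v).
  have [c c0 Hc] : exists2 c, 0 < c & forall h, h \in H -> h \notin K -> 4 * c <= normsq (rho h v - v).
    apply: (@fin_pos R gT (fun h c => h \in H -> h \notin K -> 4 * c <= normsq (rho h v - v))).
      by move=> h c c' Hc _ c'c hH hK; apply: le_trans (Hc hH hK); rewrite ler_pM2l.
    move=> h; have [hK|hK] := boolP (h \in K); first by exists 1.
    have [hH|hH] := boolP (h \in H); last by exists 1.
    have hv : rho h v - v != 0 by rewrite subr_eq0; move: hK; rewrite KE hH.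
    by exists (normsq (rho h v - v) / 4); rewrite ?divr_gt0 ?normsq_gt0 // => _ _; lra.
  by exists c.
exists c => // y h hH yv hyv; apply: contraT => hK.
have := Hc h hH hK.
have -> : rho h v - v = rho h (v - y) + (rho h y - v) by rewrite rhoB addrA subrK.
have := normsqD_le (rho h (v - y)) (rho h y - v).
rewrite normsq_rho ?HG // -[v - y]opprB normsqN; lra.
Qed.

Variables (k' : smoothness) (t : R) (e : I -> R -> R) (y : R -> V).
Hypothesis ek : forall i, ncl k' t (e i).
Hypothesis yE : \forall x \near t, forall i, tau i (y x) = e i x.
Hypothesis yt : y t = v.
Hypothesis yclose : forall eps, 0 < eps -> \forall x \near t, normsq (y x - v) < eps.

Lemma inv_regular f : pfun f -> (forall h x, h \in H -> f (rho h x) = f x) ->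
  ncl k' t (fun x => f (y x)).
Proof.
move=> pf fH; apply: polygen_ncl (m_gen M pf fH) _ => i.
by apply: ncl_ext (ek i); apply: filterS yE => x ->.
Qed.

Lemma y_cont : {for t, continuous y}.
Proof.
apply/cvgrPdist_le => eps eps0.
have e2 : 0 < eps ^+ 2 by rewrite exprn_gt0.
apply: filterS (yclose e2) => x Hx; rewrite yt distrC.
by apply: norm_le_normsq; exact: ltW.
Qed.

Lemma pfun_y_cont f : pfun f -> {for t, continuous (fun x => f (y x))}.
Proof.
move=> pf; apply: (@continuous_comp _ _ _ y f); first exact: y_cont.
by rewrite yt; exact: pfun_continuous.
Qed.

Lemma pfun_coef_prod (J : Type) (r : seq J) (P : pred J) (F : J -> V -> R) i :
  (forall j, pfun (F j)) -> pfun (fun x => (\prod_(j <- r | P j) ('X - (F j x)%:P))`_i).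
Proof.
move=> HF; elim: r i => [|j r IH] i.
  by apply: (@pfun_ext _ _ (fun _ => (1 : {poly R})`_i)) => [x|]; [rewrite big_nil|exact: pfun_cst].
case Pj: (P j); last first.
  by apply: pfun_ext (IH i) => x; rewrite big_cons Pj.
apply: (@pfun_ext _ _ (fun x => (if i is i'.+1 then (\prod_(j <- r | P j) ('X - (F j x)%:P))`_i' else 0)
   + ((-1) * F j x) * (\prod_(j <- r | P j) ('X - (F j x)%:P))`_i)).
  by move=> x; rewrite big_cons Pj mulrBl coefB coefXM coefCM mulN1r mulNr; case: i.
apply: pfun_D; first by case: i => [|i]; [exact: pfun_cst|exact: IH].
by apply: pfun_M => //; apply: pfun_M => //; exact: pfun_cst.
Qed.

(** Along the curve, th (y x) is a root of the polynomial whose roots are the values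
    of th on the H-orbit of y x.  Its coefficients are H-invariant, hence of class
    k', and the root th v at t is simple because th v differs from the values of th
    at the other points of the orbit of v. *)
Lemma separating_regular th : pfun th -> (forall h x, h \in K -> th (rho h x) = th x) ->
  (forall h, h \in H -> h \notin K -> th (rho h v) != th v) ->
  ncl k' t (fun x => th (y x)).
Proof.
move=> pth thK sep.
(* As th is K-invariant, its values on an H-orbit are indexed by the right cosets
   of K. *)
pose cs := rcosets K H.
pose F (C : {set gT}) w := th (rho (repr C) w).
pose P w := \prod_(C in cs) ('X - (F C w)%:P).
have csP C : C \in cs -> exists2 g, g \in H & C = (K :* g)%g by move=> /rcosetsP.
have sKH : K \subset H by apply/fintype.subsetP => h /KH.
have rep C g : C \in cs -> g \in C -> forall w, F C w = th (rho g w).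
  move=> /csP[g0 g0H ->] gC w.
  have : repr (K :* g0)%g \in (K :* g)%g.
    by rewrite -(rcoset_eqP gC) (mem_repr g) // rcoset_refl.
  move=> /rcosetP[h hK E]; rewrite /F E.
  have gH : g \in H by case/rcosetP: gC => h' h'K ->; rewrite groupM // KH.
  have hG := HG (KH hK); have gG := HG gH; by rewrite rhoM // thK.
have PH h w : h \in H -> P (rho h w) = P w.
  move=> hH; rewrite /P [RHS](reindex_onto (fun C => C :* h)%g (fun C => C :* h^-1)%g) /=; last first.
    by move=> C _; rewrite -rcosetM mulVg mulg1.
  apply: eq_big => [C|C CC].
    rewrite -rcosetM mulgV mulg1 eqxx andbT.
    apply/idP/idP => /csP[g gH E].
      by rewrite E -rcosetM; apply/rcosetsP; exists (g * h)%g; rewrite ?groupM.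
    have -> : C = (K :* (g * h^-1))%g by rewrite rcosetM -E -rcosetM mulgV mulg1.
    by apply/rcosetsP; exists (g * h^-1)%g; rewrite ?groupM ?groupV.
  have [g gH CE] := csP C CC.
  have Ch : (C :* h)%g \in cs by rewrite CE -rcosetM; apply/rcosetsP; exists (g * h)%g; rewrite ?groupM.
  have rC : repr C \in C by rewrite CE (mem_repr g) // rcoset_refl.
  have rCH : repr C \in H.
    by move: rC; rewrite {2}CE => /rcosetP[h' /KH h'H ->]; rewrite groupM.
  have rCh : (repr C * h)%g \in (C :* h)%g by apply/rcosetP; exists (repr C).
  by rewrite (rep _ _ Ch rCh) /F rhoM ?HG.
have sP w : size (P w) = #|cs|.+1.
  by rewrite /P -big_enum /= size_prod_XsubC cardE.
pose a (i : 'I_(#|cs|.+1)) x := (P (y x))`_i.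
have ak i : ncl k' t (a i).
  apply: (@inv_regular (fun w => (P w)`_i)).
    by apply: pfun_coef_prod => C; exact: pfun_rho.
  by move=> h w hH; rewrite PH.
have hornE x u : horn a x u = (P (y x)).[u].
  by rewrite /horn horner_coef sP.
have dhornE x u : dhorn a x u u = (P (y x))^`().[u].
  rewrite (@horner_coef_wide _ #|cs| (P (y x))^`()); last first.
    by rewrite -ltnS -(sP (y x)) lt_size_deriv // -size_poly_eq0 sP.
  rewrite /dhorn big_ord_recl big_ord0 mulr0 add0r; apply: eq_bigr => i _.
  rewrite /a coef_deriv lift0 /= -mulr_natr -mulrA; congr (_ * _).
  transitivity (\sum_(j < i.+1) u ^+ i); last by rewrite sumr_const card_ord mulr_natl.
  by apply: eq_bigr => j _; rewrite -exprD subnK // -ltnS.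
have Kcs : (K : {set gT}) \in cs by apply/rcosetsP; exists 1%g; rewrite ?group1 // rcoset1.
have FK w : F K w = th w.
  by rewrite (rep _ 1%g Kcs (group1 K)) rho1.
have PE w : P w = ('X - (th w)%:P) * \prod_(C in cs | C != K :> {set gT}) ('X - (F C w)%:P).
  by rewrite /P (bigD1 (K : {set gT})) //= FK.
apply: (@ncl_hensel _ k' t _ a) => //.
- by apply: filterE => x; rewrite hornE PE hornerM hornerXsubC subrr mul0r.
- exact: pfun_y_cont.
rewrite dhornE PE derivM derivXsubC mul1r hornerD hornerM hornerXsubC subrr mul0r addr0.
rewrite horner_prod; apply/prodf_neq0 => C /andP[CC CK]; rewrite hornerXsubC subr_eq0 eq_sym.
have [g gH CE] := csP C CC.
have gC : g \in C by rewrite CE rcoset_refl.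
rewrite (rep _ _ CC gC) yt; apply: sep => //.
by apply: contraNN CK => gK; rewrite CE rcoset_id.
Qed.

(** A K-invariant p need not separate v from the rest of its orbit, but both
    <., v> and p + la <., v> do so if la is large. *)
Lemma slice_regular p : pfun p -> (forall h x, h \in K -> p (rho h x) = p x) ->
  ncl k' t (fun x => p (y x)).
Proof.
move=> pp pK; pose th0 (x : V) := dot x v.
have th0K h x : h \in K -> th0 (rho h x) = th0 x.
  by move=> hK; rewrite /th0 -{1}(Kv hK) dot_rho // HG // KH.
have pth0 : pfun th0 by exact: pfun_dot.
have r0 : ncl k' t (fun x => th0 (y x)).
  apply: separating_regular => // h hH hK; rewrite lt_eqF //.
  by have := dot_gap hH hK; rewrite subr_gt0.
pose D h := `|p (rho h v) - p v|.
pose la := 1 + \sum_(h : gT) D h / `|dot v v - dot (rho h v) v|.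
have lah h : h \in H -> h \notin K -> D h < la * (dot v v - dot (rho h v) v).
  move=> hH hK; have g0 := dot_gap hH hK.
  rewrite -ltr_pdivrMr // /la (bigD1 h) //= (gtr0_norm g0).
  have : 0 <= \sum_(i | i != h) D i / `|dot v v - dot (rho i v) v|.
    by apply: sumr_ge0 => i _; apply: divr_ge0; exact: normr_ge0.
  lra.
pose th x := p x + la * th0 x.
have pth : pfun th by apply: pfun_D => //; apply: pfun_M => //; exact: pfun_cst.
have r1 : ncl k' t (fun x => th (y x)).
  apply: separating_regular => // [h x hK|h hH hK].
    by rewrite /th pK // th0K.
  rewrite lt_eqF // /th /th0.
  by have := lah h hH hK; have := ler_norm (p (rho h v) - p v); rewrite -/(D h); lra.
apply: ncl_ext (ncl_D r1 (ncl_M (ncl_cst k' t (- la)) r0)).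
by apply: filterE => x; rewrite /th mulNr addrK.
Qed.
End Slice.
End Fixed.
End LocalModel.

(** * The slice at a point and its invariants *)

Lemma mulmx_norm (R : realType) m n (A : 'M[R]_(n, m)) (u : 'cV[R]_m) :
  `|A *m u| <= (\sum_i \sum_j `|A i j|) * `|u|.
Proof.
apply: mx_norm_le => [|i j].
  by apply: mulr_ge0 => //; apply: sumr_ge0 => i _; apply: sumr_ge0.
rewrite (ord1 j) mxE; apply: le_trans (ler_norm_sum _ _ _) _.
rewrite (bigD1 i) //= mulrDl; apply: (@le_trans _ _ ((\sum_j `|A i j|) * `|u|)).
  rewrite mulr_suml; apply: ler_sum => k _; rewrite normrM; apply: ler_wpM2l => //.
  exact: coord_le_norm.
by rewrite lerDl mulr_ge0 // sumr_ge0 // => k _; apply: sumr_ge0.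
Qed.

Lemma is_derive_mulmx (R : realType) m n (A : 'M[R]_(n, m)) (f : R -> 'cV[R]_m) (t : R) l :
  is_derive t (1 : R) f l -> is_derive t (1 : R) (fun x => A *m f x) (A *m l).
Proof.
move=> /dvP H; apply/dvP => e e0.
pose C := 1 + \sum_i \sum_j `|A i j|.
have C0 : 0 < C by rewrite ltr_pwDl // sumr_ge0 // => i _; apply: sumr_ge0.
have [d d0 Hd] := H (e / C) (divr_gt0 e0 C0); exists d => // s /Hd {}Hd.
rewrite scalemxAr -!mulmxBr; apply: le_trans (mulmx_norm _ _) _.
apply: (@le_trans _ _ (C * `|f s - f t - (s - t) *: l|)).
  by apply: ler_wpM2r => //; rewrite lerDr.
apply: le_trans (ler_wpM2l (ltW C0) Hd) _.
by rewrite mulrA mulrCA divff ?mulr1 // gt_eqF.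
Qed.

Section SliceModel.
Context (R : realType) (gT : finGroupType) (G : {group gT}) (m : nat).
Context (rG : mx_representation R G m).
Hypothesis orth : orthogonal_repr rG.
Notation V := 'cV[R]_m.
Notation rho := (rho rG).
Variables (H K : {group gT}) (I : finType) (tau : I -> V -> R) (dg : I -> nat) (d : nat).
Variable k : smoothness.
Hypothesis M : model rG H tau dg d k.
Variable v : V.
Hypothesis KE : forall h, (h \in K) = (h \in H) && (rho h v == v).

Let HG h : h \in H -> h \in G. Proof. exact: fintype.subsetP (m_sub M) h. Qed.
Let KH h : h \in K -> h \in H. Proof. by rewrite KE => /andP[]. Qed.
Let Kv h : h \in K -> rho h v = v. Proof. by rewrite KE => /andP[_ /eqP]. Qed.

Lemma expands_inv (S : nat -> (V -> R) -> Prop) n (u : V) f a h :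
  expands S n u f a -> (forall x, f (rho h x) = f x) -> rho h u = u ->
  forall j x, (j < n)%N -> a j (rho h x) = a j x.
Proof.
move=> E fh hu j x jn.
rewrite (expands_poly E (b := \poly_(j < n) a j x)) ?coef_poly ?jn // => s.
by rewrite -(expandsE E) -rhoZ -{1}hu -rhoD fh.
Qed.

Lemma expands_hom (S : nat -> (V -> R) -> Prop) n (u : V) f a :
  expands S n u f a -> forall la j x, (j < n)%N -> a j (la *: x) = la ^+ j * a j x.
Proof.
move=> E la j x jn.
rewrite (expands_poly E (b := \poly_(j < n) (la ^+ j * a j x))) ?coef_poly ?jn // => s.
rewrite scalerA (expandsE E) !horner_poly; apply: eq_bigr => i _.
by rewrite exprMn; move: (s ^+ i) (la ^+ i) => S' L; ring.
Qed.

(** The Taylor components at v of the generators are K-invariant, since K fixes v.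
    They generate the K-invariants by slice_gen below. *)
Lemma slice_generators : exists tau' : I * 'I_d -> V -> R,
  [/\ forall i s x, tau i (v + s *: x) = tau i v + \sum_(j < d) s ^+ j.+1 * tau' (i, j) x,
      forall ij : I * 'I_d, pdeg ij.2.+1 (tau' ij),
      forall (ij : I * 'I_d) s x, tau' ij (s *: x) = s ^+ ij.2.+1 * tau' ij x
    & forall (ij : I * 'I_d) h x, h \in K -> tau' ij (rho h x) = tau' ij x].
Proof.
have /choice[a Ha] : forall i, exists a, expands (@pdeg R m) (dg i).+1 v (tau i) a.
  by move=> i; exact: taylor (m_pdeg M i).
exists (fun (ij : I * 'I_d) x => if (ij.2 < dg ij.1)%N then a ij.1 ij.2.+1 x else 0); split=> [i s x|[i j]|[i j] s x|[i j] h x hK] /=.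
- have a0 : a i 0%N x = tau i v.
    have := (Ha i).2 0 x; rewrite scale0r addr0 => ->.
    by rewrite big_ord_recl expr0 mulr1 big1 ?addr0 // => j _; rewrite expr0n mulr0.
  rewrite (Ha i).2 big_ord_recl expr0 mulr1 a0; congr (_ + _).
  rewrite (big_ord_widen d (fun j => a i j.+1 x * s ^+ j.+1)) ?(m_deg M) // big_mkcond /=.
  by apply: eq_bigr => j _; case: ifP => _; rewrite ?mulr0 // mulrC.
- by case: (j < dg i)%N; [exact: (Ha i).1|exact: pdeg0].
- case: ifP => ji; last by rewrite mulr0.
  exact: (expands_hom (Ha i)).
- case: ifP => ji //; apply: (expands_inv (Ha i)) => //; last exact: Kv.
  by move=> w; rewrite (m_inv M) // KH.
Qed.

Variable tau' : I * 'I_d -> V -> R.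
Hypothesis tauE : forall i s x, tau i (v + s *: x) = tau i v + \sum_(j < d) s ^+ j.+1 * tau' (i, j) x.

Lemma polygen_expands P : polygen tau P ->
  exists n Q, expands (fun _ => polygen tau') n.+1 v P Q.
Proof.
elim=> {P} [a|i|f g _ [n [a Ha]] _ [n' [b Hb]]|f g _ [n [a Ha]] _ [n' [b Hb]]].
- by exists 0%N; eexists; apply: expands_cst => *; exact: pg_cst.
- exists d, (fun j x => if j is j'.+1 then (if insub j' is Some j'' then tau' (i, j'') x else 0)
     else tau i v); split.
    move=> [|j]; first exact: pg_cst.
    by case: insubP => [u _ _|_]; [exact: pg_gen|exact: pg_cst].
  move=> s x; rewrite tauE big_ord_recl expr0 mulr1; congr (_ + _).
  by apply: eq_bigr => j _; rewrite lift0 valK mulrC.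
- exists (maxn n n'); eexists.
  apply: (expands_D _ (expands_wide _ _ Ha) (expands_wide _ _ Hb)) => *; rewrite ?ltnS ?leq_maxl ?leq_maxr //.
  + exact: pg_D.
  + exact: pg_cst.
  + exact: pg_cst.
- exists (n + n')%N; apply: expands_M Ha Hb => *; [exact: pg_cst|exact: pg_D|exact: pg_M].
Qed.

(** A K-invariant form p of degree e is, up to a nonzero factor, the Taylor component
    of degree e at v of an H-invariant polynomial P, and P is a polynomial in
    tau by m_gen.  To find P, take q = p (. - v) be, where be is nonzero at v and
    vanishes to order e+1 at the other points of the orbit of v, and sum q over H.
    In degree e at v, the elements of K contribute be v p each, and the others
    contribute nothing. *)
Lemma slice_gen_hom e p : pfun p -> (forall h x, h \in K -> p (rho h x) = p x) ->
  (forall s x, p (s *: x) = s ^+ e * p x) -> polygen tau' p.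
Proof.
move=> pp pK phom.
(* fac h vanishes at h v, but not at v unless h v = v. *)
pose fac h y := dot y v - dot (rho h v) v.
have pfac h : pfun (fac h) by apply: pfun_D; [exact: pfun_dot|exact: pfun_cst].
pose be y := \prod_(h in H | h \notin K) fac h y ^+ e.+1.
have pbe : pfun be by apply: pfun_prod => h; exact: pfun_exp.
have bev : be v != 0.
  apply/prodf_neq0 => h /andP[hH hK]; rewrite expf_neq0 // gt_eqF //.
  exact: (dot_gap orth M KE hH hK).
pose q y := p (y - v) * be y.
have pq : pfun q by apply: pfun_M => //; exact: pfun_shift.
pose P y := \sum_(h in H) q (rho h y).
have pP : pfun P by apply: pfun_sum => h; exact: pfun_rho.
have PH g y : g \in H -> P (rho g y) = P y.
  move=> gH; rewrite /P [RHS](reindex_inj (mulIg g)) /=.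
  apply: eq_big => [h|h hH]; first by rewrite groupMr.
  by rewrite rhoM // HG.
have [n0 [Q0 HQ0]] := polygen_expands (m_gen M pP (fun h x hH => PH h x hH)).
have [Q HQ] : exists Q, expands (fun _ => polygen tau') (maxn n0.+1 e.+1) v P Q.
  eexists; apply: (expands_wide _ _ HQ0); last exact: leq_maxl.
  by move=> _; exact: pg_cst.
have Qe x : Q e x = (#|K|%:R * be v) * p x.
  have /choice[b Hb] : forall h, exists b : {poly R}, h \in H ->
      (forall s, q (rho h (v + s *: x)) = b.[s]) /\ b`_e = if h \in K then be v * p x else 0.
    move=> h; have [hH|] := boolP (h \in H); last by exists 0.
    have [hK|hK] := boolP (h \in K).
      have [bb Hbb] := pfun_line v (rho h x) pbe.
      exists ((p x)%:P * 'X^e * bb) => _; split=> [s|].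
        rewrite rhoD Kv // rhoZ /q addrAC subrr add0r phom pK // Hbb.
        by rewrite !hornerM hornerC hornerXn [s ^+ e * _]mulrC.
      rewrite -mulrA coefCM coefXnM ltnn subnn -horner_coef0 -Hbb scale0r addr0.
      by rewrite mulrC.
    pose f y := p (y + - v) * \prod_(g | ((g \in H) && (g \notin K)) && (g != h)) fac g y ^+ e.+1.
    have pf : pfun f.
      apply: pfun_M; first exact: pfun_shift.
      by apply: pfun_prod => g; exact: pfun_exp.
    have [bb Hbb] := pfun_line (rho h v) (rho h x) pf.
    exists ('X^(e.+1) * (dot (rho h x) v ^+ e.+1)%:P * bb) => _; split=> [s|].
      rewrite rhoD rhoZ !hornerM hornerC hornerXn -Hbb /f /q /be.
      rewrite (bigD1 h) ?hH //= mulrCA; congr (_ * _).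
      by rewrite /fac dotDl addrAC subrr add0r dotZl exprMn.
    by rewrite -mulrA coefXnM ltnSn.
  rewrite (expands_poly HQ (b := \sum_(h in H) b h)); last first.
  - by rewrite leq_max ltnSn orbT.
  - move=> s; rewrite horner_sum /P; apply: eq_bigr => h hH.
    by have [-> _] := Hb h hH.
  rewrite coef_sum (eq_bigr (fun h => if h \in K then be v * p x else 0)); last first.
    by move=> h hH; have [_ ->] := Hb h hH.
  rewrite -big_mkcondr /= (eq_bigl (fun h => h \in K)); last first.
    by move=> h; apply/andb_idl => /KH.
  by rewrite sumr_const -[LHS]mulr_natl mulrA.
have c0 : #|K|%:R * be v != 0 by rewrite mulf_neq0 // pnatr_eq0 -lt0n cardG_gt0.
apply: (@polygen_ext _ _ _ _ (fun x => (#|K|%:R * be v)^-1 * Q e x)).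
  by move=> x; rewrite Qe mulKf.
by apply: pg_M; [exact: pg_cst|exact: HQ.1].
Qed.

(** The Taylor components at 0 of a K-invariant polynomial are K-invariant forms. *)
Lemma slice_gen p : pfun p -> (forall h x, h \in K -> p (rho h x) = p x) -> polygen tau' p.
Proof.
move=> [e pe] pK; have [a Ha] := taylor 0 pe.
apply: (@polygen_ext _ _ _ _ (fun x => \sum_(j < e.+1) a j x)).
  move=> x; have := Ha.2 1 x; rewrite scale1r add0r => ->.
  by apply: eq_bigr => j _; rewrite expr1n mulr1.
apply: polygen_sum => j; apply: (@slice_gen_hom j).
- by exists j; exact: Ha.1.
- move=> h x hK; apply: (expands_inv Ha) => //; first by move=> w; exact: pK.
  exact: mulmx0.
- by move=> s x; apply: (expands_hom Ha).
Qed.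
End SliceModel.

Section Blowup.
Context (R : realType) (gT : finGroupType) (G : {group gT}) (m : nat).
Context (rG : mx_representation R G m).
Hypothesis orth : orthogonal_repr rG.
Notation V := 'cV[R]_m.
Notation rho := (rho rG).

(** A germ of orbits of K through y is scaled by a small s and moved to v, where it
    becomes a germ of orbits of H of the same class, as tau (v + s y) is
    a polynomial in the tau' y.  A lift b2 of the latter that stays near v is in the
    same K-orbits as v + s y by slice_radius, so that (b2 - v) / s is a lift of the
    germ of K-orbits. *)
Lemma slice_lifting (H K : {group gT}) (I : finType) (tau : I -> V -> R) dg d k v
    (tau' : I * 'I_d -> V -> R) :
  model rG H tau dg d k ->
  (forall h, (h \in K) = (h \in H) && (rho h v == v)) ->
  (forall i s x, tau i (v + s *: x) = tau i v + \sum_(j < d) s ^+ j.+1 * tau' (i, j) x) ->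
  (forall (ij : I * 'I_d) s x, tau' ij (s *: x) = s ^+ ij.2.+1 * tau' ij x) ->
  (forall (ij : I * 'I_d) h x, h \in K -> tau' ij (rho h x) = tau' ij x) ->
  polygen tau' (@normsq R m) ->
  lifting k tau'.
Proof.
move=> M KE tauE tau'_hom tau'_inv nsq t e ek ex.
have HG h : h \in H -> h \in G by exact: fintype.subsetP (m_sub M) h.
have KH h : h \in K -> h \in H by rewrite KE => /andP[].
have Kv h : h \in K -> rho h v = v by rewrite KE => /andP[_ /eqP].
have [de de0 Hde] := slice_radius orth M KE.
have /choice[y Hy] : forall x : R, exists y : V, (exists y', forall i, tau' i y' = e i x) ->
    forall i, tau' i y = e i x.
  move=> x; have [[y Hy]|ny] := pselect (exists y', forall i, tau' i y' = e i x).
    by exists y.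
  by exists 0.
have yE : \forall x \near t, forall i, tau' i (y x) = e i x.
  by apply: filterS ex => x; exact: Hy.
have n0 := normsq_ge0 (y t).
have [s s0 sde] : exists2 s, 0 < s & normsq (s *: y t) < de.
  pose s := Num.min 1 (de / (normsq (y t) + 1)).
  have q0 : 0 < de / (normsq (y t) + 1) by apply: divr_gt0 => //; lra.
  have s0 : 0 < s by rewrite lt_min ltr01.
  have s1 : s <= 1 by rewrite ge_min lexx.
  have : s <= de / (normsq (y t) + 1) by rewrite ge_min lexx orbT.
  rewrite ler_pdivlMr; last by lra.
  by exists s => //; rewrite normsqZ expr2; nra.
have s_neq0 : s != 0 by rewrite gt_eqF.
pose f i x := tau i v + \sum_(j < d) s ^+ j.+1 * e (i, j) x.
have fk i : ncl k t (f i).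
  apply: ncl_D; first exact: ncl_cst.
  by apply: ncl_sum => j; apply: ncl_M; [exact: ncl_cst|exact: ek].
have fE : \forall x \near t, forall i, tau i (v + s *: y x) = f i x.
  apply: filterS yE => x Hx i; rewrite tauE /f; congr (_ + _).
  by apply: eq_bigr => j _; rewrite Hx.
have [|b [bf bd [B bB]]] := m_lift M fk.
  by apply: filterS fE => x Hx; exists (v + s *: y x).
have [h0 h0H h0E] : exists2 h, h \in H & v + s *: y t = rho h (b t).
  apply: (separates M) => i.
  by rewrite (nbhs_singleton bf) (nbhs_singleton fE).
pose b2 x := rho h0 (b x).
have b2d x : derivable b x 1 -> is_derive x (1 : R) b2 (rG h0 *m derive1 b x).
  by move=> bx; apply: is_derive_mulmx; rewrite derive1E; exact: derivableP.
have b2c : {for t, continuous b2}.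
  exact: dv_cont ((dvP _ _ _).2 (b2d _ (nbhs_singleton bd))).
have b2close : \forall x \near t, normsq (b2 x - v) < de.
  have c : {for t, continuous (fun x => normsq (b2 x + - v))}.
    apply: (@continuous_comp _ _ _ b2 (fun y => normsq (y + - v))) => //.
    apply: (@pfun_continuous _ _ (fun y => normsq (y + - v))).
    by apply: pfun_shift; exact: pfun_normsq.
  have d0 : 0 < de - normsq (b2 t + - v) by rewrite subr_gt0 /b2 -h0E addrAC subrr add0r.
  move/cvgrPdist_lt : c => /(_ _ d0); apply: filterS => x.
  rewrite distrC => /(le_lt_trans (ler_norm _)); lra.
have yclose : \forall x \near t, normsq (s *: y x) < de.
  have c : ncl k t (fun x => normsq (y x)).
    apply: polygen_ncl nsq _ => i.
    by apply: ncl_ext (ek i); apply: filterS yE => x ->.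
  have d0 : 0 < de / s ^+ 2 - normsq (y t).
    by rewrite subr_gt0 ltr_pdivlMr ?exprn_gt0 // mulrC -normsqZ.
  move/cvgrPdist_lt : (ncl_cont c) => /(_ _ d0); apply: filterS => x.
  rewrite distrC => /(le_lt_trans (ler_norm _)) H1.
  rewrite normsqZ mulrC -ltr_pdivlMr ?exprn_gt0 //; lra.
exists (fun x => s^-1 *: (b2 x - v)); split.
- near=> x.
  have [h hH hE] : exists2 h, h \in H & v + s *: y x = rho h (b x).
    by apply: (separates M) => i; rewrite (near bf x) // (near fE x).
  pose g := (h * h0^-1)%g.
  have gE : v + s *: y x = rho g (b2 x).
    by rewrite hE /b2 -rhoM ?mulgKV ?groupM ?groupV ?HG.
  have gK : g \in K.
    apply: (Hde (b2 x)); first by rewrite groupM ?groupV.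
      by near: x.
    by rewrite -gE addrAC subrr add0r; near: x.
  have -> : s^-1 *: (b2 x - v) = rho g^-1%g (y x).
    have gG : g \in G by apply/HG/KH.
    have -> : b2 x - v = rho g^-1%g (s *: y x).
      rewrite -[b2 x](rhoVK rG _ gG) -gE rhoD Kv ?groupV // addrAC subrr add0r //.
    by rewrite rhoZ scalerK.
  by move=> i; rewrite tau'_inv ?groupV // (near yE x).
- apply: filterS bd => x /b2d bx; apply: derivableZ.
  by apply: derivableB; [case: bx|exact: derivable_cst].
- exists (`|s^-1| * ((\sum_i \sum_j `|rG h0 i j|) * B)).
  apply: filterS2 bd bB => x bx Bx.
  have -> : derive1 (fun x => s^-1 *: (b2 x - v)) x = s^-1 *: (rG h0 *m derive1 b x).
    have D := is_deriveB (b2d x bx) (is_derive_cst v x (1 : R)); rewrite subr0 in D.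
    by rewrite derive1E; have [_ DV] := is_deriveZ s^-1 D; exact: DV.
  rewrite normrZ; apply: ler_wpM2l => //; apply: le_trans (mulmx_norm _ _) _.
  by apply: ler_wpM2l => //; apply: sumr_ge0 => i _; apply: sumr_ge0.
Unshelve. all: by end_near. Qed.

(** A model for H yields a model for the stabilizer of v with the same bound d on the
    degrees; it is this bound that makes the blow-up cost d orders of
    differentiability only. *)
Lemma slice_model (H K : {group gT}) (I : finType) (tau : I -> V -> R) dg d k v :
  model rG H tau dg d k ->
  (forall h, (h \in K) = (h \in H) && (rho h v == v)) ->
  exists tau' : I * 'I_d -> V -> R, model rG K tau' (fun ij => ij.2.+1) d k /\
    forall i s x, tau i (v + s *: x) = tau i v + \sum_(j < d) s ^+ j.+1 * tau' (i, j) x.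
Proof.
move=> M KE; have [tau' [tauE td th ti]] := slice_generators M KE.
exists tau'; split=> //.
have KG : K \subset G.
  by apply: fintype.subset_trans (m_sub M); apply/fintype.subsetP => h; rewrite KE => /andP[].
have gen := slice_gen orth M KE tauE.
have nsq : polygen tau' (@normsq R m).
  apply: gen => [|h x hK]; first exact: pfun_normsq.
  by apply: normsq_rho => //; exact: (fintype.subsetP KG).
by apply: (Model KG ti th _ _ td gen (slice_lifting M KE tauE th ti nsq)) => // ij; exact: ltn_ord.
Qed.

End Blowup.

(** * Blowing up a curve of orbits *)

(** Bounded subsets of a Euclidean space are relatively compact, so that the lifts
    near t have a cluster point, and the continuous tau take the limit values there. *)
Lemma orbit_closed (R : realType) (m : nat) (I : Type) (tau : I -> 'cV[R]_m -> R) (e : I -> R -> R) (t B : R) :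
  (forall i, pfun (tau i)) -> (forall i, {for t, continuous (e i)}) ->
  (\forall x \near t, x != t -> exists y, normsq y <= B ^+ 2 /\ forall i, tau i y = e i x) ->
  exists y, forall i, tau i y = e i t.
Proof.
move=> pt ec ex.
have /choice[y Hy] : forall x : R, exists y : 'cV[R]_m, (exists y', normsq y' <= B ^+ 2 /\ forall i, tau i y' = e i x) ->
    normsq y <= B ^+ 2 /\ forall i, tau i y = e i x.
  move=> x; have [[y Hy]|ny] := pselect (exists y', normsq y' <= B ^+ 2 /\ forall i, tau i y' = e i x).
    by exists y.
  by exists 0.
have yE : \forall x \near t^', normsq (y x) <= B ^+ 2 /\ forall i, tau i (y x) = e i x.
  by rewrite near_withinE; apply: filterS ex => x Hx xt; apply: Hy; exact: Hx.
pose A := closed_ball (0 : 'rV[R]_m) (`|B| + 1).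
have B1 : 0 < `|B| + 1 by have := normr_ge0 B; lra.
have cA : compact A.
  apply: bounded_closed_compact; last exact: closed_ball_closed.
  exists (`|B| + 1); split; first exact: num_real.
  move=> M HM r; rewrite /A closed_ballE // /closed_ball_ /= sub0r normrN => Hr.
  by apply: le_trans Hr _; exact: ltW.
pose F := (fun x => (y x)^T) @ t^'.
have FA : F A.
  rewrite /F /A closed_ballE //; apply: filterS yE => x [Hn _].
  rewrite /closed_ball_ /= sub0r normrN.
  apply: mx_norm_le => [|i j]; first exact: ltW.
  rewrite mxE (ord1 i); apply: le_trans (coord_le_norm _ _ _) _.
  apply: (@le_trans _ _ `|B|); last by lra.
  by apply: norm_le_normsq => //; rewrite real_normK ?num_real.
have [p [_ pF]] := cA F _ FA.
have trc (r : 'rV[R]_m) : {for r, continuous (fun r : 'rV[R]_m => r^T)}.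
  apply: (@mx_cvgP R _ (nbhs r) (nbhs_filter r) m 1 (fun r => r^T) r^T) => i j; rewrite mxE.
  by under eq_fun do rewrite mxE; exact: coord_continuous.
exists p^T => i; apply/eqP; rewrite -subr_eq0 -normr_le0.
apply/ler_addgt0Pl => eps eps0; rewrite addr0.
have e2 : 0 < eps / 2 by rewrite divr_gt0.
have Np : nbhs p (fun r : 'rV[R]_m => `|tau i p^T - tau i r^T| < eps / 2).
  have c : {for p, continuous (fun r : 'rV[R]_m => tau i r^T)}.
    apply: (@continuous_comp _ _ _ (fun r : 'rV[R]_m => r^T) (tau i)); first exact: trc.
    exact: pfun_continuous.
  by move/cvgrPdist_lt : c => /(_ _ e2).
have FP : F (fun r => `|e i t - tau i r^T| < eps / 2).
  have ct : \forall x \near t^', `|e i t - e i x| < eps / 2.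
    have := ec i; move/cvgrPdist_lt => /(_ _ e2) H.
    by rewrite near_withinE; apply: filterS H.
  by apply: filterS2 yE ct => x [_ Hx]; rewrite /= trmxK Hx.
have [r [/= h1 h2]] := pF _ _ FP Np.
have := ler_distD (tau i r^T) (tau i p^T) (e i t); rewrite (distrC (tau i r^T) (e i t)); lra.
Qed.

Section Step.
Context (R : realType) (gT : finGroupType) (G : {group gT}) (m : nat).
Context (rG : mx_representation R G m).
Hypothesis orth : orthogonal_repr rG.
Notation V := 'cV[R]_m.
Notation rho := (rho rG).

(** Let y be a lift that tends to v at t.  The invariants tau' of the stabilizer K
    of v are of class r + d along y - v.  So is |y - v|^2, which is nonnegative and
    vanishes at t, and is therefore O((x - t)^2).  Hence tau' (i, j), being
    homogeneous of degree j + 1, is O((x - t)^(j+1)) along y - v and can be divided by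
    (x - t)^(j+1) at the cost of at most d orders.  The quotients e' are the tau' of
    (y - v) / (x - t), so that each lift u of e' gives the lift v + (x - t) u of e. *)
Lemma blowup (H : {group gT}) (I : finType) (tau : I -> V -> R) dg d k r (t : R) (e : I -> R -> R) :
  model rG H tau dg d k -> (2 <= d)%N ->
  (forall i, ncl (smooth_add r d) t (e i)) ->
  (\forall x \near t, exists y, forall i, tau i y = e i x) ->
  exists (v : V) (K : {group gT}) (tau' : I * 'I_d -> V -> R) (e' : I * 'I_d -> R -> R),
    [/\ model rG K tau' (fun ij => ij.2.+1) d k, forall j, ncl r t (e' j),
        \forall x \near t, exists y, forall j, tau' j y = e' j x
      & forall u : R -> V, (\forall x \near t, forall j, tau' j (u x) = e' j x) ->
          \forall x \near t, forall i, tau i (v + (x - t) *: u x) = e i x].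
Proof.
move=> M d2 ek ex.
have [v Hv] := nbhs_singleton ex.
have [K KE] := stab_group rG v (m_sub M).
have [tau' [M' tauE]] := slice_model orth M KE.
have [y [yE yt yclose]] := lift_near M ek ex Hv.
have KG : {subset K <= G} := fintype.subsetP (m_sub M').
have Kv h : h \in K -> rho h v = v by rewrite KE => /andP[_ /eqP].
have reg p : pfun p -> (forall h x, h \in K -> p (rho h x) = p x) ->
    ncl (smooth_add r d) t (fun x => p (y x - v)).
  move=> pp pK; apply: (slice_regular orth M KE ek yE yt yclose (p := fun w => p (w + - v))).
    exact: pfun_shift.
  by move=> h x hK; rewrite -{1}(Kv h hK) -rhoB pK.
pose z ij x := tau' ij (y x - v).
have pz ij : pfun (tau' ij) by exists ij.2.+1; exact: m_pdeg M' ij.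
have zk ij : ncl (smooth_add r d) t (z ij).
  by apply: reg => // h x hK; exact: m_inv M' _ _ _ hK.
have [C HC] : exists C, \forall x \near t, normsq (y x - v) <= C * `|x - t| ^+ 2.
  apply: (@ncl_nonneg_bound _ (smooth_add r (d - 2))).
  - rewrite -smooth_addA subnK //; apply: reg => [|h x hK]; first exact: pfun_normsq.
    by apply: normsq_rho => //; exact: KG.
  - by rewrite yt subrr normsq0.
  - by apply: filterE => x; exact: normsq_ge0.
pose D := `|C| + 1.
have D0 : 0 < D by have := normr_ge0 C; rewrite /D; lra.
have CD : C <= D ^+ 2.
  by have := ler_norm C; have := normr_ge0 C; rewrite /D expr2; nra.
have {}HC : \forall x \near t, normsq (y x - v) <= (D * `|x - t|) ^+ 2.
  apply: filterS HC => x Hx; apply: le_trans Hx _.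
  by rewrite exprMn; apply: ler_wpM2r => //; rewrite exprn_ge0.
have /choice[g Hg] : forall ij, exists g : R -> R, ncl r t g /\ forall x, z ij x = (x - t) ^+ ij.2.+1 * g x.
  move=> ij; have [B HB] := hom_bound (pz ij) (m_hom M' ij).
  have [||g gk gz] := @ncl_quotn _ (smooth_add r (d - ij.2.+1)) t (z ij) (B * D ^+ ij.2.+1) ij.2.+1.
  - by rewrite -smooth_addA subnK.
  - apply: filterS HC => x Hx xt; rewrite -mulrA -exprMn; apply: HB => //.
    by rewrite mulr_gt0 // normr_gt0 subr_eq0.
  by exists g; split=> //; exact: ncl_weak gk.
have liftg x : x != t -> forall ij, tau' ij ((x - t)^-1 *: (y x - v)) = g ij x.
  move=> xt ij; have [_ gz] := Hg ij; have u0 : x - t != 0 by rewrite subr_eq0.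
  rewrite (m_hom M') -/(z ij x) gz mulrA exprVn mulVf ?mul1r //.
  by rewrite expf_neq0.
exists v, K, tau', g; split=> //.
- by move=> ij; have [] := Hg ij.
- have [w Hw] : exists w, forall ij, tau' ij w = g ij t.
    apply: (@orbit_closed _ _ _ _ _ _ D) => // [ij|].
      by have [gk _] := Hg ij; exact: ncl_cont gk.
    apply: filterS HC => x Hx xt; exists ((x - t)^-1 *: (y x - v)).
    split; last exact: liftg.
    rewrite normsqZ exprVn mulrC ler_pdivrMr ?exprn_even_gt0 ?subr_eq0 //=.
    by move: Hx; rewrite exprMn real_normK ?num_real.
  apply: filterE => x; have [->|xt] := eqVneq x t; first by exists w.
  by exists ((x - t)^-1 *: (y x - v)) => ij; exact: liftg.
- move=> u uE; apply: filterS2 uE yE => x ux yx i.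
  rewrite tauE -yx -[in RHS](subrKC v (y x)) -[in RHS](scale1r (y x - v)) tauE.
  congr (_ + _); apply: eq_bigr => j _; rewrite expr1n mul1r ux.
  by have [_ gz] := Hg (i, j); rewrite -gz.
Qed.

(** Two blow-ups and one lift u from the property B_k of the last stabilizer give
    b = v + (x - t) w + (x - t)^2 u.  The derivative of u is merely bounded, but it
    occurs in b' with the factor (x - t)^2, so that b' is differentiable at t. *)
Lemma second_order_lift (H : {group gT}) (I : finType) (tau : I -> V -> R) dg d k (t : R) (e : I -> R -> R) :
  model rG H tau dg d k -> (2 <= d)%N ->
  (forall i, ncl (smooth_add k (2 * d)) t (e i)) ->
  (\forall x \near t, exists y, forall i, tau i y = e i x) ->
  exists b : R -> V, [/\ \forall x \near t, forall i, tau i (b x) = e i x,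
    \forall x \near t, derivable b x 1 & derivable (derive1 b) t 1].
Proof.
move=> M d2 ek ex.
have ek1 i : ncl (smooth_add (smooth_add k d) d) t (e i).
  by rewrite -smooth_addA addnn -mul2n.
have [v [K1 [tau1 [e1 [M1 e1k e1x L1]]]]] := blowup M d2 ek1 ex.
have [w [K2 [tau2 [e2 [M2 e2k e2x L2]]]]] := blowup M1 d2 e1k e1x.
have [u [uE ud [B uB]]] := m_lift M2 e2k e2x.
pose b x := v + (x - t) *: (w + (x - t) *: u x).
pose b' x : V := w + (x - t) *: (2 *: u x + (x - t) *: derive1 u x).
have bd : \forall x \near t, derivable b x 1 /\ derive1 b x = b' x.
  apply: filterS ud => x ux.
  have D i : is_derive x (1 : R) (fun x => b x i 0) (b' x i 0).
    have Du := coord_derive i ux.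
    have DX : is_derive x (1 : R) (fun x => x - t) 1.
      have D0 : is_derive x (1 : R) (fun x => x - t) (1 - 0).
        exact: (is_deriveB (is_derive_id x (1 : R)) (is_derive_cst t x (1 : R))).
      by rewrite subr0 in D0.
    have Dm := is_deriveM DX (is_deriveD (is_derive_cst (w i 0) x (1 : R)) (is_deriveM DX Du)).
    have Da := is_deriveD (is_derive_cst (v i 0) x (1 : R)) Dm.
    apply: (@near_eq_is_derive _ _ _ _ _ _ _ _ _ (is_derive_eq Da _)).
      by apply: filterE => s; rewrite /b !mxE.
    by rewrite /b' !mxE !scaleRE /= !fctE; ring.
  have bx : derivable b x 1.
    by apply/derivable_mxP => i j; rewrite (ord1 j); have [] := D i.
  split=> //; apply/matrixP => i j; rewrite (ord1 j) derive1E derive_mx // mxE.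
  by have [_ ->] := D i.
exists b; split.
- by apply: L1; apply: L2.
- by apply: filterS bd => x [].
- apply: (@near_eq_derivable _ _ _ b').
    by apply: filterS bd => x [_ ->].
  apply/derivable_mxP => i j; rewrite (ord1 j).
  pose q x := 2 * u x i 0 + (x - t) * derive1 u x i 0.
  have qc : {for t, continuous q}.
    have uc := is_derive_cont (coord_derive i (nbhs_singleton ud)).
    apply/cvgrPdist_le => eps eps0.
    have e4 : 0 < eps / 4 by rewrite divr_gt0.
    have B0 : 0 < `|B| + 1 by have := normr_ge0 B; lra.
    have eB : 0 < eps / (2 * (`|B| + 1)) by rewrite divr_gt0 // mulr_gt0.
    move/cvgrPdist_le : uc => /(_ _ e4) H1.
    have H2 : \forall x \near t, `|x - t| <= eps / (2 * (`|B| + 1)).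
      by apply/nbhs_ballP; exists (eps / (2 * (`|B| + 1))) => //= x; rewrite /ball /= distrC => /ltW.
    apply: filterS3 H1 H2 uB => x h1 h2 h3.
    rewrite /q (subrr t) mul0r addr0 opprD addrA -mulrBr.
    apply: le_trans (ler_normB _ _) _; rewrite !normrM ger0_norm //.
    have h4 : `|derive1 u x i 0| <= `|B| + 1.
      apply: le_trans (coord_le_norm _ _ _) _; apply: le_trans h3 _.
      by have := ler_norm B; lra.
    have : `|x - t| * `|derive1 u x i 0| <= eps / 2.
      apply: le_trans (ler_pM _ _ h2 h4) _ => //.
      by rewrite invfM mulrA divfK ?gt_eqF.
    lra.
  have FE : (fun x => b' x i 0) = (fun x => w i 0 + (x - t) * q x).
    by apply/funext => x; rewrite /b' /q !mxE.
  rewrite {}FE; clearbody q.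
  suff D : is_derive t (1 : R) (fun x => w i 0 + (x - t) * q x) (q t) by case: D.
  apply/is_derive1_caratheodory; exists q; split=> // x.
  by rewrite (subrr t) mul0r addr0 addrC addKr mulrC.
Qed.
End Step.

(** * Jets of curves in the same orbits *)

Section OrbitJet.
Context (R : realType) (W : normedModType R).

Lemma dv_sub t (f g : R -> W) l k : dv t f l -> dv t g k -> dv t (fun s => f s - g s) (l - k).
Proof. by move=> /dvP Hf /dvP Hg; apply/dvP; exact: is_deriveB. Qed.

Lemma dv_nonzero t (f : R -> W) l : dv t f l -> f t != 0 \/ l != 0 ->
  \forall x \near t, x != t -> f x != 0.
Proof.
move=> H; have [f0 [/eqP//|l0]|f0 _] := eqVneq (f t) 0.
  have nl : 0 < `|l| by rewrite normr_gt0.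
  have [d d0 Hd] := H _ (divr_gt0 nl (ltr0n R 2)).
  apply/nbhs_ballP; exists d => //= x; rewrite /ball /= distrC => /Hd + xt.
  rewrite f0 subr0 => Hx; apply: contraTneq Hx => ->.
  have u0 : 0 < `|x - t| by rewrite normr_gt0 subr_eq0.
  rewrite sub0r normrN normrZ mulrC -ltNge ltr_pM2r // gtr_pMr //.
  by rewrite invf_lt1 // ltr1n.
have nf : 0 < `|f t| by rewrite normr_gt0.
have [d d0 Hd] := dv_close H nf.
apply/nbhs_ballP; exists d => //= x; rewrite /ball /= distrC => /Hd + _.
by apply: contraTneq => ->; rewrite sub0r normrN ltxx.
Qed.

(** Otherwise each of the finitely many curves w1 - act g w2 has a nonzero jet at t, so
    that it has no zeros near t other than t itself. *)
Lemma orbit_jet (gT : finGroupType) (G : {group gT}) (act : gT -> W -> W) (t : R)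
    (w1 w2 : R -> W) l1 l2 :
  (forall g, g \in G -> dv t (fun s => act g (w2 s)) (act g l2)) ->
  dv t w1 l1 ->
  (\forall x \near t, exists2 g, g \in G & w1 x = act g (w2 x)) ->
  exists2 g, g \in G & w1 t = act g (w2 t) /\ l1 = act g l2.
Proof.
move=> d2 d1 Hg; apply: contrapT => ng.
have : \forall x \near t, forall g, g \in G -> x != t -> w1 x - act g (w2 x) != 0.
  apply: (near_forall (P := fun g x => g \in G -> x != t -> w1 x - act g (w2 x) != 0)) => g.
  have [gG|gG] := boolP (g \in G); last by apply: filterE.
  have := dv_nonzero (dv_sub d1 (d2 g gG)).
  have nz : w1 t - act g (w2 t) != 0 \/ l1 - act g l2 != 0.
    have [e1|] := eqVneq (w1 t - act g (w2 t)) 0; last by left.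
    have [e2|] := eqVneq (l1 - act g l2) 0; last by right.
    by case: ng; exists g => //; split; apply/eqP; rewrite -subr_eq0 ?e1 ?e2.
  by move=> /(_ nz); apply: filterS => x Hx _; exact: Hx.
move=> Hn; have /nbhs_ballP[d /= d0 Hd] : \forall x \near t, (exists2 g, g \in G & w1 x = act g (w2 x)) /\
    forall g, g \in G -> x != t -> w1 x - act g (w2 x) != 0 by exact: filterI.
have [] := Hd (t + d / 2).
  by rewrite /ball /= opprD addrA subrr add0r normrN gtr0_norm; lra.
move=> [g gG gE] /(_ g gG); rewrite gE subrr eqxx => H.
by have := H _; rewrite -subr_eq0 addrAC subrr add0r gt_eqF ?divr_gt0 // => /(_ isT).
Qed.
End OrbitJet.

Lemma dv_pair (R : realType) (V W : normedModType R) t (f : R -> V) (g : R -> W) l k :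
  dv t f l -> dv t g k -> dv t (fun s => (f s, g s)) (l, k).
Proof.
move=> Hf Hg e e0; have [d1 d10 H1] := Hf e e0; have [d2 d20 H2] := Hg e e0.
exists (Num.min d1 d2); first by rewrite lt_min d10.
move=> s; rewrite lt_min => /andP[s1 s2].
by rewrite prod_normE /= ge_max H1 // H2.
Qed.

Lemma dv_fst (R : realType) (V W : normedModType R) t (f : R -> V * W) l :
  dv t f l -> dv t (fun s => (f s).1) l.1.
Proof.
move=> H e e0; have [d d0 Hd] := H e e0; exists d => // s /Hd.
by rewrite prod_normE /= ge_max => /andP[].
Qed.

Lemma dv_snd (R : realType) (V W : normedModType R) t (f : R -> V * W) l :
  dv t f l -> dv t (fun s => (f s).2) l.2.
Proof.
move=> H e e0; have [d d0 Hd] := H e e0; exists d => // s /Hd.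
by rewrite prod_normE /= ge_max => /andP[].
Qed.

(** * Systems of generators and property B *)

Section Mpoly.
Context (R : realType) (m : nat).
Notation V := 'cV[R]_m.
Implicit Types (p : mpoly m R).

Lemma poly_funE p (v : V) : poly_fun p v = \sum_(u <- msupp p) mcoeff u p * \prod_i v i 0 ^+ u i.
Proof. exact: mevalE. Qed.

Lemma pdeg_monomial (u : 'I_m -> nat) (r : seq 'I_m) :
  pdeg (\sum_(i <- r) u i)%N (fun v : V => \prod_(i <- r) v i 0 ^+ u i).
Proof.
elim: r => [|i r IH].
  rewrite big_nil (_ : (fun v : V => _) = fun=> 1); first exact: pdeg_cst.
  by apply/funext => v; rewrite big_nil.
rewrite big_cons (_ : (fun v : V => _) = fun v : V => v i 0 ^+ u i * \prod_(j <- r) v j 0 ^+ u j).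
  apply: pdeg_M => //; elim: (u i) => [|n IHn].
    by rewrite (_ : (fun v : V => _) = fun=> 1); [exact: pdeg_cst|apply/funext => v; rewrite expr0].
  rewrite (_ : (fun v : V => _) = fun v : V => v i 0 * v i 0 ^+ n); last by apply/funext => v; rewrite exprS.
  by rewrite -add1n; apply: pdeg_M => //; exact: pdeg_X.
by apply/funext => v; rewrite big_cons.
Qed.

Lemma pdeg_poly_fun p e : p \is ishomog1 e mdeg -> pdeg e (@poly_fun R m p).
Proof.
move=> /dhomogP hp.
suff H (r : seq (multinom m)) : {subset r <= msupp p} ->
    pdeg e (fun v : V => \sum_(u <- r) mcoeff u p * \prod_i v i 0 ^+ (u : multinom m) i).
  have -> : @poly_fun R m p = fun v : V => \sum_(u <- msupp p) mcoeff u p * \prod_i v i 0 ^+ (u : multinom m) i.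
    by apply/funext => v; exact: poly_funE.
  exact: (H (msupp p) (fun u up => up)).
elim: r => [|u r IH] sr.
  rewrite (_ : (fun v : V => _) = fun=> 0); first exact: pdeg0.
  by apply/funext => v; rewrite big_nil.
rewrite (_ : (fun v : V => _) = fun v : V => mcoeff u p * \prod_i v i 0 ^+ u i +
  \sum_(u <- r) mcoeff u p * \prod_i v i 0 ^+ (u : multinom m) i); last by apply/funext => v; rewrite big_cons.
apply: pdeg_D; last by apply: IH => x xr; apply: sr; rewrite inE xr orbT.
have <- : mdeg u = e by apply: hp; apply: sr; exact: mem_head.
rewrite mdegE -[X in pdeg X]add0n.
by apply: pdeg_M; [exact: pdeg_cst|exact: pdeg_monomial].
Qed.

Lemma pfun_poly_fun p : pfun (@poly_fun R m p).
Proof.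
apply: (@pfun_ext _ _ _ _ (fun v => esym (poly_funE p v))).
apply: pfun_sum => u; apply: pfun_M; first exact: pfun_cst.
by exists (\sum_i u i)%N; exact: pdeg_monomial.
Qed.

Lemma poly_fun_hom p e s (v : V) : p \is ishomog1 e mdeg ->
  poly_fun p (s *: v) = s ^+ e * poly_fun p v.
Proof.
move=> /dhomogP hp; rewrite !poly_funE mulr_sumr; apply: eq_big_seq => u up.
have ue : mdeg u = e by exact: hp.
rewrite mulrCA; congr (_ * _); rewrite -ue mdegE expr_sum -big_split /=.
by apply: eq_bigr => i _; rewrite mxE exprMn.
Qed.

Lemma pfun_mpoly f : pfun f -> exists p, forall v : V, f v = poly_fun p v.
Proof.
case=> e; elim=> {e f} [a|i|e f g _ [p Hp] _ [q Hq]|e e' f g _ [p Hp] _ [q Hq]|//].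
- by exists (mpolyC m a) => v; rewrite /poly_fun mevalC.
- by exists (mpolyX R (mnm1 i)) => v; rewrite /poly_fun mevalXU.
- by exists (p + q) => v; rewrite Hp Hq /poly_fun mevalD.
- by exists (p * q) => v; rewrite Hp Hq /poly_fun mevalM.
Qed.

Lemma poly_fun_comp n (s : n.-tuple (mpoly m R)) (q : mpoly n R) (v : V) :
  poly_fun (comp_mpoly s q) v = \sum_(u <- msupp q) mcoeff u q * \prod_i poly_fun (tnth s i) v ^+ u i.
Proof.
rewrite /poly_fun comp_mpolyE raddf_sum /=; apply: eq_bigr => u _.
rewrite mevalZ rmorph_prod; congr (_ * _); apply: eq_bigr => i _.
by rewrite rmorphXn.
Qed.
End Mpoly.

Lemma polygen_prod (R : realType) (T I J : Type) (tau : I -> T -> R) (r : seq J) (F : J -> T -> R) :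
  (forall i, polygen tau (F i)) -> polygen tau (fun u => \prod_(i <- r) F i u).
Proof.
move=> HF; elim: r => [|i r IH].
  by apply: polygen_ext (pg_cst tau 1) => u; rewrite big_nil.
by apply: polygen_ext (pg_M (HF i) IH) => u; rewrite big_cons.
Qed.

Lemma polygen_exp (R : realType) (T I : Type) (tau : I -> T -> R) f n :
  polygen tau f -> polygen tau (fun u => f u ^+ n).
Proof.
move=> Hf; elim: n => [|n IH]; first by apply: polygen_ext (pg_cst tau 1) => u; rewrite expr0.
by apply: polygen_ext (pg_M Hf IH) => u; rewrite exprS.
Qed.

Lemma polygen_trans (R : realType) (T I J : Type) (tau : I -> T -> R) (sg : J -> T -> R) f :
  polygen tau f -> (forall i, polygen sg (tau i)) -> polygen sg f.
Proof.
move=> pf H; elim: pf => [a|i|f1 f2 _ H1 _ H2|f1 f2 _ H1 _ H2].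
- exact: pg_cst.
- exact: H.
- exact: pg_D.
- exact: pg_M.
Qed.

Section Base.
Context (R : realType) (gT : finGroupType) (G : {group gT}) (m : nat).
Context (rG : mx_representation R G m).
Hypothesis orth : orthogonal_repr rG.
Notation V := 'cV[R]_m.
Notation rho := (rho rG).

Definition gens n (s : n.-tuple (mpoly m R)) (i : 'I_n) (v : V) := poly_fun (tnth s i) v.

Lemma generators_gen n (s : n.-tuple (mpoly m R)) f : homogeneous_generators rG s ->
  pfun f -> (forall h x, h \in G -> f (rho h x) = f x) -> polygen (gens s) f.
Proof.
move=> [_ _ Hs] /pfun_mpoly[p Hp] fG.
have [|q Eq] := Hs p.
  by move=> g gG v; rewrite -!Hp; exact: fG.
apply: (@polygen_ext _ _ _ _ (fun v => \sum_(u <- msupp q) mcoeff u q * \prod_i gens s i v ^+ (u : multinom n) i)).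
  by move=> v; rewrite Hp Eq poly_fun_comp.
apply: polygen_sum => u; apply: pg_M; first exact: pg_cst.
by apply: polygen_prod => i; apply: polygen_exp; exact: pg_gen.
Qed.

Lemma generators_inv n (s : n.-tuple (mpoly m R)) : homogeneous_generators rG s ->
  forall i h x, h \in G -> gens s i (rho h x) = gens s i x.
Proof. by move=> [Hs _ _] i h x hG; exact: Hs. Qed.

(** Germs of orbits are scaled into the neighborhood U of property B; scaling acts on
    each homogeneous generator by a constant factor and thus preserves the class.
    The factor is removed from the lift afterwards. *)
Lemma base_lifting n (sg : n.-tuple (mpoly m R)) (I : finType) (tau : I -> V -> R) k :
  homogeneous_generators rG sg -> property_B sg k ->
  (forall i, polygen tau (gens sg i)) ->
  (forall i, pfun (tau i)) ->
  (forall i h x, h \in G -> tau i (rho h x) = tau i x) ->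
  lifting k tau.
Proof.
move=> sgG [U [Usub Unbhs UB]] sgtau ptau itau t e ek ex.
have /choice[y Hy] : forall x : R, exists y : V, (exists y', forall i, tau i y' = e i x) ->
    forall i, tau i y = e i x.
  move=> x; have [[y Hy]|ny] := pselect (exists y', forall i, tau i y' = e i x).
    by exists y.
  by exists 0.
have yE : \forall x \near t, forall i, tau i (y x) = e i x.
  by apply: filterS ex => x; exact: Hy.
have [_ sghom _] := sgG.
have /choice[dg Hdg] : forall l, exists e, (0 < e)%N /\ tnth sg l \is ishomog1 e mdeg.
  by move=> l; have [e0 e00 He0] := sghom l; exists e0.
have sgk l : ncl k t (fun x => gens sg l (y x)).
  apply: polygen_ncl (sgtau l) _ => i.
  by apply: ncl_ext (ek i); apply: filterS yE => x ->.
have [eps /= eps0 Heps] : exists2 eps : R, 0 < eps & forall z, range (orbit_map sg) z -> `|z| < eps -> U z.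
  move: Unbhs; rewrite /within /= => /nbhs_ballP[eps eps0 Heps]; exists eps => // z rz zeps.
  by apply: Heps => //; rewrite -ball_normE /= sub0r normrN.
have [r r0 Hr] : exists2 r : R, 0 < r & `|orbit_map sg (r *: y t)| < eps.
  pose N := `|orbit_map sg (y t)|.
  have N0 : 0 <= N by exact: normr_ge0.
  pose r := Num.min 1 (eps / (2 * (N + 1))).
  have q0 : 0 < eps / (2 * (N + 1)) by apply: divr_gt0 => //; lra.
  have r0 : 0 < r by rewrite lt_min ltr01.
  have r1 : r <= 1 by rewrite ge_min lexx.
  have rq : r * (2 * (N + 1)) <= eps.
    by rewrite -ler_pdivlMr ?ge_min ?lexx ?orbT //; lra.
  exists r => //; apply: (@le_lt_trans _ _ (r * N)); last by nra.
  apply: mx_norm_le => [|l j]; first by rewrite mulr_ge0 // ltW.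
  have [dl Hl] := Hdg l; rewrite mxE (poly_fun_hom _ _ Hl) normrM.
  apply: ler_pM => //.
    rewrite normrX gtr0_norm //; case: (dg l) dl => // q _.
    by rewrite exprS; apply: ler_piMr; [exact: ltW|apply: exprn_ile1 => //; exact: ltW].
  by have := coord_le_norm (orbit_map sg (y t)) l 0; rewrite mxE.
pose c x := orbit_map sg (r *: y x).
have cE x l : c x l 0 = r ^+ dg l * gens sg l (y x).
  by rewrite mxE; have [_ Hl] := Hdg l; rewrite (poly_fun_hom _ _ Hl).
have ck l : ncl k t (fun x => c x l 0).
  apply: (@ncl_ext _ k t (fun x => r ^+ dg l * gens sg l (y x))).
    by apply: filterE => x; rewrite cE.
  by apply: ncl_M => //; exact: ncl_cst.
have cc : {for t, continuous c}.
  by apply: mx_cvgP => l j; rewrite (ord1 j); exact: ncl_cont (ck l).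
have cU : \forall x \near t, U (c x).
  have d0 : 0 < eps - `|c t| by rewrite subr_gt0.
  move/cvgrPdist_lt : cc => /(_ _ d0); apply: filterS => x Hx.
  apply: Heps; first by exists (r *: y x).
  have := ler_distD (c t) (c x) 0; rewrite !subr0 distrC; lra.
have /nbhs_ballP[de /= de0 Hde] : \forall x \near t, U (c x) /\ forall l, gcl k x (fun x => c x l 0).
  by apply: filterS2 cU (near_forall ck).
have tI : ball t de t by exact: ballxx.
have [||||J [b [[Jop Jt] JI bc bd bb]]] := UB (ball t de) c _ _ _ _ t tI.
- exact: ball_open.
- move=> x z; rewrite /ball /= => xt zt w /andP[xw wz].
  by move: xt zt; rewrite !ltr_norml => /andP[? ?] /andP[? ?]; apply/andP; split; lra.
- by apply: coord_of_class => x /Hde[].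
- by move=> x /Hde[].
have Jn : \forall x \near t, J x by apply: open_nbhs_nbhs.
have bdn : \forall x \near t, derivable b x 1 by apply: filterS Jn => x /bd.
exists (fun x => r^-1 *: b x); split.
- apply: filterS2 Jn yE => x Jx yx i; rewrite -yx.
  have E l : gens sg l (b x) = gens sg l (r *: y x).
    by have := bc x Jx => /(congr1 (fun M : 'cV[R]_n => M l 0)); rewrite !mxE.
  have pr : polygen (gens sg) (fun w => tau i (r^-1 *: w)).
    apply: generators_gen => // [|h w hG]; last by rewrite -rhoZ itau.
    apply: (@pfun_ext _ _ (fun w => tau i (r^-1%:M *m w))).
      by move=> w; rewrite mul_scalar_mx.
    exact: pfun_mul.
  by rewrite (polygen_eq pr E) scalerK // gt_eqF.
- by apply: filterS bdn => x; exact: derivableZ.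
- have /nbhs_ballP[d1 /= d10 Hd1] := Jn.
  have d2 : 0 < d1 / 2 by rewrite divr_gt0.
  have cpt : compact `[t - d1 / 2, t + d1 / 2]%classic by exact: segment_compact.
  have subJ : `[t - d1 / 2, t + d1 / 2]%classic `<=` J.
    move=> x /=; rewrite in_itv /= => /andP[h1 h2]; apply: Hd1.
    by rewrite /ball /= ltr_norml; apply/andP; split; lra.
  have [B0 [_ HB]] := bb _ cpt subJ.
  have B1 : B0 < B0 + 1 by rewrite ltrDl.
  have {}HB := HB (B0 + 1) B1.
  exists (`|r^-1| * (B0 + 1)).
  have near_seg : \forall x \near t, t - d1 / 2 <= x <= t + d1 / 2.
    apply/nbhs_ballP; exists (d1 / 2) => //= x; rewrite /ball /= ltr_norml => /andP[? ?].
    by apply/andP; split; lra.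
  apply: filterS2 bdn near_seg => x bx xs.
  have -> : derive1 (fun x => r^-1 *: b x) x = r^-1 *: derive1 b x.
    have [_ DV] := is_deriveZ r^-1 (derivableP bx).
    by rewrite !derive1E; exact: DV.
  rewrite normrZ; apply: ler_wpM2l => //; apply: HB.
  by rewrite /= in_itv.
Qed.
End Base.

(** * Lifts of second order and their global selection *)

Section Final.
Context (R : realType) (gT : finGroupType) (G : {group gT}) (m : nat).
Context (rG : mx_representation R G m).
Hypothesis orth : orthogonal_repr rG.
Notation V := 'cV[R]_m.
Notation rho := (rho rG).

(** The minimal system bounds the degrees by d.  The zero polynomial is left out: it
    is homogeneous of every degree, so that no degree can be assigned to it. *)
Lemma base_model n (sg : n.-tuple (mpoly m R)) k d d' :
  homogeneous_generators rG sg -> max_generator_degree rG d -> property_B sg k ->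
  (d <= d')%N ->
  exists (I : finType) (tau : I -> V -> R) (dg : I -> nat),
    [/\ model rG G tau dg d' k, forall i, (dg i <= d)%N,
        forall l, polygen tau (gens sg l) & forall i, polygen (gens sg) (tau i)].
Proof.
move=> sgG [s0 [s0G _] dE] HB dd'.
pose s := in_tuple s0.
pose I : finType := {i : 'I_(size s0) | tnth s i != 0}.
pose tau (i : I) : V -> R := gens s (val i).
pose dg (i : I) := (msize (tnth s (val i))).-1.
have [sinv shom _] := s0G.
have hom (i : I) : tnth s (val i) \is ishomog1 (dg i) mdeg.
  by have [e _ He] := shom (val i); exact: dhomog_msize He.
have stau l : polygen tau (gens s l).
  have [s_l|s_l] := eqVneq (tnth s l) 0; last exact: (pg_gen tau (exist _ l s_l)).
  apply: (@polygen_ext _ _ _ _ (fun _ => 0)); last exact: pg_cst.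
  by move=> v; rewrite /gens s_l /poly_fun meval0.
have gen f : pfun f -> (forall h x, h \in G -> f (rho h x) = f x) -> polygen tau f.
  by move=> pf fG; apply: polygen_trans (generators_gen s0G pf fG) stau.
have ptau i : pfun (tau i) by exact: pfun_poly_fun.
have itau i h x : h \in G -> tau i (rho h x) = tau i x.
  by move=> hG; exact: generators_inv s0G _ _ _ hG.
have sgtau l : polygen tau (gens sg l).
  by apply: gen; [exact: pfun_poly_fun|exact: generators_inv].
have dgd i : (dg i <= d)%N.
  by rewrite dE /dg; apply: (@leq_bigmax_seq _ s0 xpredT (fun p : mpoly m R => (msize p).-1)) => //; exact: (mem_tnth (val i) s).
exists I, tau, dg; split=> //; last first.
  by move=> i; apply: (generators_gen sgG) => // h x hG; exact: itau.
split=> //.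
- by move=> i c x; exact: poly_fun_hom (hom i).
- move=> i; have [e e0 He] := shom (val i).
  by rewrite -(dhomog_uniq (valP i) He (hom i)).
- by move=> i; exact: leq_trans (dgd i) dd'.
- by move=> i; exact: pdeg_poly_fun (hom i).
- exact: base_lifting sgG HB sgtau ptau itau.
Qed.

(** The number e has to be general for the induction; for a product of degree at most
    1, one factor has degree 0 and is constant. *)
Lemma pdeg1_affine e (f : V -> R) : pdeg e f -> (e <= 1)%N ->
  (forall x y, f (x + y) + f 0 = f x + f y) /\ (e = 0%N -> forall x, f x = f 0).
Proof.
elim=> {e f} [a|i|e f g _ Hf _ Hg|e e' f g _ Hf _ Hg|e e' f ee' _ Hf] e1.
- by [].
- by split=> // x y; rewrite !mxE addr0.
- have [Af Cf] := Hf e1; have [Ag Cg] := Hg e1; split=> [x y|e0 x]; last by rewrite Cf ?Cg.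
  by rewrite addrACA Af Ag addrACA.
- have ef : (e <= 1)%N by lia.
  have eg : (e' <= 1)%N by lia.
  have [Af Cf] := Hf ef; have [Ag Cg] := Hg eg; split=> [x y|ee x]; last by rewrite Cf ?Cg //; lia.
  have [e0|e0] := eqVneq e 0%N.
    rewrite (Cf e0 (x + y)) (Cf e0 x) (Cf e0 y) -!mulrDr; congr (_ * _); exact: Ag.
  have e'0 : e' = 0%N by lia.
  rewrite (Cg e'0 (x + y)) (Cg e'0 x) (Cg e'0 y) -!mulrDl; congr (_ * _); exact: Af.
- have [Af Cf] := Hf (leq_trans ee' e1); split=> // e'0 x.
  by apply: Cf; lia.
Qed.

(** Generators of degree at most one are linear and separate orbits, so that the
    action is trivial and the coordinates themselves are invariant. *)
Lemma linear_case (I : finType) (tau : I -> V -> R) dg d k : model rG G tau dg d k ->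
  (forall i, (dg i <= 1)%N) -> forall j, polygen tau (fun v : V => v j 0).
Proof.
move=> M dg1 j; apply: (m_gen M) => [|h x hG]; first exact: pfun_X.
suff -> : rho h x = x by [].
have tau0 i : tau i 0 = 0.
  by rewrite -(scale0r 0) (m_hom M) expr0n (negbTE (lt0n_neq0 (m_pos M i))) mul0r.
have aff i u w : tau i (u + w) = tau i u + tau i w.
  by have [A _] := pdeg1_affine (m_pdeg M i) (dg1 i); rewrite -A tau0 addr0.
have z i : tau i (rho h x - x) = tau i 0.
  apply: (addIr (tau i x)); rewrite -aff subrK (m_inv M) //.
  by rewrite tau0 add0r.
have [g gG] := separates M z; move=> /(congr1 (rho g^-1%g)); rewrite rhoVK //.
have -> : rho g^-1%g 0 = 0 by exact: mulmx0.
by move=> /esym/eqP; rewrite subr_eq0 => /eqP.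
Qed.

Section Curve.
Variables (n : nat) (sg : n.-tuple (mpoly m R)) (c : R -> 'cV[R]_n).

Definition local_lift (t : R) (b : R -> V) :=
  (\forall x \near t, orbit_map sg (b x) = c x) /\ \forall x \near t, derivable b x 1.

(** The blow-up needs a bound d of at least 2 on the degrees.  If d is smaller and k is
    infinite or analytic, d can be replaced by a larger bound without changing the
    class of c.  If k is finite, the action is trivial and any lift has the class
    of c. *)
Lemma local_second_order k d : 
  homogeneous_generators rG sg -> max_generator_degree rG d -> property_B sg k ->
  (forall t, range (orbit_map sg) (c t)) ->
  of_class (smooth_add k (2 * d)) setT c ->
  forall t, exists b, local_lift t b /\ derivable (derive1 b) t 1.
Proof.
move=> sgG dmax HB cr ck t.
have /choice[y Hy] : forall x, exists y, orbit_map sg y = c x.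
  by move=> x; have [y _ yE] := cr x; exists y.
have yE x l : gens sg l (y x) = c x l 0 by rewrite -Hy mxE.
have reg f : polygen (gens sg) f -> ncl (smooth_add k (2 * d)) t (fun x => f (y x)).
  move=> pf; apply: polygen_ncl pf _ => l.
  by apply: ncl_ext (of_class_coord l t ck); apply: filterE => x; rewrite yE.
have back (I : finType) (tau : I -> V -> R) (b : R -> V) x : (forall l, polygen tau (gens sg l)) ->
    (forall i, tau i (b x) = tau i (y x)) -> orbit_map sg (b x) = c x.
  move=> sgtau E; apply/matrixP => l j; rewrite (ord1 j) -yE mxE.
  exact: polygen_eq (sgtau l) E.
have general d' : (d <= d')%N -> (2 <= d')%N -> smooth_add k (2 * d') = smooth_add k (2 * d) ->
    exists b, local_lift t b /\ derivable (derive1 b) t 1.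
  move=> dd' d'2 kE; have [I [tau [dg [M _ sgtau tausg]]]] := base_model sgG dmax HB dd'.
  have [||b [bE bd b2]] := @second_order_lift _ _ _ _ _ orth G I tau dg d' k t (fun i x => tau i (y x)) M d'2.
  - by move=> i; rewrite kE; exact: reg.
  - by apply: filterE => x; exists (y x).
  exists b; split=> //; split=> //.
  by apply: filterS bE => x; exact: back.
have [d2|d1] := leqP 2 d; first exact: (general d).
case: (k) general reg HB => [N||] general reg HB; last 2 first.
- by apply: (general (d + 2)%N); rewrite ?leq_addr ?leq_addl.
- by apply: (general (d + 2)%N); rewrite ?leq_addr ?leq_addl.
have [I [tau [dg [M dgd sgtau tausg]]]] := base_model sgG dmax HB (leqnn d).
have dg1 i : (dg i <= 1)%N by apply: leq_trans (dgd i) _; rewrite -ltnS.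
have yk j : ncl (Cfin 2) t (fun x => y x j 0).
  apply: polygen_ncl (linear_case M dg1 j) _ => i.
  have dE : d = 1%N by have := m_pos M i; have := dgd i; lia.
  apply: (@ncl_weak _ (Cfin 2) N); have := reg _ (tausg i).
  by rewrite dE /= addnC.
have yd : \forall x \near t, derivable y x 1.
  have : \forall x \near t, forall j, derivable (fun x => y x j 0) (x : R) 1.
    apply: near_forall => j; have [f' [Hf _]] := ncl_gcl (yk j).
    by apply: filterS Hf => x [].
  by apply: filterS => x Hx; apply/derivable_mxP => i j; rewrite (ord1 j).
exists y; split; first by split=> //; apply: filterE => x; exact: Hy.
apply/derivable_mxP => i j; rewrite (ord1 j).
have [f' [Hf [f'' [Hf' _]]]] := ncl_gcl (yk i).
apply: (@near_eq_derivable _ _ _ f'); last by have [] := nbhs_singleton Hf'.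
apply: filterS2 yd Hf => x yx fx.
by have [_ <-] := coord_derive i yx; have [_ ->] := fx.
Qed.

Lemma local_lift_near t b : local_lift t b -> \forall x \near t, local_lift x b.
Proof. by move=> [/near2 H1 /near2 H2]; apply: filterS2 H1 H2. Qed.

Hypothesis sgG : homogeneous_generators rG sg.

Definition act2 g (w : V * V) : V * V := (rho g w.1, rho g w.2).

(** The 1-jets at t of the local lifts; they form a single orbit. *)
Definition jets (t : R) (w : V * V) :=
  exists2 b, local_lift t b & w = (b t, derive1 b t).

Lemma dv_derive1 (W : normedModType R) (b : R -> W) (t : R) : derivable b t 1 -> dv t b (derive1 b t).
Proof. by move=> bt; apply/dvP; rewrite derive1E; exact: derivableP. Qed.

Lemma dv_rho t (b : R -> V) l g : dv t b l -> dv t (fun x => rho g (b x)) (rho g l).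
Proof. by move=> /dvP H; apply/dvP; exact: is_derive_mulmx. Qed.

Lemma orbit_map_separates v w : orbit_map sg v = orbit_map sg w -> exists2 g, g \in G & w = rho g v.
Proof.
move=> E; have pg : polygen (gens sg) (orbdist rG G w).
  apply: (generators_gen sgG); first exact: orbdist_pfun.
  by move=> h x hG; exact: orbdist_inv.
have := polygen_eq (y := v) (y' := w) pg.
have E' l : gens sg l v = gens sg l w by have := congr1 (fun M : 'cV[R]_n => M l 0) E; rewrite !mxE.
move=> /(_ E'); rewrite orbdist_self => /eqP.
rewrite prodf_seq_eq0 => /hasP[h _ /andP[hG /eqP/normsq_eq0/eqP]].
by rewrite subr_eq0 => /eqP <-; exists h.
Qed.

Lemma orbit_map_rho g v : g \in G -> orbit_map sg (rho g v) = orbit_map sg v.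
Proof.
move=> gG; apply/matrixP => l j; rewrite !mxE; exact: generators_inv sgG _ _ _ gG.
Qed.

Lemma jets_orbit t u v : jets t u -> jets t v -> exists2 g, g \in G & v = act2 g u.
Proof.
move=> [b [bl bd] ->] [b' [bl' bd'] ->].
have [] := @orbit_jet R V gT G rho t b' b (derive1 b' t) (derive1 b t).
- by move=> g gG; apply: dv_rho; exact: dv_derive1 (nbhs_singleton bd).
- exact: dv_derive1 (nbhs_singleton bd').
- apply: filterS2 bl bl' => x E E'; apply: orbit_map_separates.
  by rewrite E E'.
- by move=> g gG [-> ->]; exists g.
Qed.

Lemma jets_act t u g : g \in G -> jets t u -> jets t (act2 g u).
Proof.
move=> gG [b [bl bd] ->]; exists (fun x => rho g (b x)).
  split.
    by apply: filterS bl => x <-; rewrite orbit_map_rho.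
  by apply: filterS bd => x /dv_derive1/(dv_rho g)/dvP[].
have /dvP[_ D] := dv_rho g (dv_derive1 (nbhs_singleton bd)).
by rewrite [X in _ = (_, X)]derive1E /act2 /= -D.
Qed.

(** The jets of lifts are orbits in the space of 1-jets.  A local lift b
    whose derivative is differentiable at t makes (b, b') a selection of the jets near
    t that is differentiable at t.  So there is a global differentiable selection of
    the jets; its first component is the required lift, and its second component is
    the derivative of the first. *)
Lemma global_lift :
  (forall t, exists b, local_lift t b /\ derivable (derive1 b) t 1) ->
  exists cbar : R -> V,
    [/\ lift_on sg setT c cbar, differentiable_on setT cbar
      & differentiable_on setT (derive1 cbar)].
Proof.
move=> loc.
pose C := 1 + \sum_(g : gT) \sum_i \sum_j `|rG g i j|.
have C1 : 1 <= C by rewrite lerDl !sumr_ge0 // => g _; rewrite sumr_ge0 // => i _; rewrite sumr_ge0.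
have rho_norm g v : `|rho g v| <= C * `|v|.
  apply: le_trans (mulmx_norm _ _) _; apply: ler_wpM2r => //.
  rewrite /C (bigD1 g) //= addrCA lerDl addr_ge0 // sumr_ge0 // => h _.
  by apply: sumr_ge0 => i _; apply: sumr_ge0.
have jets_local t : exists b l, local_at jets t b l.
  have [b [bl b2]] := loc t.
  exists (fun x => (b x, derive1 b x)), (derive1 b t, derive1 (derive1 b) t); split.
    have /nbhs_ballP[d /= d0 Hd] := local_lift_near bl; exists d => // s sd.
    by exists b => //; apply: Hd; rewrite /ball /= distrC.
  apply: dv_pair; last exact: dv_derive1.
  by apply: dv_derive1; have [_ bd] := bl; exact: nbhs_singleton bd.
have [f Hf] : exists f, forall t, selat jets t f.
  apply: (@differentiable_selection R (V * V)%type gT G act2 C) => //.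
  - by move=> [u v]; rewrite /act2 !rho1.
  - by move=> g h gG hG [u v]; rewrite /act2 !rhoM.
  - by move=> g gG a [u1 u2] [v1 v2]; rewrite /act2 /= !rhoD !rhoZ.
  - by move=> g gG [u1 u2]; rewrite !prod_normE /= maxr_pMr ?le_max2 ?rho_norm //; lra.
  - exact: jets_orbit.
  - by move=> t u g; exact: jets_act.
pose cbar x := (f x).1.
have cbarE t : orbit_map sg (cbar t) = c t.
  by have [[b [bl _] fE] _] := Hf t; rewrite /cbar fE; exact: nbhs_singleton bl.
(* Near t the selection f runs through the same orbits as the jets of b, so that its
   jet at t is in the orbit of the jet of the latter; in particular the derivative of
   the first component is the second component. *)
have fd t : is_derive t (1 : R) cbar (f t).2.
  have [_ [l Hl]] := Hf t; have [b [bl b2]] := loc t.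
  have bt := nbhs_singleton bl.2.
  have [||g gG [e1 e2]] := @orbit_jet R (V * V)%type gT G act2 t f (fun x => (b x, derive1 b x)) l
      (derive1 b t, derive1 (derive1 b) t) _ Hl.
  - by move=> g gG; apply: dv_pair; apply: dv_rho; exact: dv_derive1.
  - apply: filterS (local_lift_near bl) => x bx; apply: jets_orbit (Hf x).1.
    by exists b.
  by apply/dvP; have := dv_fst Hl; rewrite e1 e2.
have dcbar : derive1 cbar = fun t => (f t).2.
  by apply/funext => t; have [_ <-] := fd t; rewrite derive1E.
exists cbar; split.
- by move=> t _; exact: cbarE.
- by move=> t _; have [] := fd t.
- move=> t _; rewrite dcbar; have [_ [l Hl]] := Hf t.
  by have /dvP[] := dv_snd Hl.
Qed.
End Curve.
End Final.

Theorem theorem5p2 (R : realType) (gT : finGroupType) (G : {group gT})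
    (m : nat) (rG : mx_representation R G m) (n : nat)
    (sigma : n.-tuple (mpoly m R)) (k : smoothness) (d : nat)
    (c : R -> 'cV[R]_n) :
  orthogonal_repr rG ->
  homogeneous_generators rG sigma ->
  max_generator_degree rG d ->
  property_B sigma k ->
  (forall t, range (orbit_map sigma) (c t)) ->
  of_class (smooth_add k (2 * d)) setT c ->
  exists cbar : R -> 'cV[R]_m,
    [/\ lift_on sigma setT c cbar,
        differentiable_on setT cbar
      & differentiable_on setT (derive1 cbar)].
Proof.
move=> orth sG dmax HB cr ck; apply: (global_lift sG).
exact: (local_second_order orth sG dmax HB cr ck).
Qed.
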